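(* Let $W$ be a random variable in the minimal Kahane--Peyri\`ere regime, and let $\widetilde\mu^{\mathbb T}$ be the dyadic scalar Mandelbrot cascade on $\mathbb T=\mathbb R/\mathbb Z$ generated by $W$. Let $\gamma:\mathbb T\to\mathbb R^2$ be a fixed nondegenerate $C^2$ Jordan curve, and set $\mu_\gamma^{\mathbb T}=\gamma_\#\widetilde\mu^{\mathbb T}$ and $S_\gamma^{\mathbb T}=\{\widetilde\mu^{\mathbb T}(\mathbb T)>0\}$. Then, almost surely on $S_\gamma^{\mathbb T}$, $$\dim_{\mathrm F}(\mu_\gamma^{\mathbb T})=A_{\mathrm{loc}}(W).$$ Moreover, if $A_{\mathrm{loc}}(W)>0$, then, almost surely on $S_\gamma^{\mathbb T}$, for every $0<\sigma<A_{\mathrm{loc}}(W)$ there are finite random constants $C_\sigma,R_\sigma<\infty$ such that $$|\widehat{\mu_\gamma^{\mathbb T}}(\xi)|\le C_\sigma|\xi|^{-\sigma/2}\qquad(|\xi|\ge R_\sigma,\ \xi\in\mathbb R^2).$$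
   Context: Minimal Kahane--Peyri\`ere regime: $W\ge0$, $\mathbb E W=1$, $\mathbb E[W\log_2^+W]<\infty$ and $\mathbb E[W\log_2W]<1$, where $\log_2^+x=\max\{\log_2x,0\}$ and $0\log_20=0$. Endpoint exponent: $A_{\mathrm{loc}}(W)=\sup_{q>1}\max\{0,\ (q-1-\log_2\mathbb E[W^q])/q\}$, where the $q$-term is interpreted as $0$ whenever $\mathbb E[W^q]=\infty$. Dyadic scalar cascade on $\mathbb T$: for $v=(v_1,\dots,v_n)\in\{0,1\}^n$ let $a_v=\sum_{j=1}^nv_j2^{-j}$ and let $J_v\subset\mathbb T$ be the image of $[a_v,a_v+2^{-n})$. Attach i.i.d. copies $W_v$ of $W$ to all nonempty finite binary words $v$; put $Q_v=\prod_{j=1}^nW_{v|j}$, where $v|j=(v_1,\dots,v_j)$, and $Q_\varnothing=1$. Let $\widetilde\mu^{\mathbb T}_n$ have density $\sum_{|v|=n}Q_v\mathbf 1_{J_v}$ with respect to Lebesgue measure on $\mathbb T$. Almost surely $\widetilde\mu^{\mathbb T}_n$ converges weakly to a finite random Borel measure $\widetilde\mu^{\mathbb T}$, the cascade generated by $W$. A fixed nondegenerate $C^2$ Jordan curve is a $C^2$ embedding $\gamma:\mathbb T\to\mathbb R^2$ (deterministic) with $\inf_{\mathbb T}|\gamma'|>0$ and $\inf_{\mathbb T}|\det(\gamma',\gamma'')|>0$, derivatives being those of the associated $1$-periodic $C^2$ map on $\mathbb R$. For a finite Borel measure $\eta$ on $\mathbb R^2$, $\widehat\eta(\xi)=\int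 e^{-2\pi ix\cdot\xi}\,d\eta(x)$. For nonzero $\eta$, $\dim_{\mathrm F}(\eta)=\sup\{0\le\sigma\le2:\ |\widehat\eta(\xi)|=O(|\xi|^{-\sigma/2})\text{ as }|\xi|\to\infty\}$. *)

(* Defs.v *)
From HB Require Import structures.
From mathcomp Require Import all_boot all_order all_algebra generic_quotient finmap.
From mathcomp Require Import all_classical all_reals all_analysis.
From mathcomp.real_closed Require Import complex.

Set Implicit Arguments.
Unset Strict Implicit.
Unset Printing Implicit Defensive.

Import Order.TTheory GRing.Theory Num.Theory.
Import numFieldNormedType.Exports.

Local Open Scope classical_set_scope.
Local Open Scope quotient_scope.
Local Open Scope ring_scope.

Section Torus.
Variable R : realType.

Definition congr_int (x y : R) : bool := (x - y) \is a Num.int.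

Lemma congr_int_refl : reflexive congr_int.
Proof. by move=> x; rewrite /congr_int subrr rpred0. Qed.

Lemma congr_int_sym : symmetric congr_int.
Proof. by move=> x y; rewrite /congr_int -opprB rpredN. Qed.

Lemma congr_int_trans : transitive congr_int.
Proof.
by move=> y x z xy yz; rewrite /congr_int -(subrK y x) -addrA rpredD.
Qed.

Canonical congr_int_equiv :=
  EquivRel congr_int congr_int_refl congr_int_sym congr_int_trans.

(* The circle R / Z as a topological quotient, with its Borel sigma-algebra. *)
Definition torus : Type := quotient_topology {eq_quot congr_int_equiv}.

HB.instance Definition _ := PointedTopological.on torus.
HB.instance Definition _ := Quotient.on torus.
HB.instance Definition _ :=
  Measurable.copy torus (g_sigma_algebraType (@open torus)).

Definition to_torus (x : R) : torus := \pi_torus x.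

(* [0, 1) is a fundamental domain of R / Z. *)
Definition torus_lebesgue : set torus -> \bar R :=
  pushforward (mrestr lebesgue_measure (measurable_itv `[0 : R, 1[)) to_torus.

End Torus.

Section KahanePeyriere.
Context (d : measure_display) (T : measurableType d) (R : realType).
Implicit Type P : probability T R.

Definition log2 (x : R) : R := ln x / ln 2.

(* The convention 0 log2 0 = 0 holds because ln 0 = 0 in the library.
   Expectations take values in \bar R.                                    *)
Definition minimal_Kahane_Peyriere P (W : {RV P >-> R}) : Prop :=
  [/\ {ae P, forall w, 0 <= W w},
      ('E_P[W] = 1)%E,
      ('E_P[fun w => (W w * Num.max (log2 (W w)) 0)%R] < +oo)%E &
      ('E_P[fun w => (W w * log2 (W w))%R] < 1%:E)%E].

Definition local_exponent_term P (W : {RV P >-> R}) (q : R) : R :=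
  let m := ('E_P[fun w => (W w `^ q)%R])%E in
  if m == +oo%E then 0 else (q - 1 - log2 (fine m)) / q.

(* When 'E_P[W] = 1, Jensen's inequality bounds the terms by 1, so that this
   real supremum is a genuine one.                                        *)
Definition local_exponent P (W : {RV P >-> R}) : R :=
  sup [set Num.max 0 (local_exponent_term W q) | q in [set q : R | 1 < q]].

Definition mutually_independent (I : choiceType) P (D : set I)
    (X : I -> {RV P >-> R}) : Prop :=
  forall (J : {fset I}) (A : I -> set R), [set` J] `<=` D ->
    (forall i, measurable (A i)) ->
    P (\bigcap_(i in [set` J]) X i @^-1` A i) =
      (\prod_(i <- J) P (X i @^-1` A i))%E.

End KahanePeyriere.

Definition iid_copies (d0 : measure_display) (T0 : measurableType d0)
    (d : measure_display) (T : measurableType d) (R : realType)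
    (P0 : probability T0 R) (P : probability T R) (I : choiceType) (D : set I)
    (W : {RV P0 >-> R}) (X : I -> {RV P >-> R}) : Prop :=
  (forall i, D i -> forall A : set R, measurable A ->
    distribution P (X i) A = distribution P0 W A) /\
  mutually_independent D X.

Section Cascade.
Variable R : realType.

Definition dyadic_point (v : seq bool) : R :=
  \sum_(j < size v) (nth false v j)%:R / 2 ^+ j.+1.

Definition dyadic_arc (v : seq bool) : set (torus R) :=
  to_torus (R := R) @`
    `[dyadic_point v, dyadic_point v + (2 ^+ size v)^-1[.

Context (d : measure_display) (T : measurableType d) (P : probability T R).

Definition cascade_weight (W : seq bool -> {RV P >-> R}) (v : seq bool)
    (w : T) : R :=
  \prod_(j < size v) W (take j.+1 v) w.

Definition cascade_density (W : seq bool -> {RV P >-> R}) (n : nat) (w : T)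
    (x : torus R) : R :=
  \sum_(v : n.-tuple bool) cascade_weight W v w * \1_(dyadic_arc v) x.

(* This set function is a measure whenever all the weights are nonnegative,
   hence almost surely in the intended use.                               *)
Definition cascade_step (W : seq bool -> {RV P >-> R}) (n : nat) (w : T) :
    set (torus R) -> \bar R :=
  fun A => (\int[@torus_lebesgue R]_(x in A) (cascade_density W n w x)%:E)%E.

(* The circle is compact, so all continuous test functions are bounded. *)
Definition weakly_converges (m : nat -> set (torus R) -> \bar R)
    (l : set (torus R) -> \bar R) : Prop :=
  forall f : torus R -> R, continuous f ->
    (\int[m n]_x (f x)%:E)%E @[n --> \oo] --> (\int[l]_x (f x)%:E)%E.

(* The cascade is only determined up to a null event, so it is given by a
   predicate on random measures (kernels) rather than by a function of W.  *)
Definition is_cascade (W : seq bool -> {RV P >-> R})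
    (mu : R.-ker T ~> torus R) : Prop :=
  (forall w, (mu w [set: torus R] < +oo)%E) /\
  {ae P, forall w, weakly_converges (fun n => cascade_step W n w) (mu w)}.

End Cascade.

Section Plane.
Variable R : realType.
Implicit Types x y xi : R * R.

(* The library norm on R * R is the sup norm. *)
Definition euclidean_norm x : R := Num.sqrt (x.1 ^+ 2 + x.2 ^+ 2).

Definition dot x y : R := x.1 * y.1 + x.2 * y.2.

Definition det2 x y : R := x.1 * y.2 - x.2 * y.1.

(* An injective continuous map on the compact torus is an embedding. *)
Definition nondegenerate_C2_Jordan_curve (gamma : torus R -> R * R) : Prop :=
  let g : R -> R * R := gamma \o @to_torus R in
  [/\ continuous gamma, injective gamma,
      [/\ forall t, derivable g t 1, forall t, derivable (derive1 g) t 1 &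
          continuous (derive1n 2 g)],
      0 < inf (range (fun t => euclidean_norm (derive1 g t))) &
      0 < inf (range (fun t => `|det2 (derive1 g t) (derive1n 2 g t)|))].

Definition complex_integral (eta : set (R * R) -> \bar R) (f : R * R -> R[i]) :
    R[i] :=
  Complex (fine (\int[eta]_x (complex.Re (f x))%:E)%E)
          (fine (\int[eta]_x (complex.Im (f x))%:E)%E).

Definition expi (t : R) : R[i] := Complex (cos t) (sin t).

Definition fourier (eta : set (R * R) -> \bar R) xi : R[i] :=
  complex_integral eta (fun x => expi (- (2 * pi * dot x xi))).

Definition fourier_dimension (eta : set (R * R) -> \bar R) : R :=
  sup [set s : R | 0 <= s <= 2 /\
    exists C r : R, forall xi, r <= euclidean_norm xi ->
      ComplexField.Normc.normc (fourier eta xi) <=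
        C * euclidean_norm xi `^ (- (s / 2))].

End Plane.

(* Main.v *)
(* Write x_v = 2^-|v| Q_v and let Y_v be the total mass of the normalised cascade
   below the word v, so that the arc J_v has mass x_v Y_v.

   Upper bound. Suppose that the transform decays like |xi|^-(s/2). Testing with a
   Fejer kernel whose frequencies are multiples, up to order 4^|v|, of the normal
   to the curve at the left end of J_v gives x_v Y_v <= C 2^-(s |v|) for all v. Let
   g be the tail, in logarithmic scale, of the law of sup_v 2^(s |v|) x_v Y_v. If
   this supremum were finite with positive probability on survival, it would be
   finite almost surely, since the zero-one law of the branching process has a
   unique nontrivial fixed point; then g -> 0 and g(u) >= lam E[g(u - ln Z)] for
   large u, where Z = 2^(s-1) W and lam < 2 is arbitrary. When s exceeds the
   endpoint exponent, 2 E[Z^q] > 1 for all q >= 0, and comparing g with a cut-off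
   of e^(-q u) cos (k u) contradicts g -> 0.

   Lower bound. Let q > 1 and a satisfy 2^(1-q) E[W^q] 2^(a q) < 1, so that
   sup_(|v|=n) x_v <= K 2^-(a n). Exponential moments of the martingale
   differences, with the weights truncated at that level and a compensator
   given by E[W^q], control almost surely the masses of all subtrees and the
   integrals of the waves for all frequencies in a grid. As gamma', gamma'' are
   independent, only boundedly many arcs of each generation are nearly stationary
   for a given frequency, and the other arcs contribute little by integration by
   parts. A Lipschitz estimate extends the decay from the grid to the plane. *)
Require Import Defs.
From HB Require Import structures.
From mathcomp Require Import all_boot all_order all_algebra generic_quotient finmap.
From mathcomp Require Import all_classical all_reals all_analysis.
From mathcomp.real_closed Require Import complex.
From mathcomp Require Import measurable_realfun.
From mathcomp Require Import ring lra zify.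

Set Implicit Arguments.
Unset Strict Implicit.
Unset Printing Implicit Defensive.

Import Order.TTheory GRing.Theory Num.Theory.
Import numFieldNormedType.Exports.

Local Open Scope classical_set_scope.
Local Open Scope ring_scope.

(** * Independent weights indexed by binary words *)

(** Both bounds meet at |xi| = 4^n: curvature keeps a wave coherent on an arc of length |xi|^(-1/2)
    = 2^-n, so an arc mass 2^-(sigma n) corresponds to decay |xi|^-(sigma/2). For the upper bound
    only W log W is integrable. The moments of Z of order above 1 may all be infinite, so no moment
    recursion for the tail is at hand. Since 2 E[Z^q] stays above 1 for all real q, no real
    exponential balances the linear recursion; a complex one does nearly, its real part changes
    sign, and cut at its first zeros it becomes a compactly supported function which the recursion
    strictly increases. For the lower bound q may lie below 2, so second moments may be infinite.
    Truncating at a level that the masses do not exceed bounds the variance by level times mean, and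
    E[W^q] pays only for the part cut off. Union bounds over exponentially many words or frequencies
    cost a factor linear in the generation, which an arbitrarily small loss in the exponent absorbs.
    Conditioning on part of the tree is expressed throughout by resampling the other weights. *)

Section FieldSpace.
Variable R : realType.
Implicit Types (J : {fset seq bool}) (A : seq bool -> set R).

Definition cylinder J A : set (seq bool -> R) :=
  [set w | forall v, v \in J -> A v (w v)].

(* The weight at the empty word never enters a cascade, so the coordinate
   there is left unobserved. *)
Definition cylinders : set (set (seq bool -> R)) :=
  [set C | exists J A, [/\ [::] \notin J, forall v, measurable (A v) &
                           C = cylinder J A]].

Definition field : Type := g_sigma_algebraType cylinders.
HB.instance Definition _ := Measurable.on field.

Lemma cylinders_setI : setI_closed cylinders.
Proof.
move=> _ _ [J1 [A1 [J1n mA1 ->]]] [J2 [A2 [J2n mA2 ->]]].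
exists (J1 `|` J2)%fset,
  (fun v => (if v \in J1 then A1 v else setT) `&`
            (if v \in J2 then A2 v else setT)); split.
- by rewrite inE negb_or J1n.
- by move=> v; apply: measurableI; case: ifP.
- apply/seteqP; split=> w /=.
  + move=> [h1 h2] v _; split; case: ifP => // vJ; [exact: h1|exact: h2].
  + move=> h; split=> v vJ; have := h v; rewrite inE vJ ?orbT => /(_ isT) [].
    * by [].
    * by case: ifP.
Qed.

Lemma cylinders_setT : cylinders setT.
Proof.
exists fset0, (fun=> setT); split=> //; apply/seteqP; split=> //.
Qed.

Lemma measurable_coord v : v != [::] ->
  measurable_fun [set: field] (fun w : field => w v).
Proof.
move=> v0 _ A mA; rewrite setTI; apply: sub_sigma_algebra.
exists [fset v]%fset, (fun=> A); split=> //; first by rewrite inE eq_sym.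
apply/seteqP; split=> w /=; first by move=> h u; rewrite inE => /eqP->.
by apply; rewrite inE.
Qed.

Lemma measurable_field d (T : measurableType d) (V : T -> seq bool -> R) :
  (forall v, v != [::] -> measurable_fun [set: T] (V ^~ v)) ->
  measurable_fun [set: T] (V : T -> field).
Proof.
move=> mV; apply: (@measurability _ _ _ field _ _ cylinders) => //.
move=> _ [_ [J [A [J0 mA ->]] <-]]; rewrite setTI.
rewrite (_ : _ @^-1` _ = \bigcap_(v in [set` J]) ((V ^~ v) @^-1` A v)).
  apply: fin_bigcap_measurable => // v /= vJ.
  rewrite -[X in measurable X]setTI; apply: mV => //.
  by apply: contraNneq J0 => <-.
by apply/seteqP; split=> w /= h v; exact: h.
Qed.

End FieldSpace.
Arguments measurable_coord {R}.

(** Only the finite-dimensional laws at nonempty words are prescribed, through a set function [rho].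
    The ambient [m] is an arbitrary measure, so that the product [m \x m] used for resampling fits
    the same definition; the empty [J] makes the total mass one. *)
Definition iid_field d (T : measurableType d) (R : realType)
    (m : {measure set T -> \bar R}) (rho : set R -> \bar R)
    (U : seq bool -> T -> R) : Prop :=
  (forall v, measurable_fun [set: T] (U v)) /\
  forall (J : {fset seq bool}) (A : seq bool -> set R),
    [::] \notin J -> (forall v, measurable (A v)) ->
    m [set t | forall v, v \in J -> A v (U v t)] = (\prod_(v <- J) rho (A v))%E.

Section IidField.
Context d (T : measurableType d) (R : realType) (rho : set R -> \bar R).
Variables (m : {measure set T -> \bar R}) (U : seq bool -> T -> R).
Hypothesis iidU : iid_field m rho U.

Lemma iid_measurable : measurable_fun [set: T] (fun t => (U ^~ t) : field R).
Proof. by apply: measurable_field => v _; exact: iidU.1. Qed.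

Lemma iid_mass : m setT = 1%E.
Proof.
have := iidU.2 fset0 (fun=> setT).
rewrite big_seq_fset0 => /(_ isT (fun=> measurableT)) <-.
by congr (m _); apply/seteqP; split.
Qed.

(** The cylinders form a pi-system generating the sigma-algebra of [field], so the
    finite-dimensional laws decide every nonnegative integral. All later equalities in law go
    through this lemma. *)
Lemma iid_law d' (T' : measurableType d') (m' : {measure set T' -> \bar R})
    (V : seq bool -> T' -> R) (f : field R -> \bar R) :
  iid_field m' rho V -> measurable_fun [set: field R] f -> (forall w, 0 <= f w)%E ->
  (\int[m]_t f (U ^~ t) = \int[m']_t f (V ^~ t))%E.
Proof.
move=> iidV mf f0.
have mU := iid_measurable.
have mV : measurable_fun [set: T'] (fun t => (V ^~ t) : field R).
  by apply: measurable_field => v _; exact: iidV.1.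
have := @ge0_integral_pushforward _ _ _ (field R) _ _ mU m [set: field R] f measurableT mf.
have := @ge0_integral_pushforward _ _ _ (field R) _ _ mV m' [set: field R] f measurableT mf.
rewrite !preimage_setT => /(_ (fun w _ => f0 w)) <- /(_ (fun w _ => f0 w)) <-.
apply: eq_measure_integral => A mA _.
have cyl_eq C : cylinders C ->
    pushforward m (fun t => (U ^~ t) : field R) C =
    pushforward m' (fun t => (V ^~ t) : field R) C.
  move=> [J [B [J0 mB ->]]]; rewrite /pushforward /=.
  have := iidU.2 J B J0 mB; have := iidV.2 J B J0 mB.
  by rewrite /cylinder /preimage /= => -> ->.
apply: (@measure_unique _ R (field R) (@cylinders R) (fun=> setT)) => //.
- exact: cylinders_setI.
- by move=> _; exact: cylinders_setT.
- by apply/seteqP; split=> // w _; exists 0%N.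
- move=> _ /=; rewrite /pushforward preimage_setT iid_mass.
  by rewrite ltry.
Qed.

End IidField.

Section IidFieldTransforms.
Context d (T : measurableType d) (R : realType) (rho : set R -> \bar R).
Variables (m : probability T R) (U : seq bool -> T -> R).
Hypothesis iidU : iid_field m rho U.

Lemma iid_shift u : iid_field m rho (fun v => U (u ++ v)).
Proof.
split=> [v|J A J0 mA]; first exact: iidU.1.
have := iidU.2 [fset (u ++ v) | v in J]%fset (fun v => A (drop (size u) v)).
rewrite big_imfset /=; last first.
  by move=> x y _ _ /(congr1 (drop (size u))); rewrite !drop_size_cat.
under [X in _ -> _ -> _ = X]eq_bigr do rewrite drop_size_cat//.
move=> <-; last by move=> v; exact: mA.
- congr (m _); apply/seteqP; split=> t /= h v.
  + by move=> /imfsetP[x /= xJ ->]; rewrite drop_size_cat//; exact: h.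
  + move=> vJ; have := h (u ++ v); rewrite drop_size_cat//; apply.
    by rewrite in_imfset.
- apply/imfsetP => -[[|b x] /= xJ]; last by move/(congr1 size); rewrite size_cat /= addnS.
  by move: J0; rewrite xJ.
Qed.

Definition glue (D : pred (seq bool)) (w w' : seq bool -> R) : seq bool -> R :=
  fun v => if D v then w v else w' v.

(** The weights outside [D] are redrawn from an independent copy; the product over [J] factorises
    along [D] and its complement. *)
Lemma iid_glue (D : pred (seq bool)) :
  iid_field (m \x m)%E rho (fun v t => glue D (U ^~ t.1) (U ^~ t.2) v).
Proof.
split=> [v|J A J0 mA].
  rewrite /glue; case: (D v).
  - by apply: measurableT_comp measurable_fst; exact: iidU.1.
  - by apply: measurableT_comp measurable_snd; exact: iidU.1.
pose J1 := [fset v in J | D v]%fset; pose J2 := [fset v in J | ~~ D v]%fset.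
have mc (K : {fset seq bool}) :
    measurable [set t | forall v, v \in K -> A v (U v t)].
  rewrite (_ : [set t | _] = \bigcap_(v in [set` K]) (U v @^-1` A v)).
    apply: fin_bigcap_measurable => // v /= vJ.
    by rewrite -[X in measurable X]setTI; apply: iidU.1.
  by apply/seteqP; split=> w /= h v; exact: h.
rewrite (_ : [set t | _] = [set t | forall v, v \in J1 -> A v (U v t)] `*`
                           [set t | forall v, v \in J2 -> A v (U v t)]); last first.
  apply/seteqP; split=> -[t t'] /=.
  - move=> h; split=> v; rewrite !inE => /andP[vJ Dv]; have := h v vJ.
      by rewrite /glue Dv.
    by rewrite /glue (negbTE Dv).
  - move=> [h1 h2] v vJ; rewrite /glue; case: ifPn => Dv.
      by apply: h1; rewrite !inE vJ.
    by apply: h2; rewrite !inE vJ.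
rewrite /= product_measure1E// (iidU.2 J1) ?(iidU.2 J2)//; last 2 first.
- by rewrite !inE negb_and J0.
- by rewrite !inE negb_and J0.
rewrite [RHS](big_fsetID _ D) /=; congr (_ * _)%E.
Qed.

Lemma iid_split (D : pred (seq bool)) (f : field R -> \bar R) :
  measurable_fun [set: field R] f -> (forall w, 0 <= f w)%E ->
  (\int[m]_t f (U ^~ t) =
   \int[m]_t \int[m]_t' f (glue D (U ^~ t) (U ^~ t')))%E.
Proof.
move=> mf f0.
rewrite (iid_law iidU (iid_glue D) mf f0) fubini_tonelli1//.
apply: (@measurableT_comp _ _ _ _ (field R) _ _ _ (fun t => glue D (U ^~ t.1) (U ^~ t.2))) => //.
exact: (iid_measurable (iid_glue D)).
Qed.

Lemma iid_split_le (D : pred (seq bool)) (f : field R -> \bar R) :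
  measurable_fun [set: field R] f -> (forall w, 0 <= f w)%E ->
  (forall t, \int[m]_t' f (glue D (U ^~ t) (U ^~ t')) <= 1)%E ->
  (\int[m]_t f (U ^~ t) <= 1)%E.
Proof.
move=> mf f0 f1; rewrite (iid_split D)//.
apply: (@le_trans _ _ (\int[m]_t (cst 1%E) t)%E).
  apply: ge0_le_integral => //; first by move=> t _; exact: integral_ge0.
  apply: (@measurable_fun_fubini_tonelli_F _ _ _ _ _ _
    (fun t => f (glue D (U ^~ t.1) (U ^~ t.2)))) => //.
  apply: (@measurableT_comp _ _ _ _ (field R) _ _ _
    (fun t => glue D (U ^~ t.1) (U ^~ t.2))) => //.
  exact: (iid_measurable (iid_glue D)).
by rewrite integral_cst// (iid_mass iidU) mule1.
Qed.

Lemma iid_prod (s : seq (seq bool)) (g : seq bool -> R -> R) :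
  uniq s -> [::] \notin s -> (forall v, measurable_fun setT (g v)) ->
  (forall v x, 0 <= g v x) ->
  (\int[m]_t (\prod_(v <- s) g v (U v t))%:E =
   \prod_(v <- s) \int[m]_t (g v (U v t))%:E)%E.
Proof.
move=> + + mg g0; elim: s => [|u s IH] /=.
  by move=> _ _; rewrite big_nil; under eq_integral do rewrite big_nil;
     rewrite integral_cst// mul1e; exact: (iid_mass iidU).
move=> /andP[us s_uniq]; rewrite inE negb_or => /andP[u0 s0].
rewrite big_cons -IH//.
have mcoord v : v != [::] -> measurable_fun [set: field R] (fun w : field R => g v (w v)).
  by move=> v0; apply: measurableT_comp => //; exact: measurable_coord.
rewrite (@iid_split (pred1 u) (fun w => (\prod_(v <- u :: s) g v (w v))%:E)); last 2 first.
- apply/measurable_EFinP; apply: measurable_prod => v; rewrite inE => vs.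
  apply: mcoord; case/orP: vs => [/eqP->|vs]; first by rewrite eq_sym.
  by apply: contraNneq s0 => <-.
- by move=> w; rewrite lee_fin; apply: prodr_ge0.
under eq_integral => t _.
  under eq_integral => t' _.
    rewrite big_cons /glue /= eqxx.
    rewrite (eq_big_seq (fun v => g v (U v t'))); last first.
      by move=> v vs /=; case: eqP => // vu; move: us; rewrite -vu vs.
    rewrite EFinM; over.
  rewrite ge0_integralZl//; last 3 first.
  - apply/measurable_EFinP; apply: measurable_prod => v vs.
    by apply: measurableT_comp => //; exact: iidU.1.
  - by move=> x _; rewrite lee_fin; apply: prodr_ge0.
  - by rewrite lee_fin.
  over.
rewrite ge0_integralZr//.
- by apply/measurable_EFinP; apply: measurableT_comp => //; exact: iidU.1.
- by move=> x _; rewrite lee_fin.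
- by apply: integral_ge0 => x _; rewrite lee_fin; apply: prodr_ge0.
Qed.

(** Transposing the words [u] and [v] yields another field with the same law, which [iid_law]
    compares with the original. *)
Lemma iid_marginal v (f : R -> \bar R) u : v != [::] -> u != [::] ->
  measurable_fun setT f -> (forall x, 0 <= f x)%E ->
  (\int[m]_t f (U v t) = \int[m]_t f (U u t))%E.
Proof.
move=> v0 u0 mf f0.
have iidW : iid_field m rho (fun w => if w == v then U u else if w == u then U v else U w).
  split=> [w/=|J A J0 mA]; first by case: ifP => _; [|case: ifP => _]; exact: iidU.1.
  pose s w := if w == v then u else if w == u then v else w.
  have sK : involutive s.
    move=> w; rewrite /s; have [->|wv] := eqVneq w v.
      by rewrite eqxx; case: eqP.
    have [->|wu] := eqVneq w u; first by rewrite eqxx.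
    by rewrite (negbTE wv) (negbTE wu).
  have UsE w : (if w == v then U u else if w == u then U v else U w) = U (s w).
    by rewrite /s; case: ifP => //; case: ifP.
  have := iidU.2 [fset s w | w in J]%fset (fun w => A (s w)).
  rewrite big_imfset /=; last by move=> x y _ _; exact: (can_inj sK).
  under [X in _ -> _ -> _ = X]eq_bigr do rewrite sK.
  move=> <-; last by move=> w; exact: mA.
  - congr (m _); apply/seteqP; split=> t /= h w.
    + by move=> /imfsetP[x /= xJ ->]; rewrite sK -UsE; exact: h.
    + by move=> wJ; rewrite UsE -{1}(sK w); apply: h; rewrite in_imfset.
  - apply/imfsetP => -[w wJ] /esym; rewrite /s; case: eqP => [|_]; first by move=> _ /eqP; rewrite (negbTE u0).
    case: eqP => [_ /eqP|_ w0]; first by rewrite (negbTE v0).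
    by move: J0; rewrite -w0 wJ.
have := iid_law iidU iidW (f := fun w => f (w v)).
rewrite eqxx; apply=> //.
by apply: measurableT_comp => //; exact: measurable_coord.
Qed.

End IidFieldTransforms.

(** * Words, masses and dyadic arcs *)

(** With [rcons] as the recursion a new generation is immediate; a permutation gives the recursion
    by [cons] that subtrees require. *)
Fixpoint words (n : nat) : seq (seq bool) :=
  if n is n'.+1 then [seq rcons v b | v <- words n', b <- [:: false; true]]
  else [:: [::]].

Lemma mem_words n v : (v \in words n) = (size v == n).
Proof.
elim: n v => [|n IH] v; first by rewrite inE; case: v.
apply/idP/idP.
- by move=> /allpairsP[[u b] /= [+ _ ->]]; rewrite IH size_rcons eqSS.
- case/lastP: v => // v b; rewrite size_rcons eqSS -IH => vn.
  by apply/allpairsP; exists (v, b); split=> //=; case: (b).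
Qed.

Lemma words_uniq n : uniq (words n).
Proof.
elim: n => [//|n IH]; apply: allpairs_uniq => //.
by move=> [u b] [v c] _ _ /= /rcons_inj.
Qed.

Lemma words_perm_cons n :
  perm_eq (words n.+1)
    (map (cons false) (words n) ++ map (cons true) (words n)).
Proof.
apply: uniq_perm.
- exact: words_uniq.
- have cI b : injective (cons b : seq bool -> seq bool) by move=> u v [].
  rewrite cat_uniq !map_inj_uniq ?words_uniq ?andbT//=.
  by apply/hasPn => _ /mapP[v _ ->]; apply/mapP => -[u _].
- move=> [|[] v]; rewrite mem_words mem_cat /=.
  + by apply/esym/negbTE; rewrite negb_or; apply/andP; split;
      apply/mapP => -[].
  + rewrite eqSS -mem_words; apply/idP/orP => [vn|]; first by right; apply/map_f.
    by case=> /mapP[u un] // [->].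
  + rewrite eqSS -mem_words; apply/idP/orP => [vn|]; first by left; apply/map_f.
    by case=> /mapP[u un] // [->].
Qed.

Lemma size_words n : size (words n) = (2 ^ n)%N.
Proof. by elim: n => [//|n IH]; rewrite size_allpairs IH expnSr. Qed.

Section Words.
Variable R : realType.
Implicit Types (w : seq bool -> R) (v u : seq bool) (F : seq bool -> R).

Lemma sum_words_rcons n F :
  \sum_(v <- words n.+1) F v =
  \sum_(v <- words n) (F (rcons v false) + F (rcons v true)).
Proof.
rewrite big_allpairs_dep /=; apply: eq_bigr => v _.
by rewrite !big_cons big_nil addr0.
Qed.

Lemma sum_words_cons n F :
  \sum_(v <- words n.+1) F v =
  \sum_(v <- words n) F (false :: v) + \sum_(v <- words n) F (true :: v).
Proof. by rewrite (perm_big _ (words_perm_cons n)) big_cat !big_map. Qed.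

Lemma sum_tuple_words n F :
  \sum_(v : n.-tuple bool) F v = \sum_(v <- words n) F v.
Proof.
rewrite -(big_map (@tval n bool) xpredT F); apply: perm_big.
apply: uniq_perm; rewrite ?words_uniq//.
  by rewrite map_inj_uniq ?index_enum_uniq//; exact: val_inj.
move=> v; rewrite mem_words; apply/mapP/eqP => [[t _ ->]|vn]; first exact: size_tuple.
by subst n; exists (in_tuple v); rewrite ?mem_index_enum.
Qed.

Lemma sum_words_take n j (Pr : pred (seq bool)) F : (j <= n)%N ->
  \sum_(v <- words n | Pr (take j v)) F v =
  \sum_(u <- words j | Pr u) \sum_(v <- words n | take j v == u) F v.
Proof.
move=> jn; under [RHS]eq_bigr do rewrite big_mkcond.
rewrite exchange_big /= [LHS]big_mkcond; apply: eq_big_seq => v.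
rewrite mem_words => /eqP vn.
have tj : take j v \in words j by rewrite mem_words size_takel ?vn.
rewrite big_mkcond /= (bigD1_seq _ tj (words_uniq j)) /= eqxx.
rewrite big1 ?addr0; first by case: ifP.
by move=> u; rewrite eq_sym => /negbTE->; case: ifP.
Qed.

Definition weight w v : R := \prod_(j < size v) w (take j.+1 v).
Definition mass w v : R := weight w v / 2 ^+ size v.
Definition total_mass w n : R := \sum_(v <- words n) mass w v.
Definition subtree w u : seq bool -> R := fun v => w (u ++ v).

Lemma weight_nil w : weight w [::] = 1.
Proof. by rewrite /weight big_ord0. Qed.

Lemma weight_rcons w v b :
  weight w (rcons v b) = weight w v * w (rcons v b).
Proof.
rewrite /weight size_rcons big_ord_recr /= take_oversize ?size_rcons//.
by congr (_ * _); apply: eq_bigr => i _; rewrite -cats1 takel_cat.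
Qed.

Lemma weight_cat w u v : weight w (u ++ v) = weight w u * weight (subtree w u) v.
Proof.
elim/last_ind: v => [|v b IH]; first by rewrite cats0 weight_nil mulr1.
by rewrite -rcons_cat !weight_rcons IH mulrA /subtree rcons_cat.
Qed.

Lemma mass_rcons w v b : mass w (rcons v b) = mass w v / 2 * w (rcons v b).
Proof.
by rewrite /mass weight_rcons size_rcons exprSr invfM; ring.
Qed.

Lemma mass_nil w : mass w [::] = 1.
Proof. by rewrite /mass weight_nil expr0 divr1. Qed.

Lemma mass_cat w u v : mass w (u ++ v) = mass w u * mass (subtree w u) v.
Proof. by rewrite /mass weight_cat size_cat exprD invfM; ring. Qed.

Lemma mass_ge0 w v : (forall u, 0 <= w u) -> 0 <= mass w v.
Proof. by move=> w0; rewrite divr_ge0// prodr_ge0. Qed.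

Lemma mass_cons w b v :
  mass w (b :: v) = w [:: b] / 2 * mass (subtree w [:: b]) v.
Proof.
by rewrite -cat1s mass_cat -[[:: b]]/(rcons [::] b) mass_rcons mass_nil; ring.
Qed.

Lemma total_massS w n :
  total_mass w n.+1 =
  (w [:: false] * total_mass (subtree w [:: false]) n +
   w [:: true] * total_mass (subtree w [:: true]) n) / 2.
Proof.
rewrite /total_mass sum_words_cons mulrDl !mulr_sumr !mulr_suml.
by congr (_ + _); apply: eq_bigr => v _; rewrite mass_cons; ring.
Qed.

Lemma subtree_cat w u v : subtree (subtree w u) v = subtree w (u ++ v).
Proof. by apply/funext => z; rewrite /subtree catA. Qed.

Definition dyadic_index v : nat := foldl (fun (k : nat) (b : bool) => k.*2 + b)%N 0%N v.

Lemma dyadic_point_rcons v b :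
  dyadic_point R (rcons v b) = dyadic_point R v + b%:R / 2 ^+ (size v).+1.
Proof.
rewrite /dyadic_point size_rcons big_ord_recr /= nth_rcons ltnn eqxx.
by congr (_ + _); apply: eq_bigr => i _; rewrite nth_rcons ltn_ord.
Qed.

Lemma dyadic_pointE v : dyadic_point R v = (dyadic_index v)%:R / 2 ^+ size v.
Proof.
elim/last_ind: v => [|v b IH]; first by rewrite /dyadic_point big_ord0 mul0r.
rewrite dyadic_point_rcons IH /dyadic_index -cats1 foldl_cat /=.
by rewrite cats1 size_rcons natrD -mul2n natrM exprS; field; rewrite expf_neq0.
Qed.

Lemma dyadic_index_inj u v :
  size u = size v -> dyadic_index u = dyadic_index v -> u = v.
Proof.
elim/last_ind: u v => [|u b IH] v; first by case: v.
case/lastP: v => [|v c]; first by rewrite size_rcons.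
rewrite !size_rcons /dyadic_index -!cats1 !foldl_cat /= => -[suv] uv.
have bc : b = c by move/(congr1 odd): uv; rewrite !oddD !odd_double !oddb.
by rewrite (IH v)//; [rewrite bc|move: uv; rewrite bc => /addIn/double_inj].
Qed.

Lemma dyadic_point_ge0 v : 0 <= dyadic_point R v.
Proof. by rewrite dyadic_pointE divr_ge0. Qed.

Definition dyadic_end v : R := dyadic_point R v + (2 ^+ size v)^-1.

Lemma dyadic_end_rcons v b :
  dyadic_end (rcons v b) =
  dyadic_point R v + (1 + b%:R) / 2 ^+ (size v).+1.
Proof. by rewrite /dyadic_end dyadic_point_rcons size_rcons; ring. Qed.

Lemma dyadic_rconsF v : [/\ dyadic_point R (rcons v false) = dyadic_point R v,
  dyadic_end (rcons v false) = dyadic_point R (rcons v true) &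
  dyadic_end (rcons v true) = dyadic_end v].
Proof.
rewrite !dyadic_end_rcons !dyadic_point_rcons /dyadic_end exprS; split.
- by rewrite mul0r addr0.
- by rewrite addr0.
- by rewrite /=; field; rewrite expf_neq0.
Qed.

Lemma dyadic_lt v : dyadic_point R v < dyadic_end v.
Proof. by rewrite ltrDl invr_gt0 exprn_gt0. Qed.

Lemma dyadic_nested u v :
  dyadic_point R u <= dyadic_point R (u ++ v) /\
  dyadic_end (u ++ v) <= dyadic_end u.
Proof.
elim/last_ind: v => [|v b [IH1 IH2]]; first by rewrite cats0.
rewrite -rcons_cat; split.
  by rewrite dyadic_point_rcons (le_trans IH1)// lerDl divr_ge0.
apply: le_trans IH2; rewrite dyadic_end_rcons /dyadic_end lerD2l exprS invfM mulrA.
by rewrite ler_piMl ?invr_ge0 ?exprn_ge0//; case: (b) => /=; lra.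
Qed.

Lemma dyadic_end_le1 v : dyadic_end v <= 1.
Proof.
have [_] := dyadic_nested [::] v.
by rewrite /= {2}/dyadic_end /dyadic_point big_ord0 add0r expr0 invr1.
Qed.

End Words.

(** * Real powers of two *)

Section Pow2.
Variable R : realType.
Implicit Types a b : R.

Definition pow2 a : R := 2 `^ a.

Lemma pow2_gt0 a : 0 < pow2 a. Proof. exact: powR_gt0. Qed.
Lemma pow2_ge0 a : 0 <= pow2 a. Proof. exact: powR_ge0. Qed.
Lemma pow2_0 : pow2 0 = 1. Proof. exact: powRr0. Qed.
Lemma pow2D a b : pow2 (a + b) = pow2 a * pow2 b.
Proof. by rewrite /pow2 powRD// pnatr_eq0 implybT. Qed.
Lemma pow2N a : pow2 (- a) = (pow2 a)^-1. Proof. exact: powRN. Qed.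
Lemma pow2_nat n : pow2 n%:R = 2 ^+ n. Proof. by rewrite /pow2 powR_mulrn. Qed.
Lemma pow2M a b : pow2 (a * b) = pow2 a `^ b. Proof. by rewrite /pow2 powRrM. Qed.
Lemma ler_pow2 a b : (pow2 a <= pow2 b) = (a <= b).
Proof. by rewrite /pow2 /powR pnatr_eq0 /= ler_expR ler_pM2r// ln_gt0// ltr1n. Qed.
Lemma ltr_pow2 a b : (pow2 a < pow2 b) = (a < b).
Proof. by rewrite !ltNge ler_pow2. Qed.
Lemma pow2_le1 a : a <= 0 -> pow2 a <= 1.
Proof. by rewrite -ler_pow2 pow2_0. Qed.

End Pow2.

Ltac nonneg := repeat first
  [ assumption | exact: pow2_ge0 | exact: powR_ge0 | exact: ler0n
  | exact: sqr_ge0 | exact: expR_ge0 | exact: normr_ge0 | by apply: ltW | done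
  | apply: exprn_ge0 | apply: mulr_ge0 | apply: addr_ge0 | rewrite invr_ge0 ].

(** * Exponential moments of one generation *)

Lemma measurable_sum_in d (T : measurableType d) (R : realType) (I : eqType)
    (s : seq I) (h : I -> T -> R) :
  (forall i, i \in s -> measurable_fun setT (h i)) ->
  measurable_fun setT (fun x => \sum_(i <- s) h i x).
Proof.
elim: s => [mh|x y ih mh].
  by under eq_fun do rewrite big_nil//=; exact: measurable_cst.
under eq_fun do rewrite big_cons//=; apply: measurable_funD => //.
- by apply: mh; rewrite mem_head.
- by apply: ih => n ny; apply: mh; rewrite inE orbC ny.
Qed.

Section AlmostSure.
Context d (T : measurableType d) (R : realType) (m : probability T R).

(** The sum over [n] has finite expectation, hence is finite almost surely, and it dominates each of
    its terms. *)
Lemma ae_bounded_geometric (f : nat -> T -> R) (r : R) : 0 <= r < 1 ->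
  (forall n, measurable_fun setT (f n)) -> (forall n t, 0 <= f n t) ->
  (forall n, \int[m]_t (f n t)%:E <= (r ^+ n)%:E)%E ->
  {ae m, forall t, exists C : R, forall n, f n t <= C}.
Proof.
move=> /andP[r0 r1] mf f0 fr.
pose g t := (\sum_(0 <= n <oo) (f n t)%:E)%E.
have mfE n : measurable_fun setT (fun t => (f n t)%:E) by exact/measurable_EFinP.
have mg : measurable_fun setT g by apply: ge0_emeasurable_sum => // n t _ _; rewrite lee_fin.
have g0 t : (0 <= g t)%E by apply: nneseries_ge0 => n _ _; rewrite lee_fin.
have gfin : (\int[m]_t g t < +oo)%E.
  rewrite integral_nneseries//; last by move=> n t _; rewrite lee_fin.
  apply: (@le_lt_trans _ _ ((1 - r)^-1)%:E); last exact: ltry.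
  apply: lime_le.
    by apply: is_cvg_nneseries => n _ _; apply: integral_ge0 => t _; rewrite lee_fin.
  near=> n; apply: (le_trans (lee_sum _ (fun i _ => fr i))).
  rewrite sumEFin lee_fin -(@ler_pM2l _ (1 - r)) ?subr_gt0// divff ?gt_eqF ?subr_gt0//.
  rewrite big_mkord.
  have := subrX1 r n; have := exprn_ge0 n r0.
  set S := \sum_(_ < _) _; nra.
have ig : m.-integrable setT g.
  apply/integrableP; split=> //.
  by under eq_integral do rewrite gee0_abs//.
apply: filterS (integrable_ae measurableT ig) => t /(_ I) gt.
exists (fine (g t)) => n; rewrite -lee_fin fineK//.
apply: le_trans (nneseries_lim_ge n.+1 _); last by move=> i _ _; rewrite lee_fin.
by rewrite big_nat_recr//= leeDr// sume_ge0// => i _; rewrite lee_fin.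
Unshelve. all: by end_near. Qed.

Lemma ge0_integral_scale (c : R) (f : T -> R) : 0 <= c ->
  measurable_fun setT f -> (forall t, 0 <= f t) ->
  (\int[m]_t (c * f t)%:E = c%:E * \int[m]_t (f t)%:E)%E.
Proof.
move=> c0 mf f0; under eq_integral do rewrite EFinM.
by apply: ge0_integralZl => //; [exact/measurable_EFinP|move=> t _; rewrite lee_fin].
Qed.

Lemma ge0_integral_bigsum (I : Type) (s : seq I) (f : I -> T -> R) :
  (forall i, measurable_fun setT (f i)) -> (forall i t, 0 <= f i t) ->
  (\int[m]_t (\sum_(i <- s) f i t)%:E = \sum_(i <- s) \int[m]_t (f i t)%:E)%E.
Proof.
move=> mf f0; under eq_integral do rewrite -sumEFin.
by apply: ge0_integral_sum => //; [move=> i; exact/measurable_EFinP|move=> i t _; rewrite lee_fin].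
Qed.

(** A union bound: the mean of the exponentials over [r n], weighted by [2^-n], has expectation at
    most [2^-n]. Logarithms turn the weight and the number of indices into the two additive terms.
    If [r n] is empty, the inverse of its size is 0 and so is the mean. *)
Lemma ae_bounded_family (I : eqType) (r : nat -> seq I) (X : nat -> I -> T -> R) :
  (forall n i, measurable_fun setT (X n i)) ->
  (forall n i, \int[m]_t (expR (X n i t))%:E <= 1)%E ->
  {ae m, forall t, exists C : R, forall n i, i \in r n ->
    X n i t <= C + ln (size (r n))%:R + n%:R * ln 2}.
Proof.
move=> mX X1.
pose f n t := (2^-1 ^+ n / (size (r n))%:R) * \sum_(i <- r n) expR (X n i t).
have mexp n i : measurable_fun setT (fun t => expR (X n i t)).
  by apply: measurableT_comp; [exact: measurable_expR|exact: mX].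
have msum n : measurable_fun setT (fun t => \sum_(i <- r n) expR (X n i t)).
  by apply: measurable_sum => i; exact: mexp.
have fb : {ae m, forall t, exists C : R, forall n, f n t <= C}.
  apply: (@ae_bounded_geometric _ 2^-1).
  - by rewrite invr_ge0 ler0n/= invf_lt1// ltr1n.
  - by move=> n; apply: measurable_funM.
  - by move=> n t; rewrite mulr_ge0// ?divr_ge0// ?exprn_ge0//; apply: sumr_ge0 => i _; exact: expR_ge0.
  - move=> n; rewrite /f ge0_integral_scale//; last first.
      by move=> t; apply: sumr_ge0 => i _; exact: expR_ge0.
    rewrite (ge0_integral_bigsum (r n) (f := fun i t => expR (X n i t)))//.
    apply: (@le_trans _ _ ((2^-1 ^+ n / (size (r n))%:R)%:E * (size (r n))%:R%:E)%E).
      apply: lee_wpmul2l; first by rewrite lee_fin divr_ge0.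
      elim: (r n) => [|i s IH]; first by rewrite big_nil.
      by rewrite big_cons /= -natr1 EFinD addeC leeD.
    rewrite -EFinM lee_fin; case: (size _) => [|k]; first by rewrite mulr0 exprn_ge0.
    by rewrite divfK// pnatr_eq0.
apply: filterS fb => t [C fC]; exists (ln (C + 1)) => n i ir.
have C0 : 0 <= C.
  apply: le_trans (fC 0%N); rewrite mulr_ge0// ?divr_ge0// ?exprn_ge0//.
  by apply: sumr_ge0 => j _; exact: expR_ge0.
have s0 : 0 < (size (r n))%:R :> R by rewrite ltr0n; case: (r n) ir.
have e2 : expR (n%:R * ln 2) = 2 ^+ n :> R by rewrite expRM_natl lnK ?posrE.
rewrite -ler_expR !expRD e2 lnK ?posrE ?ltr_wpDl// lnK ?posrE//.
apply: (@le_trans _ _ (\sum_(i <- r n) expR (X n i t))).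
  elim: (r n) ir => // j s IH; rewrite big_cons inE => /predU1P[->|js].
    by rewrite lerDl sumr_ge0.
  by rewrite (le_trans (IH js))// lerDr expR_ge0.
have := fC n; rewrite /f -ler_pdivlMl; last by rewrite divr_gt0// exprn_gt0// invr_gt0.
move=> /le_trans; apply; rewrite invfM invrK exprVn invrK.
have : 0 < 2 ^+ n * (size (r n))%:R :> R by rewrite mulr_gt0// exprn_gt0.
nra.
Qed.

End AlmostSure.

Section Exponential.
Variable R : realType.
Implicit Types (t y b x q z : R).

(** From [expR (- z) >= 1 - z] and [(1 - z) (1 + z + 2 z^2) = 1 + z^2 (1 - 2 z)]. There is no lower
    bound on [z], so coefficients of both signs are covered. *)
Lemma expR_le_quadratic z : z <= 2^-1 -> expR z <= 1 + z + 2 * z ^+ 2.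
Proof.
move=> z1; have := expR_ge1Dx (- z); rewrite expRN.
have e0 := expR_gt0 z; rewrite -(ler_pM2r e0) mulVf ?gt_eqF// => h.
have : 0 <= z ^+ 2 * (1 - 2 * z) by apply: mulr_ge0; [exact: sqr_ge0|lra].
nra.
Qed.

(** Values above [b] become 0 rather than [b]. On a path whose masses stay below the cut-off nothing
    changes. *)
Definition truncate b x := if x <= b then x else 0.

Lemma measurable_truncate b : measurable_fun setT (truncate b).
Proof. by apply: measurable_fun_ifT => //; exact: measurable_fun_ler. Qed.

(* When [b < y * x] the truncation is [0], and the last term dominates [|t| y x]
   because [1 <= y x / b]. *)
Lemma expR_truncate_le t y b x q : 0 <= y -> 0 < b -> 0 <= x -> 1 < q ->
  `|t| * b <= 2^-1 ->
  expR (t * truncate b (y * x)) <=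
  1 + (t * y + 2 * t ^+ 2 * b * y) * x + `|t| * y * (y / b) `^ (q - 1) * x `^ q.
Proof.
move=> y0 b0 x0 q1 tb; have yx0 : 0 <= y * x by exact: mulr_ge0.
have c0 : 0 <= `|t| * y * (y / b) `^ (q - 1) * x `^ q.
  by rewrite !mulr_ge0 ?powR_ge0.
have t1 := ler_norm t; have t2 := ler_norm (- t); rewrite normrN in t2.
rewrite /truncate; case: ifPn => [yxb|]; last rewrite -ltNge => byx.
  have tyx : `|t| * (y * x) <= 2^-1 by rewrite (le_trans _ tb)// ler_wpM2l.
  apply: le_trans (expR_le_quadratic _) _.
    by apply: le_trans tyx; rewrite ler_wpM2r.
  have : t ^+ 2 * (y * x) * (y * x) <= t ^+ 2 * (y * x) * b.
    by rewrite ler_wpM2l// mulr_ge0// sqr_ge0.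
  nra.
rewrite mulr0 expR0.
have x_gt0 : 0 < x by rewrite lt_neqAle x0 andbT; apply: contraTneq byx => <-; rewrite mulr0 -leNgt ltW.
have q0 : 0 <= q - 1 by lra.
have p1 : 1 <= (y / b * x) `^ (q - 1).
  rewrite -[leLHS](powRr0 (y / b * x)) ler_powR//.
  by rewrite mulrAC ler_pdivlMr// mul1r ltW.
have -> : `|t| * y * (y / b) `^ (q - 1) * x `^ q =
    `|t| * y * x * (y / b * x) `^ (q - 1).
  rewrite (powRM _ (divr_ge0 y0 (ltW b0)) x0).
  by have <- := @mulr_powRB1 _ x q x0 ltac:(lra); ring.
have : `|t| * (y * x) * 1 <= `|t| * (y * x) * (y / b * x) `^ (q - 1).
  by rewrite ler_wpM2l// mulr_ge0.
have : 0 <= t ^+ 2 * (y * x) * b by rewrite mulr_ge0 ?(ltW b0)// mulr_ge0// sqr_ge0.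
have : - (`|t| * (y * x)) <= t * (y * x) by rewrite -mulNr ler_wpM2r//; lra.
nra.
Qed.

End Exponential.

Section Increment.
Context d (T : measurableType d) (R : realType) (rho : set R -> \bar R).
Variables (m : probability T R) (U : seq bool -> T -> R).
Hypothesis iidU : iid_field m rho U.
Hypothesis U0 : forall v t, 0 <= U v t.
Hypothesis meanU : (\int[m]_t (U [:: true] t)%:E = 1)%E.
Variables (q M : R).
Hypothesis q1 : 1 < q.
Hypothesis momentU : (\int[m]_t (U [:: true] t `^ q)%:E = M%:E)%E.

Let mU v : measurable_fun setT (U v). Proof. exact: iidU.1. Qed.

Lemma moment_ge0 : 0 <= M.
Proof. by rewrite -lee_fin -momentU; apply: integral_ge0 => t _; rewrite lee_fin powR_ge0. Qed.

Lemma iid_mean v : v != [::] -> (\int[m]_t (U v t)%:E = 1)%E.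
Proof.
move=> v0; rewrite -meanU.
have := @iid_marginal _ _ _ _ _ _ iidU v (fun x => (Num.max x 0)%:E) [:: true] v0 isT.
under eq_integral do rewrite max_l//.
under [X in _ -> _ -> _ = X]eq_integral do rewrite max_l//.
apply; first by apply/measurable_EFinP; apply: measurable_maxr.
by move=> x; rewrite lee_fin le_max lexx orbT.
Qed.

Lemma iid_moment v : v != [::] -> (\int[m]_t (U v t `^ q)%:E = M%:E)%E.
Proof.
move=> v0; rewrite -momentU.
apply: (@iid_marginal _ _ _ _ _ _ iidU v (fun x => (x `^ q)%:E) [:: true] v0 isT).
  by apply/measurable_EFinP; exact: measurable_powR.
by move=> x; rewrite lee_fin powR_ge0.
Qed.

(** An upper bound for the logarithm of the moment generating function: the mean, the second-order
    term with [(y x)^2 <= b y x] below the cut-off, and the [q]-th moment of what is cut off. It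
    enters through [1 + z <= expR z]. *)
Definition compensator (t y b : R) : R :=
  t * y + 2 * t ^+ 2 * b * y + `|t| * y * (y / b) `^ (q - 1) * M.

Lemma integral_expR_truncate_le v (t y b : R) : v != [::] -> 0 <= y -> 0 < b ->
  `|t| * b <= 2^-1 ->
  (\int[m]_z (expR (t * truncate b (y * U v z) - compensator t y b))%:E <= 1)%E.
Proof.
move=> v0 y0 b0 tb.
pose A := t * y + 2 * t ^+ 2 * b * y; pose B := `|t| * y * (y / b) `^ (q - 1).
have iU : m.-integrable setT (EFin \o U v).
  apply/integrableP; split; first exact/measurable_EFinP.
  under eq_integral do rewrite /= ger0_norm//.
  by rewrite iid_mean// ltry.
have iUq : m.-integrable setT (EFin \o (fun z => U v z `^ q)).
  apply/integrableP; split; first exact/measurable_EFinP/(measurableT_comp (measurable_powR q) (mU v)).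
  under eq_integral do rewrite /= ger0_norm ?powR_ge0//.
  by rewrite iid_moment// ltry.
have e_eq : (\int[m]_z (1 + A * U v z + B * U v z `^ q)%:E = (1 + A + B * M)%:E)%E.
  under eq_integral do rewrite EFinD.
  rewrite integralD//=; last 2 first.
  - under eq_fun do rewrite EFinD EFinM.
    apply: integrableD => //; first exact: finite_measure_integrable_cst.
    exact: integrableZl.
  - by under eq_fun do rewrite EFinM; exact: integrableZl.
  under eq_integral do rewrite EFinD.
  rewrite integralD//=; last 2 first.
  - exact: finite_measure_integrable_cst.
  - by under eq_fun do rewrite EFinM; exact: integrableZl.
  rewrite integral_cst// (iid_mass iidU) mul1e.
  under eq_integral do rewrite EFinM.
  under [X in (_ + X)%E]eq_integral do rewrite EFinM.
  by rewrite !integralZl//= iid_mean// iid_moment// mule1 !EFinD EFinM.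
under eq_integral do rewrite expRD mulrC.
have mexp : measurable_fun setT (fun z => expR (t * truncate b (y * U v z))).
  apply: measurableT_comp (@measurable_expR R) _.
  apply: measurable_funM => //; apply: (measurableT_comp (measurable_truncate b)).
  exact: measurable_funM.
rewrite ge0_integral_scale ?expR_ge0//.
apply: (@le_trans _ _ ((expR (- compensator t y b))%:E * (1 + A + B * M)%:E)%E).
  apply: lee_wpmul2l; first by rewrite lee_fin expR_ge0.
  rewrite -e_eq; apply: ge0_le_integral => //.
  - exact/measurable_EFinP.
  - apply/measurable_EFinP; apply: measurable_funD.
      by apply: measurable_funD => //; exact: measurable_funM.
    apply: measurable_funM => //; exact: (measurableT_comp (measurable_powR q) (mU v)).
  - by move=> z _; rewrite lee_fin; apply: expR_truncate_le.
rewrite -EFinM lee_fin expRN mulrC ler_pdivrMr ?expR_gt0// mul1r.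
by have := expR_ge1Dx (compensator t y b); rewrite /compensator -/A -/B addrA.
Qed.

(** When [size u = n.+1], this is the conditional mean of [mass w u] given the first [n]
    generations; [take n u] is then the parent. *)
Definition parent_mass (w : seq bool -> R) n u := mass w (take n u) / 2.

(** The exponent of a supermartingale factor for one generation. The exponential parameter is
    contained in [c], so the same sum serves the masses of subtrees and the integrals of waves. *)
Definition level_sum n (c : seq bool -> R) b (w : seq bool -> R) : R :=
  \sum_(u <- words n.+1) (c u * truncate b (parent_mass w n u * w u)
                          - compensator (c u) (parent_mass w n u) b).

Lemma measurable_mass v : measurable_fun [set: field R] (fun w => mass w v).
Proof.
apply: measurable_funM => //; apply: measurable_prod => i _.
by apply: measurable_coord; rewrite -size_eq0 size_takel.
Qed.

Lemma measurable_level_sum n c b :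
  measurable_fun [set: field R] (fun w => level_sum n c b w).
Proof.
apply: measurable_sum_in => u; rewrite mem_words => un.
have mu : measurable_fun [set: field R] (fun w => w u).
  by apply: measurable_coord; apply: contraTneq un => ->.
have mp : measurable_fun [set: field R] (fun w => parent_mass w n u).
  by apply: measurable_funM => //; exact: measurable_mass.
apply: measurable_funB.
  apply: measurable_funM => //; apply: (measurableT_comp (measurable_truncate b)).
  exact: measurable_funM.
apply: measurable_funD; first by apply: measurable_funD; apply: measurable_funM.
apply: measurable_funM => //; apply: measurable_funM; first exact: measurable_funM.
apply: (measurableT_comp (measurable_powR (q - 1))); exact: measurable_funM.
Qed.

(** With the words of length at most [n] frozen, the parent masses are constants and the weights of
    generation [n.+1] are independent; the exponential factorises into integrals at most 1. *)
Lemma integral_level_sum_le n c b : 0 < b -> (forall u, `|c u| * b <= 2^-1) ->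
  (\int[m]_t (expR (level_sum n c b (U ^~ t)))%:E <= 1)%E.
Proof.
move=> b0 cb.
apply: (iid_split_le iidU (D := fun v => (size v <= n)%N)
  (f := fun w => (expR (level_sum n c b w))%:E)).
- apply/measurable_EFinP; apply: measurableT_comp (@measurable_expR R) _.
  exact: measurable_level_sum.
- by move=> w; rewrite lee_fin expR_ge0.
move=> t; set w := U ^~ t.
have pm t' u : u \in words n.+1 ->
    parent_mass (glue (fun v => (size v <= n)%N) w (U ^~ t')) n u = parent_mass w n u.
  rewrite mem_words => /eqP un; rewrite /parent_mass /mass /weight size_takel ?un//.
  congr (_ / _ / _); apply: eq_bigr => i _; rewrite /glue take_takel ?ltn_ord//.
  by rewrite size_takel ?un ?ltn_ord// (leq_trans (ltn_ord i)).
pose g u x := expR (c u * truncate b (parent_mass w n u * x)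
                          - compensator (c u) (parent_mass w n u) b).
rewrite (eq_integral (fun t' => (\prod_(u <- words n.+1) g u (U u t'))%:E)); last first.
  move=> t' _; rewrite /level_sum expR_sum; congr EFin; apply: eq_big_seq => u un.
  rewrite pm// /glue /g; move: un; rewrite mem_words => /eqP->.
  by rewrite ltnn.
have mg u : measurable_fun setT (g u).
  apply: measurableT_comp (@measurable_expR R) _.
  apply: measurable_funB => //; apply: measurable_funM => //.
  apply: (measurableT_comp (measurable_truncate b)); exact: measurable_funM.
rewrite (iid_prod iidU) ?words_uniq ?mem_words//; last by move=> u x; exact: expR_ge0.
have : forall s, {subset s <= words n.+1} ->
    (0 <= \prod_(u <- s) \int[m]_t' (g u (U u t'))%:E <= 1)%E.
  elim=> [_|u s IH sub]; first by rewrite big_nil lee01 lexx.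
  rewrite big_cons; have /andP[p0 p1] := IH (fun v vs => sub v (mem_behead (s := u :: s) vs)).
  have un : u \in words n.+1 by apply: sub; rewrite mem_head.
  have g1 : (\int[m]_t' (g u (U u t'))%:E <= 1)%E.
    apply: integral_expR_truncate_le => //.
      by apply: contraTneq un => ->; rewrite mem_words.
    by apply: divr_ge0 => //; apply: mass_ge0 => v; exact: U0.
  have g0 : (0 <= \int[m]_t' (g u (U u t'))%:E)%E.
    by apply: integral_ge0 => x _; rewrite lee_fin expR_ge0.
  by rewrite mule_ge0//= -[leRHS]mul1e lee_pmul.
by move=> /(_ (words n.+1) (fun _ => id)) /andP[].
Qed.

(** If the families [r n] grow exponentially, the right-hand side is linear in [n], a loss that
    exponential decay absorbs. *)
Lemma ae_level_sum (I : eqType) (r : nat -> seq I)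
    (c : nat -> I -> seq bool -> R) (b : nat -> R) :
  (forall n, 0 < b n) -> (forall n i u, `|c n i u| * b n <= 2^-1) ->
  {ae m, forall t, exists C : R, forall n i, i \in r n ->
    level_sum n (c n i) (b n) (U ^~ t) <= C + ln (size (r n))%:R + n%:R * ln 2}.
Proof.
move=> b0 cb.
apply: (@ae_bounded_family _ _ _ m I r (fun n i t => level_sum n (c n i) (b n) (U ^~ t))).
  move=> n i; apply: (measurableT_comp (measurable_level_sum n (c n i) (b n))).
  exact: (iid_measurable iidU).
by move=> n i; apply: integral_level_sum_le.
Qed.

Lemma integral_mass_powR v :
  (\int[m]_t (mass (U ^~ t) v `^ q)%:E = ((2^-1 `^ q * M) ^+ size v)%:E)%E.
Proof.
pose s := [seq take j.+1 v | j <- iota 0 (size v)].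
have massE w : mass w v = \prod_(u <- s) (w u / 2).
  rewrite big_map -[X in iota 0 X]subn0 -/(index_iota 0 _) big_mkord.
  by rewrite big_split /= prodr_const card_ord exprVn.
rewrite (eq_integral (fun t => (\prod_(u <- s) (2^-1 `^ q * U u t `^ q))%:E)); last first.
  move=> t _; rewrite massE; congr EFin; elim: {massE} s => [|u s IH].
    by rewrite !big_nil powR1.
  rewrite !big_cons powRM ?divr_ge0//; last by apply: prodr_ge0 => *; exact: divr_ge0.
  by rewrite IH powRM ?invr_ge0// [_ `^ q * _]mulrC.
rewrite (iid_prod iidU (g := fun _ x => 2^-1 `^ q * x `^ q)).
- rewrite (eq_big_seq (fun=> (2^-1 `^ q * M)%:E)); last first.
    move=> u /mapP[j]; rewrite mem_iota add0n => /andP[_ jv] ->.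
    rewrite ge0_integral_scale ?powR_ge0//.
    - by rewrite iid_moment// -size_eq0 size_takel.
    - exact: (measurableT_comp (measurable_powR q) (mU _)).
    - by move=> t; exact: powR_ge0.
  have <- : size s = size v by rewrite size_map size_iota.
  elim: {massE} s => [|u s IH]; first by rewrite big_nil.
  by rewrite big_cons IH -EFinM exprS.
- rewrite map_inj_in_uniq ?iota_uniq// => i j; rewrite !mem_iota !add0n /= => iv jv.
  by move/(congr1 size); rewrite !size_takel// => -[].
- apply/mapP => -[j]; rewrite mem_iota add0n => /andP[_ jv].
  by move/(congr1 size); rewrite size_takel.
- by move=> u; apply: measurable_funM => //; exact: measurable_powR.
- by move=> u x; rewrite mulr_ge0 ?powR_ge0.
Qed.

(** The hypothesis is the ratio of a geometric series: [2^n] words, expectation [(2^-q M)^n] for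
    each, and the factor [2^(a q n)] to be gained. *)
Lemma ae_mass_moment a : 2 * (2^-1 `^ q * M) * pow2 (a * q) < 1 ->
  {ae m, forall t, exists C : R, forall n,
    \sum_(v <- words n) mass (U ^~ t) v `^ q <= C * pow2 (- (n%:R * (a * q)))}.
Proof.
move=> a1; have P0 n : 0 < pow2 (n%:R * (a * q)) :> R by exact: pow2_gt0.
pose f n t := pow2 (n%:R * (a * q)) * \sum_(v <- words n) mass (U ^~ t) v `^ q.
have mp v : measurable_fun setT (fun t => mass (U ^~ t) v `^ q).
  apply: (measurableT_comp (measurable_powR q)).
  apply: (measurableT_comp (measurable_mass v)); exact: (iid_measurable iidU).
have : {ae m, forall t, exists C : R, forall n, f n t <= C}.
  apply: (ae_bounded_geometric (r := 2 * (2^-1 `^ q * M) * pow2 (a * q))).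
  - by rewrite a1 andbT !mulr_ge0 ?powR_ge0 ?moment_ge0.
  - by move=> n; apply: measurable_funM => //; apply: measurable_sum => v; exact: mp.
  - by move=> n t; rewrite mulr_ge0 ?(ltW (P0 n))// sumr_ge0// => v _; exact: powR_ge0.
  - move=> n; rewrite ge0_integral_scale ?(ltW (P0 n))//; last 2 first.
    + by apply: measurable_sum => v; exact: mp.
    + by move=> t; rewrite sumr_ge0// => v _; exact: powR_ge0.
    rewrite (@ge0_integral_bigsum _ _ _ m _ (words n) (fun v t => mass (U ^~ t) v `^ q))//; last first.
      by move=> v t; exact: powR_ge0.
    rewrite (eq_big_seq (fun=> ((2^-1 `^ q * M) ^+ n)%:E)); last first.
      by move=> v; rewrite mem_words integral_mass_powR => /eqP->.
    rewrite sumEFin -EFinM lee_fin big_const_seq count_predT size_words.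
    rewrite iter_addr_0 -[_ *+ (2 ^ n)%N]mulr_natl natrX mulrC [n%:R * _]mulrC.
    by rewrite (pow2M (a * q)) powR_mulrn ?pow2_ge0// !exprMn.
apply: filterS => t [C fC]; exists C => n.
by rewrite pow2N ler_pdivlMr// mulrC; exact: fC.
Qed.

End Increment.

(** * Growth of masses *)

Section PolynomialGeometric.
Variable R : realType.

Lemma succ_le_pow2 (e : R) : 0 < e ->
  exists2 C : R, 0 < C & forall n : nat, n.+1%:R <= C * pow2 (n%:R * e).
Proof.
move=> e0; have l0 : 0 < ln 2 :> R by rewrite ln_gt0// ltr1n.
exists (1 + (e * ln 2)^-1); first by rewrite addr_gt0// invr_gt0 mulr_gt0.
move=> n; rewrite /pow2 /powR pnatr_eq0 /=.
have el : 0 < e * ln 2 by exact: mulr_gt0.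
apply: (@le_trans _ _ ((1 + (e * ln 2)^-1) * (1 + n%:R * e * ln 2))).
  rewrite -natr1 -mulrA mulrDl mul1r mulrDr mulr1.
  have -> : (e * ln 2)^-1 * (n%:R * (e * ln 2)) = n%:R by field; rewrite gt_eqF// gt_eqF.
  have : 0 <= n%:R * (e * ln 2) :> R by rewrite mulr_ge0// ltW.
  have : 0 < (e * ln 2)^-1 by rewrite invr_gt0.
  lra.
rewrite ler_pM2l ?expR_ge1Dx//.
by rewrite addr_gt0// invr_gt0.
Qed.

Lemma succ_exp_le_pow2 (k : nat) (e : R) : 0 < e ->
  exists2 C : R, 0 < C & forall n : nat, n.+1%:R ^+ k <= C * pow2 (n%:R * e).
Proof.
move=> e0; have k0 : 0 < k.+1%:R :> R by rewrite ltr0n.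
(* The divisor [k.+1] instead of [k] also covers [k = 0]. *)
have [C C0 hC] := succ_le_pow2 (divr_gt0 e0 k0).
exists ((C + 1) ^+ k) => [|n]; first by rewrite exprn_gt0// ltr_wpDr.
apply: (@le_trans _ _ ((C * pow2 (n%:R * (e / k.+1%:R))) ^+ k)).
  by rewrite lerXn2r ?nnegrE// mulr_ge0 ?pow2_ge0// ltW.
rewrite exprMn ler_pM ?exprn_ge0 ?pow2_ge0 ?(ltW C0)//.
  by rewrite lerXn2r ?nnegrE ?(ltW C0) ?addr_ge0 ?(ltW C0)// lerDl.
rewrite -powR_mulrn ?pow2_ge0// -pow2M ler_pow2 -mulrA ler_wpM2l//.
by rewrite -mulrA ler_piMr ?(ltW e0)// ler_pdivrMl// mulr1 ler_nat.
Qed.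

(* The potential [S n + A * tau * pow2 (- (n * e / 2))] is nonincreasing. *)
Lemma geometric_growth (D e : R) (k : nat) : 0 <= D -> 0 < e ->
  exists2 C : R, 0 <= C & forall (S : nat -> R) (tau : R) (n0 : nat), 0 <= tau ->
    (forall n, (n0 <= n)%N ->
      S n.+1 <= S n + D * n.+1%:R ^+ k * pow2 (- (n%:R * e)) * tau) ->
    forall n, (n0 <= n)%N -> S n <= S n0 + C * tau.
Proof.
move=> D0 e0; have e20 : 0 < e / 2 by lra.
have [C C0 hC] := succ_exp_le_pow2 k e20.
have p1 : pow2 (- (e / 2)) < 1 :> R.
  by rewrite -[X in _ < X]pow2_0 ltr_pow2; lra.
(* Half of the decay absorbs the polynomial at the price of [C]; this [A] makes the drop of the
   potential over one step equal to what remains of the increment. *)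
have [A A0 AE] : exists2 A, 0 <= A & A * (1 - pow2 (- (e / 2))) = D * C.
  exists (D * C / (1 - pow2 (- (e / 2)))).
    by rewrite divr_ge0 ?mulr_ge0 ?(ltW C0)// subr_ge0 ltW.
  by rewrite divfK// gt_eqF// subr_gt0.
exists A => // S tau n0 tau0 hS.
suff H n : (n0 <= n)%N -> S n + A * tau * pow2 (- (n%:R * (e / 2))) <=
    S n0 + A * tau.
  move=> n n0n; apply: le_trans (H n n0n); rewrite lerDl.
  nonneg.
elim: n => [|n IH].
  rewrite leqn0 => /eqP->; rewrite lerD2l ler_piMr ?mulr_ge0//.
  by rewrite pow2_le1// mul0r oppr0.
rewrite leq_eqVlt => /predU1P[<-|].
  rewrite lerD2l ler_piMr ?mulr_ge0// pow2_le1// oppr_le0 mulr_ge0// ltW//.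
rewrite ltnS => n0n; apply: le_trans (IH n0n).
apply: le_trans (lerD (hS n n0n) (lexx _)) _.
rewrite -addrA lerD2l.
have -> : pow2 (- (n.+1%:R * (e / 2))) = pow2 (- (n%:R * (e / 2))) * pow2 (- (e / 2)) :> R.
  by rewrite -pow2D -natr1; congr pow2; ring.
have -> : pow2 (- (n%:R * e)) = pow2 (- (n%:R * (e / 2))) * pow2 (- (n%:R * (e / 2))) :> R.
  by rewrite -pow2D; congr pow2; field.
have := hC n; set p := pow2 (- (n%:R * (e / 2))).
have p0 : 0 < p by exact: pow2_gt0.
have pV : pow2 (n%:R * (e / 2)) = p^-1 by rewrite /p pow2N invrK.
rewrite pV ler_pdivlMr// => h.
have -> : A * tau * p = A * tau * (p * pow2 (- (e / 2))) + D * C * tau * p.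
  by rewrite -AE; ring.
rewrite addrC lerD2l.
have -> : D * n.+1%:R ^+ k * (p * p) * tau = D * (n.+1%:R ^+ k * p) * tau * p by ring.
by rewrite ler_wpM2r ?(ltW p0)// ler_wpM2r// ler_wpM2l.
Qed.

End PolynomialGeometric.

(** * Masses of subtrees along one realisation *)

Section Path.
Variable R : realType.
Variables (w : seq bool -> R) (a q M K : R).
Hypothesis w0 : forall u, 0 <= w u.
Hypothesis a0 : 0 < a.
Hypothesis q1 : 1 < q.
Hypothesis M0 : 0 <= M.
Hypothesis K1 : 1 <= K.
Hypothesis massq : forall n,
  \sum_(v <- words n) mass w v `^ q <= K * pow2 (- (n%:R * (a * q))).

(** The bound of [mass_le] at generation [n.+1], the one that [level_sum n] examines. *)
Definition cutoff n : R := K * pow2 (- (n.+1%:R * a)).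

Let K0 : 0 < K. Proof. by apply: lt_le_trans K1. Qed.

Lemma cutoff_gt0 n : 0 < cutoff n. Proof. by rewrite mulr_gt0// pow2_gt0. Qed.

(** A single term of the sum of [q]-th powers; [K <= K^q] because [K >= 1]. *)
Lemma mass_le v : mass w v <= K * pow2 (- ((size v)%:R * a)).
Proof.
have q0 : 0 < q by apply: lt_trans q1.
have m0 : 0 <= mass w v by exact: mass_ge0.
have p0 : 0 < K * pow2 (- ((size v)%:R * a)) by rewrite mulr_gt0// pow2_gt0.
have mq : mass w v `^ q <= (K * pow2 (- ((size v)%:R * a))) `^ q.
  apply: (@le_trans _ _ (\sum_(u <- words (size v)) mass w u `^ q)).
    have vs : v \in words (size v) by rewrite mem_words.
    rewrite (bigD1_seq v vs (words_uniq _)) /= lerDl.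
    by apply: sumr_ge0 => u _; exact: powR_ge0.
  apply: le_trans (massq _) _; rewrite powRM ?(ltW K0) ?pow2_ge0// -pow2M mulNr -mulrA.
  by rewrite ler_wpM2r ?pow2_ge0// -{1}(powRr1 (ltW K0)) ler_powR// ltW.
rewrite leNgt; apply/negP => h; move: mq; rewrite leNgt => /negP; apply.
by apply: gt0_ltr_powR => //; rewrite nnegrE ltW.
Qed.

Lemma mass_parent n u : u \in words n.+1 -> mass w u = parent_mass w n u * w u.
Proof.
rewrite mem_words => /eqP; case/lastP: u => // v b; rewrite size_rcons => -[vn].
by rewrite mass_rcons /parent_mass -vn -cats1 take_size_cat.
Qed.

Lemma sum_parent n (F : seq bool -> R) (G : R -> R) :
  (forall v b, v \in words n -> F (rcons v b) = F v) ->
  \sum_(u <- words n.+1) F u * G (parent_mass w n u) =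
  \sum_(v <- words n) 2 * F v * G (mass w v / 2).
Proof.
move=> hF; rewrite sum_words_rcons; apply: eq_big_seq => v vn.
rewrite !hF// /parent_mass; move: vn; rewrite mem_words => /eqP vn.
have tk b : take n (rcons v b) = v by rewrite -vn -cats1 take_size_cat.
by rewrite !tk; ring.
Qed.

(** Below the cut-off [truncate] is the identity, so the level sum is a true increment minus its
    compensators. The truncation error is settled here by the moment bound; [s] stays free, to
    balance the variance against [X / s]. *)
Lemma level_sum_bound (s X : R) (n : nat) (al : seq bool -> R) : 0 < s ->
  (forall u, `|al u| <= 1) ->
  level_sum q M n (fun u => s * al u) (cutoff n) w <= X ->
  \sum_(u <- words n.+1) al u * (mass w u - parent_mass w n u) <=
  2 * s * cutoff n * (\sum_(u <- words n.+1) al u ^+ 2 * parent_mass w n u) +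
  M * K * pow2 (a * (q - 1)) * pow2 (- (n%:R * a)) + X / s.
Proof.
move=> s0 al1 hX.
pose b := cutoff n; have b0 : 0 < b by exact: cutoff_gt0.
have pm0 u : 0 <= parent_mass w n u by rewrite divr_ge0// mass_ge0.
pose Dl := \sum_(u <- words n.+1) `|al u| * parent_mass w n u *
   (parent_mass w n u / b) `^ (q - 1) * M.
have levelE : level_sum q M n (fun u => s * al u) b w =
    s * ((\sum_(u <- words n.+1) al u * (mass w u - parent_mass w n u)) -
    2 * s * b * (\sum_(u <- words n.+1) al u ^+ 2 * parent_mass w n u) - Dl).
  rewrite /level_sum /Dl !mulrBr !mulr_sumr -!sumrB; apply: eq_big_seq => u un.
  rewrite /compensator -mass_parent// /truncate ifT; last first.
    by rewrite /b /cutoff; have := mass_le u; move: un; rewrite mem_words => /eqP->.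
  by rewrite normrM (gtr0_norm s0); ring.
(* The [q]-th powers of the masses sum to order [2^(- n a q)], and the cut-off to the power [1 - q]
   has order [2^(n a (q - 1))]: the product is of order [2^(- n a)]. *)
have DlE : Dl <= M * K * pow2 (a * (q - 1)) * pow2 (- (n%:R * a)).
  have bq0 : 0 <= b^-1 `^ (q - 1) by exact: powR_ge0.
  have q0 : 0 < q by apply: lt_trans q1.
  apply: (@le_trans _ _ (\sum_(u <- words n.+1)
      1 * (parent_mass w n u `^ q * (b^-1 `^ (q - 1) * M)))).
    apply: ler_sum => u _.
    rewrite powRM ?invr_ge0 ?(ltW b0)// -(mulr_powRB1 (pm0 u) q0) mul1r.
    have -> : `|al u| * parent_mass w n u *
      (parent_mass w n u `^ (q - 1) * b^-1 `^ (q - 1)) * M =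
      `|al u| * (parent_mass w n u * parent_mass w n u `^ (q - 1) * (b^-1 `^ (q - 1) * M)) by ring.
    by rewrite ler_piMl//; nonneg.
  rewrite (@sum_parent n (fun=> 1) (fun x => x `^ q * (b^-1 `^ (q - 1) * M)))//.
  apply: (@le_trans _ _ (\sum_(v <- words n) mass w v `^ q * (b^-1 `^ (q - 1) * M))).
    apply: ler_sum => v _; rewrite mulr1 mulrA ler_wpM2r ?mulr_ge0//.
    rewrite powRM ?invr_ge0 ?mass_ge0// mulrC -mulrA ler_piMr ?powR_ge0//.
    rewrite -ler_pdivlMr// mul1r; apply: ge1r_powR; last exact: ltW.
    by rewrite invr_gt0 ltr0n /= invf_le1 ?ltr0n// ler1n.
  rewrite -mulr_suml.
  apply: le_trans (ler_wpM2r _ (massq n)) _; first by rewrite mulr_ge0.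
  have -> : b^-1 = K^-1 * pow2 (n.+1%:R * a).
    by rewrite /b /cutoff invfM pow2N invrK.
  rewrite powRM ?invr_ge0 ?(ltW K0) ?pow2_ge0// -pow2M.
  have -> : pow2 (n.+1%:R * a * (q - 1)) =
      pow2 (a * (q - 1)) * (pow2 (- (n%:R * a)) * pow2 (n%:R * (a * q))).
    by rewrite -!pow2D -natr1; congr pow2; ring.
  rewrite pow2N.
  have p0 : 0 < pow2 (n%:R * (a * q)) by exact: pow2_gt0.
  have kq : K^-1 `^ (q - 1) <= 1.
    have one : 1 `^ (q - 1) = 1 :> R by rewrite powR1.
    rewrite -[X in _ <= X]one.
    by apply: ge0_ler_powR; rewrite ?nnegrE ?invr_ge0 ?(ltW K0) ?invf_le1// subr_ge0 ltW.
  have -> : K * (pow2 (n%:R * (a * q)))^-1 * (K^-1 `^ (q - 1) *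
      (pow2 (a * (q - 1)) * (pow2 (- (n%:R * a)) * pow2 (n%:R * (a * q)))) * M) =
      K^-1 `^ (q - 1) * (M * K * pow2 (a * (q - 1)) * pow2 (- (n%:R * a))).
    by field; rewrite gt_eqF.
  by rewrite ler_piMl//; nonneg.
move: hX; rewrite levelE -ler_pdivlMl// [s^-1 * X]mulrC => hX.
by move: hX DlE; rewrite /b; lra.
Qed.

Definition branch_mass n u : R :=
  \sum_(v <- words n | take (size u) v == u) mass w v.

Lemma sum_branch_parent n u : (size u <= n)%N ->
  \sum_(v <- words n.+1) (take (size u) v == u)%:R * parent_mass w n v =
  branch_mass n u.
Proof.
move=> un; rewrite (@sum_parent n (fun v => (take (size u) v == u)%:R) id).
  rewrite [RHS]big_mkcond /=; apply: eq_bigr => v _.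
  by case: ifP => _; rewrite ?mulr0 ?mul0r// mulr1; field.
by move=> v b; rewrite mem_words => /eqP vn; rewrite -cats1 takel_cat// vn.
Qed.

Lemma branch_massS n u : (size u <= n)%N ->
  branch_mass n.+1 u - branch_mass n u =
  \sum_(v <- words n.+1) (take (size u) v == u)%:R * (mass w v - parent_mass w n v).
Proof.
move=> un; under [RHS]eq_bigr do rewrite mulrBr.
rewrite sumrB sum_branch_parent//; congr (_ - _).
rewrite [LHS]big_mkcond /=; apply: eq_bigr => v _.
by case: ifP => _; rewrite ?mul1r ?mul0r.
Qed.

(** Chosen so that [2 * branch_scale n * cutoff n] is [1 / n.+1]. For an indicator coefficient the
    variance sum is the branch mass itself, which is thus multiplied by [n.+2 / n.+1], a telescoping
    factor. *)
Definition branch_scale n : R := (2 * cutoff n * n.+1%:R)^-1.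

Lemma cutoff_le n : cutoff n <= K * pow2 (- (n%:R * a)).
Proof.
rewrite ler_wpM2l ?(ltW K0)// ler_pow2 lerN2 ler_wpM2r ?(ltW a0)//.
by rewrite ler_nat.
Qed.

(** The ratio of the branch mass to [n.+1] is nonincreasing up to summable errors, and at generation
    [size u] the branch mass is [mass w u]. For [k >= size u] an error [2^(- k a)] splits into
    [2^(- k (a - sg))], which is summed, and the factor [2^(- size u * sg)], which is kept. *)
Lemma branch_mass_bound (C0 sg : R) : 0 <= C0 -> 0 < sg -> sg < a ->
  (forall n u, (size u <= n)%N ->
    level_sum q M n (fun v => branch_scale n * (take (size u) v == u)%:R)
      (cutoff n) w <= C0 * n.+1%:R) ->
  exists2 C : R, 0 <= C & forall n u, (size u <= n)%N ->
    branch_mass n u <= C * n.+1%:R * pow2 (- ((size u)%:R * sg)).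
Proof.
move=> C00 sg0 sga hlev.
pose D := M * K * pow2 (a * (q - 1)) + 2 * C0 * K.
have D0 : 0 <= D by rewrite /D; nonneg.
have [|G G0 hG] := @geometric_growth R D (a - sg) 1%N D0; first by rewrite subr_gt0.
exists (K + G) => [|n u un]; first by rewrite addr_ge0// ltW.
pose S n := branch_mass n u / n.+1%:R; pose tau : R := pow2 (- ((size u)%:R * sg)).
have hS : forall n, (size u <= n)%N ->
    S n.+1 <= S n + D * n.+1%:R ^+ 1 * pow2 (- (n%:R * (a - sg))) * tau.
  move=> k uk; have k0 : 0 < k.+1%:R :> R by rewrite ltr0n.
  have b0 := cutoff_gt0 k.
  have s0 : 0 < branch_scale k by rewrite invr_gt0; apply: mulr_gt0 => //; apply: mulr_gt0.
  have al1 v : `|(take (size u) v == u)%:R : R| <= 1.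
    by case: eqP => _; rewrite ?normr1 ?normr0.
  have := level_sum_bound s0 al1 (hlev k u uk); rewrite -branch_massS//.
  have -> : \sum_(v <- words k.+1) (take (size u) v == u)%:R ^+ 2 * parent_mass w k v =
      branch_mass k u.
    rewrite -sum_branch_parent//; apply: eq_bigr => v _.
    by case: eqP => _; rewrite ?expr1n ?expr0n.
  have -> : 2 * branch_scale k * cutoff k = k.+1%:R^-1.
    by rewrite /branch_scale; field; rewrite !gt_eqF.
  have -> : C0 * k.+1%:R / branch_scale k = 2 * C0 * k.+1%:R ^+ 2 * cutoff k.
    by rewrite /branch_scale invrK; ring.
  set B := branch_mass k u; set B' := branch_mass k.+1 u => H.
  have dl : pow2 (- (k%:R * a)) <= pow2 (- (k%:R * (a - sg))) * tau.
    rewrite -pow2D ler_pow2 -subr_ge0.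
    have : 0 <= (k%:R - (size u)%:R) * sg :> R.
      by rewrite mulr_ge0 ?(ltW sg0)// subr_ge0 ler_nat.
    lra.
  have H2 : B' <= B * (k.+2%:R / k.+1%:R) + D * k.+1%:R ^+ 2 * pow2 (- (k%:R * a)).
    have -> : B * (k.+2%:R / k.+1%:R) = B + k.+1%:R^-1 * B.
      by rewrite -[k.+2%:R]natr1; field; rewrite gt_eqF.
    have : 0 <= 2 * C0 * k.+1%:R ^+ 2 by nonneg.
    move=> /ler_wpM2l/(_ _ _ (cutoff_le k)) c1.
    have k1 : 1 <= k.+1%:R ^+ 2 :> R by rewrite exprn_ege1// ler1n.
    have : 0 <= M * K * pow2 (a * (q - 1)) * pow2 (- (k%:R * a)) by nonneg.
    move=> /ler_wpM2l/(_ _ _ k1); rewrite mulr1 /D => c2.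
    have -> : (M * K * pow2 (a * (q - 1)) + 2 * C0 * K) * k.+1%:R ^+ 2 *
        pow2 (- (k%:R * a)) =
        M * K * pow2 (a * (q - 1)) * pow2 (- (k%:R * a)) * k.+1%:R ^+ 2 +
        2 * C0 * k.+1%:R ^+ 2 * (K * pow2 (- (k%:R * a))) by ring.
    apply: le_trans (_ : _ <= B + (k.+1%:R^-1 * B +
      M * K * pow2 (a * (q - 1)) * pow2 (- (k%:R * a)) +
      2 * C0 * k.+1%:R ^+ 2 * cutoff k)) _; first by rewrite -lerBlDl.
    by rewrite -!addrA !lerD2l lerD.
  rewrite /S -/B -/B'.
  have kk0 : 0 < k.+2%:R :> R by rewrite ltr0n.
  rewrite ler_pdivrMr//; apply: (le_trans H2).
  rewrite [leRHS]mulrDl; apply: lerD; first by rewrite mulrA mulrAC.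
  apply: (@le_trans _ _ (D * k.+1%:R ^+ 2 * (pow2 (- (k%:R * (a - sg))) * tau))).
    by apply: ler_wpM2l => //; nonneg.
  have -> : D * k.+1%:R ^+ 2 * (pow2 (- (k%:R * (a - sg))) * tau) =
    D * k.+1%:R * pow2 (- (k%:R * (a - sg))) * tau * k.+1%:R by ring.
  by rewrite expr1 ler_wpM2l ?ler_nat//; rewrite /tau; nonneg.
have := hG S tau (size u) (pow2_ge0 _) hS n un.
rewrite {1}/S ler_pdivrMr ?ltr0n// => /le_trans; apply.
rewrite mulrAC ler_wpM2r// mulrDl lerD2r.
rewrite /S ler_pdivrMr ?ltr0n//.
have -> : branch_mass (size u) u = mass w u.
  have uw : u \in words (size u) by rewrite mem_words.
  rewrite /branch_mass big_mkcond (bigD1_seq u uw (words_uniq _)) /= take_size eqxx.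
  rewrite big_seq_cond big1 ?addr0// => v /andP[]; rewrite mem_words => /eqP vu.
  by rewrite -vu take_size => /negbTE->.
apply: (le_trans (mass_le u)).
rewrite -mulrA ler_wpM2l ?(ltW K0)//.
apply: (@le_trans _ _ tau).
  by rewrite /tau ler_pow2 lerN2 ler_wpM2l// ltW.
by rewrite ler_peMr ?pow2_ge0// ler1n.
Qed.

End Path.

(** * Oscillation along a nondegenerate curve *)

Section RealCalculus.
Variable R : realType.

Lemma is_derive_within_continuous (f f' : R -> R) (a b : R) :
  (forall t, t \in `[a, b]%R -> is_derive t 1 f (f' t)) ->
  {within `[a, b], continuous f}.
Proof.
move=> df; apply: derivable_within_continuous => t tab.
by have [] := df t tab.
Qed.

Lemma mean_value_le (f f' : R -> R) (a b C : R) : a <= b ->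
  (forall t, t \in `[a, b]%R -> is_derive t 1 f (f' t)) ->
  (forall t, t \in `[a, b]%R -> `|f' t| <= C) ->
  `|f b - f a| <= C * (b - a).
Proof.
move=> ab df fC.
have dfo x : x \in `]a, b[%R -> is_derive x 1 f (f' x).
  by move=> xab; apply: df; exact: subset_itv_oo_cc xab.
have [c cab ->] := @MVT_segment R f f' a b ab dfo (is_derive_within_continuous df).
by rewrite normrM (ger0_norm (_ : 0 <= b - a)) ?subr_ge0// ler_wpM2r ?subr_ge0// fC.
Qed.

Lemma uniform_continuity (f : R -> R) (e : R) : continuous f -> 0 < e ->
  exists n : nat, forall t s : R, 0 <= t <= 1 -> `|s - t| <= 2^-1 ^+ n ->
    `|f s - f t| <= e.
Proof.
move=> cf e0.
have /compact_near_coveringP/near_covering_withinP : compact `[0 : R, 1] by exact: segment_compact.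
move=> /(_ nat \oo (fun n t => forall s, `|s - t| <= 2^-1 ^+ n -> `|f s - f t| <= e) _).
case.
  move=> t _; have e20 : 0 < e / 2 by lra.
  have /cvgrPdist_lt/(_ _ e20) := cf t; rewrite near_simpl => /nbhs_ballP[r /= r0 hr].
  have [N _ hN] : \forall n \near \oo, 2^-1 ^+ n < r / 2 :> R.
    have h2 : `|2^-1| < 1 :> R by rewrite gtr0_norm; lra.
    have /cvgrPdist_lt/(_ (r / 2)) := cvg_expr h2.
    move=> /(_ ltac:(lra)); apply: filterS => n; rewrite sub0r normrN.
    by apply: le_lt_trans; exact: ler_norm.
  exists (ball t (r / 2), [set n | (N <= n)%N]) => /=.
    split; last by exists N.
    by apply: nbhsx_ballx; lra.
  move=> [t' n] [/= tt' Nn] _ s st'.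
  have h1 : ball t r t' by apply: le_ball tt'; lra.
  have h2 : ball t r s.
    move: tt'; rewrite /ball/= => tt'; have := hN n Nn => /= nr.
    have -> : t - s = (t - t') - (s - t') by ring.
    apply: le_lt_trans (ler_normB _ _) _; lra.
  have := hr _ h1; have := hr _ h2 => /= f1 f2.
  have -> : f s - f t' = (f t - f t') - (f t - f s) by ring.
  apply: le_trans (ler_normB _ _) _; lra.
move=> N _ hN; exists N => t s t01; apply: hN => //=.
Qed.

Lemma continuous_bounded (f : R -> R) : continuous f ->
  exists2 C : R, 0 < C & forall t : R, 0 <= t <= 1 -> `|f t| <= C.
Proof.
move=> cf.
have [|c _ hc] := @EVT_max R (fun t => `|f t|) 0 1 ler01.
  apply: continuous_subspaceT => t; apply: continuous_comp; [exact: cf|exact: norm_continuous].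
exists (`|f c| + 1); first by rewrite ltr_wpDl.
by move=> t t01; apply: le_trans (hc t _) _; [rewrite in_itv|rewrite lerDl].
Qed.

End RealCalculus.

Section Curve.
Variable R : realType.
Variables x1 x2 y1 y2 z1 z2 : R -> R.
Hypothesis dx1 : forall t : R, is_derive t 1 x1 (y1 t).
Hypothesis dx2 : forall t : R, is_derive t 1 x2 (y2 t).
Hypothesis dy1 : forall t : R, is_derive t 1 y1 (z1 t).
Hypothesis dy2 : forall t : R, is_derive t 1 y2 (z2 t).
Hypothesis cz1 : continuous z1.
Hypothesis cz2 : continuous z2.
Variables B c : R.
Hypothesis B0 : 0 < B.
Hypothesis yB : forall t, 0 <= t <= 1 -> `|y1 t| <= B /\ `|y2 t| <= B.
Hypothesis zB : forall t, 0 <= t <= 1 -> `|z1 t| <= B /\ `|z2 t| <= B.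
Hypothesis c0 : 0 < c.
Hypothesis det_ge : forall t, c <= `|y1 t * z2 t - y2 t * z1 t|.
Implicit Types (th : R * R) (t s : R).

Definition unit_vector th := th.1 ^+ 2 + th.2 ^+ 2 = 1.
Definition speed th t := y1 t * th.1 + y2 t * th.2.
Definition accel th t := z1 t * th.1 + z2 t * th.2.

Lemma unit_vector_le th : unit_vector th -> `|th.1| <= 1 /\ `|th.2| <= 1.
Proof.
rewrite /unit_vector => h; have h1 := sqr_ge0 th.1; have h2 := sqr_ge0 th.2.
split; rewrite -(@expr_le1 _ 2)// real_normK ?num_real//; lra.
Qed.

Lemma dot_unit_le th (a b : R) : unit_vector th -> `|a| <= B -> `|b| <= B ->
  `|a * th.1 + b * th.2| <= 2 * B.
Proof.
move=> /unit_vector_le[t1 t2] aB bB.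
apply: le_trans (ler_normD _ _) _; rewrite !normrM.
have : `|a| * `|th.1| <= B * 1 by rewrite ler_pM.
have : `|b| * `|th.2| <= B * 1 by rewrite ler_pM.
lra.
Qed.

Lemma is_derive_speed th t : is_derive t 1 (speed th) (accel th t).
Proof.
rewrite /speed; apply: is_derive_eq.
by rewrite /accel /= !scaler0 !add0r; congr (_ + _); exact: mulrC.
Qed.

(** In the frame of [th] and its normal the determinant is a difference of two products, one
    containing [speed] and one [accel], with cofactors at most [2 * B]. If both were at most
    [c / (8 * B)], the determinant would be at most [c / 2]. *)
Lemma speed_accel th t : unit_vector th -> 0 <= t <= 1 ->
  `|speed th t| <= c / (8 * B) -> c / (8 * B) < `|accel th t|.
Proof.
move=> uth t01; have e0 : 0 < c / (8 * B) by rewrite divr_gt0// mulr_gt0.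
rewrite !ltNge => h1; apply/negP => h2.
have [yB1 yB2] := yB t01; have [zB1 zB2] := zB t01.
have pth : unit_vector (- th.2, th.1) by rewrite /unit_vector /= sqrrN addrC.
have d1 := dot_unit_le pth yB1 yB2; have d2 := dot_unit_le pth zB1 zB2.
have := det_ge t.
have -> : y1 t * z2 t - y2 t * z1 t =
    speed th t * (z1 t * - th.2 + z2 t * th.1) -
    accel th t * (y1 t * - th.2 + y2 t * th.1).
  rewrite /speed /accel -[LHS]mulr1 -uth; ring.
rewrite leNgt => /negP; apply.
apply: le_lt_trans (ler_normB _ _) _; rewrite !normrM.
have p1 : `|speed th t| * `|z1 t * - th.2 + z2 t * th.1| <= c / (8 * B) * (2 * B).
  by rewrite ler_pM.
have p2 : `|accel th t| * `|y1 t * - th.2 + y2 t * th.1| <= c / (8 * B) * (2 * B).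
  by rewrite ler_pM.
have E : c / (8 * B) * (2 * B) = c / 4 by field; rewrite gt_eqF.
rewrite E in p1 p2; by apply: le_lt_trans (lerD p1 p2) _; move: c0; lra.
Qed.

(* As [speed] and [accel] cannot both be small, [speed] is monotone near its zeros. *)
Lemma stationary_diameter : exists m0 : nat, forall th (dl : R) t s,
  unit_vector th -> dl <= c / (8 * B) -> 0 <= t <= 1 -> 0 <= s <= 1 ->
  `|t - s| <= 2^-1 ^+ m0 -> `|speed th t| <= dl -> `|speed th s| <= dl ->
  `|t - s| <= 2 * dl / (c / (16 * B)).
Proof.
(* [z1] and [z2] each contribute at most [c / (32 * B)] to the variation of [accel], which therefore
   keeps half of its lower bound [c / (8 * B)]. *)
have e0 : 0 < c / (32 * B) by rewrite divr_gt0// mulr_gt0.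
have [n1 h1] := uniform_continuity cz1 e0; have [n2 h2] := uniform_continuity cz2 e0.
exists (maxn n1 n2) => th dl t s uth dle t01 s01.
wlog ts : t s t01 s01 / t <= s.
  move=> H; have [|/ltW st] := leP t s; first exact: H.
  by move=> h d1 d2; rewrite distrC; apply: H => //; rewrite distrC.
move=> ts_m dt ds.
have sc : {within `[t, s], continuous (speed th)}.
  by apply: (@is_derive_within_continuous _ _ (accel th)) => x _; exact: is_derive_speed.
have [xi xiab E] := @MVT_segment R (speed th) (accel th) t s ts
  (fun x _ => is_derive_speed th x) sc.
have at_ := speed_accel uth t01 (le_trans dt dle).
have xit : `|xi - t| <= `|t - s|.
  move: xiab; rewrite in_itv /= => /andP[x1' x2'].
  by rewrite ger0_norm ?subr_ge0// ler0_norm ?subr_le0//; lra.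
have le2 k : (k <= maxn n1 n2)%N -> `|xi - t| <= 2^-1 ^+ k.
  move=> kn; apply: le_trans xit (le_trans ts_m _).
  by rewrite ler_wiXn2l//; lra.
have z1d := h1 t xi t01 (le2 _ (leq_maxl _ _)); have z2d := h2 t xi t01 (le2 _ (leq_maxr _ _)).
have da : `|accel th xi - accel th t| <= c / (16 * B).
  have -> : accel th xi - accel th t = (z1 xi - z1 t) * th.1 + (z2 xi - z2 t) * th.2.
    by rewrite /accel; ring.
  have [u1 u2] := unit_vector_le uth.
  apply: le_trans (ler_normD _ _) _; rewrite !normrM.
  have : `|z1 xi - z1 t| * `|th.1| <= c / (32 * B) * 1 by rewrite ler_pM.
  have : `|z2 xi - z2 t| * `|th.2| <= c / (32 * B) * 1 by rewrite ler_pM.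
  have -> : c / (16 * B) = c / (32 * B) + c / (32 * B) by field; rewrite gt_eqF.
  lra.
have e16 : c / (8 * B) = c / (16 * B) + c / (16 * B) by field; rewrite gt_eqF.
have axi : c / (16 * B) <= `|accel th xi|.
  have := ler_distD (accel th xi) (accel th t) 0; rewrite !subr0 distrC; lra.
have ec0 : 0 < c / (16 * B) by rewrite divr_gt0// mulr_gt0.
rewrite ler_pdivlMr//.
have : `|speed th s - speed th t| <= 2 * dl by apply: le_trans (ler_normB _ _) _; lra.
rewrite E normrM (distrC s t) mulrC; apply: le_trans.
by rewrite ler_wpM2l// normr_ge0.
Qed.

(** The threshold is such that an arc of generation [j] failing the test satisfies the hypothesis of
    [oscillation_le]: [4 * B] times its length is at most the lower bound of the speed. For [j = 0]
    the whole circle passes, the speed being at most [2 * B]. *)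
Definition near_stationary th (j : nat) (u : seq bool) : bool :=
  `[< exists2 t : R, dyadic_point R u <= t <= dyadic_end R u &
      `|speed th t| <= 4 * B * 2^-1 ^+ j >].

Lemma dyadic_itv01 u t : dyadic_point R u <= t <= dyadic_end R u -> 0 <= t <= 1.
Proof.
move=> /andP[ut tu]; rewrite (le_trans (dyadic_point_ge0 R u) ut).
exact: le_trans tu (dyadic_end_le1 R u).
Qed.

Lemma dyadic_end_sub u : dyadic_end R u - dyadic_point R u = 2^-1 ^+ size u.
Proof. by rewrite /dyadic_end addrC addKr exprVn. Qed.

Lemma card_dyadic_cluster (j D : nat) (s : seq (seq bool)) : uniq s ->
  (forall u, u \in s -> size u = j) ->
  (forall u v, u \in s -> v \in s ->
    `|dyadic_point R u - dyadic_point R v| <= D%:R * 2^-1 ^+ j) ->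
  (size s <= D.*2.+1)%N.
Proof.
case: s => // u0 s us sj hd.
have u0s : u0 \in u0 :: s by rewrite mem_head.
rewrite -(size_map dyadic_index) -(size_iota (dyadic_index u0 - D)%N D.*2.+1).
apply: uniq_leq_size.
  rewrite map_inj_in_uniq// => u v us' vs'; apply: dyadic_index_inj.
  by rewrite !sj.
move=> _ /mapP[u uin ->]; rewrite mem_iota.
have := hd u u0 uin u0s; rewrite !dyadic_pointE !sj// exprVn -mulrBl normrM.
rewrite (ger0_norm (_ : 0 <= (2 ^+ j)^-1)) ?invr_ge0 ?exprn_ge0// ler_pM2r ?invr_gt0 ?exprn_gt0//.
rewrite ler_norml; set x := dyadic_index u; set y := dyadic_index u0 => /andP[h1 h2].
have : (y <= x + D)%N by rewrite -(ler_nat R) natrD; move: h1; lra.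
have : (x <= y + D)%N by rewrite -(ler_nat R) natrD; move: h2; lra.
lia.
Qed.

(** For small [j] the number of words is itself bounded. For large [j] the circle is cut into [2^m0]
    arcs of a fixed generation; in each of them [stationary_diameter] confines the slow points to a
    length of order [2^-j], which meets boundedly many arcs of generation [j]. *)
Lemma count_near_stationary : exists2 N : R, 0 <= N & forall th j, unit_vector th ->
  \sum_(u <- words j) (near_stationary th j u)%:R <= N.
Proof.
have [m0 hm0] := stationary_diameter.
have e0 : 0 < c / (16 * B) by rewrite divr_gt0// mulr_gt0.
pose rr := 2 * (4 * B) / (c / (16 * B)).
have rr0 : 0 <= rr by rewrite divr_ge0 ?(ltW e0)// !mulr_ge0// ltW.
(* At least [rr + 1]: the slow points lie anywhere in their arcs, so the left ends may be farther
   apart by one arc length. *)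
pose D := (Num.truncn rr).+2.
have rrD : rr + 1 <= D%:R by rewrite /D -natr1 lerD2r ltW// truncnS_gt.
have [j0 mj0 hj0] : exists2 j0 : nat, (m0 <= j0)%N & 4 * B * 2^-1 ^+ j0 <= c / (8 * B).
  have h2 : `|2^-1| < 1 :> R by rewrite gtr0_norm; lra.
  have e1 : 0 < c / (8 * B) / (4 * B) by rewrite !divr_gt0// mulr_gt0.
  have [N _ hN] : \forall n \near \oo, 2^-1 ^+ n < c / (8 * B) / (4 * B) :> R.
    have /cvgrPdist_lt/(_ _ e1) := cvg_expr h2.
    apply: filterS => n; rewrite sub0r normrN; apply: le_lt_trans; exact: ler_norm.
  exists (maxn m0 N); first exact: leq_maxl.
  by rewrite mulrC -ler_pdivlMr ?mulr_gt0// ltW// hN//= leq_maxr.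
exists (2 ^+ j0 + 2 ^+ m0 * D.*2.+1%:R) => [|th j uth]; first by rewrite addr_ge0 ?mulr_ge0 ?exprn_ge0.
have [/ltnW jj0|jj0] := ltnP j j0.
  apply: (@le_trans _ _ (\sum_(u <- words j) 1)).
    by apply: ler_sum => u _; case: near_stationary.
  rewrite big_const_seq count_predT size_words iter_addr_0 natrX.
  apply: (@le_trans _ _ (2 ^+ j0)); last by rewrite lerDl mulr_ge0 ?exprn_ge0.
  by rewrite ler_weXn2l ?ler1n.
apply: (@le_trans _ _ (2 ^+ m0 * D.*2.+1%:R)); last by rewrite lerDr exprn_ge0.
have m0j : (m0 <= j)%N by lia.
have := @sum_words_take R j m0 xpredT (fun u => (near_stationary th j u)%:R) m0j.
rewrite /= => ->.
apply: (@le_trans _ _ (\sum_(p <- words m0) D.*2.+1%:R)); last first.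
  by rewrite big_const_seq count_predT size_words iter_addr_0 -[_ *+ (2 ^ m0)%N]mulr_natl natrX.
rewrite !big_seq; apply: ler_sum => p; rewrite mem_words => /eqP pm.
pose L := [seq u <- words j | (take m0 u == p) && near_stationary th j u].
have -> : \sum_(u <- words j | take m0 u == p) (near_stationary th j u)%:R =
    (size L)%:R :> R.
  rewrite /L size_filter -sum1_count natr_sum big_mkcond [RHS]big_mkcond /=.
  by apply: eq_bigr => u _; case: (_ == _) => //=; case: near_stationary.
rewrite ler_nat; apply: (@card_dyadic_cluster j).
- by rewrite filter_uniq// words_uniq.
- by move=> u; rewrite mem_filter mem_words => /andP[_ /eqP].
move=> u v; rewrite !mem_filter !mem_words.
move=> /andP[/andP[/eqP up /asboolP[t tu ht]] /eqP uj].
move=> /andP[/andP[/eqP vp /asboolP[s sv hs]] /eqP vj].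
have sub z x : take m0 z = p -> dyadic_point R z <= x <= dyadic_end R z ->
    dyadic_point R p <= x <= dyadic_end R p.
  move=> zp /andP[zx xz]; have [] := dyadic_nested R p (drop m0 z).
  have -> : p ++ drop m0 z = z by rewrite -zp cat_take_drop.
  by move=> h1 h2; rewrite (le_trans h1 zx) (le_trans xz h2).
have ts : `|t - s| <= 2^-1 ^+ m0.
  have /andP[t1 t2] := sub _ _ up tu; have /andP[s1 s2] := sub _ _ vp sv.
  have := dyadic_end_sub p; rewrite pm => <-.
  by rewrite ler_norml; apply/andP; split; move: t1 t2 s1 s2; lra.
have hj : 4 * B * 2^-1 ^+ j <= c / (8 * B).
  apply: le_trans hj0; rewrite ler_wpM2l ?mulr_ge0 ?(ltW B0)//.
  by rewrite ler_wiXn2l//; lra.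
have := hm0 th _ t s uth hj (dyadic_itv01 tu) (dyadic_itv01 sv) ts ht hs.
have -> : 2 * (4 * B * 2^-1 ^+ j) / (c / (16 * B)) = rr * 2^-1 ^+ j by rewrite /rr; ring.
move=> ts2.
have du := dyadic_end_sub u; have dv := dyadic_end_sub v; rewrite uj in du; rewrite vj in dv.
apply: (@le_trans _ _ ((rr + 1) * 2^-1 ^+ j)); last by rewrite ler_wpM2r ?exprn_ge0.
rewrite mulrDl mul1r.
set r1 := rr * _ in ts2 *; set r2 := 2^-1 ^+ j in du dv *.
move: tu sv ts2 du dv => /andP[t1 t2] /andP[s1 s2]; rewrite !ler_norml => /andP[? ?] ? ?.
by apply/andP; split; lra.
Qed.

Definition phase th (Lam ph : R) t := Lam * (x1 t * th.1 + x2 t * th.2) + ph.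

Lemma is_derive_phase th Lam ph t :
  is_derive t 1 (phase th Lam ph) (Lam * speed th t).
Proof.
rewrite /phase; apply: is_derive_eq.
rewrite /speed /= !scaler0 !add0r addr0.
by rewrite /GRing.scale /=; ring.
Qed.

(** One integration by parts, written on the antiderivative: subtracting [sin phase / (Lam * speed)]
    from [F] leaves the derivative [sin phase * accel / (Lam * speed^2)]. The two end terms and the
    remaining increment each cost at most [1 / (Lam * dl)]. *)
Lemma oscillation_le th (Lam ph dl al be : R) (F : R -> R) :
  unit_vector th -> 0 < Lam -> 0 < dl -> 0 <= al -> al <= be -> be <= 1 ->
  (forall t : R, is_derive t 1 F (cos (phase th Lam ph t))) ->
  (forall t, al <= t <= be -> dl <= `|speed th t|) -> 4 * B * (be - al) <= dl ->
  `|F be - F al| <= 3 / (Lam * dl).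
Proof.
move=> uth Lam0 dl0 al0 ab be1 dF sdl hab.
have Ldl : 0 < Lam * dl by exact: mulr_gt0.
pose H t := F t - sin (phase th Lam ph t) * (Lam * speed th t)^-1.
pose H' t := sin (phase th Lam ph t) * accel th t * (Lam * speed th t ^+ 2)^-1.
have s0 t : t \in `[al, be]%R -> speed th t != 0.
  by rewrite in_itv /= => /sdl h; rewrite -normr_gt0 (lt_le_trans dl0).
have dH t : t \in `[al, be]%R -> is_derive t 1 H (H' t).
  move=> tab; have st := s0 t tab.
  have dS : is_derive t 1 (fun t => sin (phase th Lam ph t))
      (cos (phase th Lam ph t) * (Lam * speed th t)).
    exact: (is_derive1_comp (is_derive_sin _) (is_derive_phase _ _ _ _)).
  have dL : is_derive t 1 (fun t => Lam * speed th t) (Lam * accel th t).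
    by have ds := is_derive_speed th t; apply: is_derive_eq.
  have L0 : Lam * speed th t != 0 by rewrite mulf_neq0// gt_eqF.
  have dH0 := is_deriveB (dF t) (is_deriveM dS (@is_deriveV R (fun t => Lam * speed th t) t _ 1 L0 dL)).
  have <- : cos (phase th Lam ph t) - (sin (phase th Lam ph t) *:
      (- (Lam * speed th t) ^- 2 *: (Lam * accel th t)) +
      (Lam * speed th t)^-1 *: (cos (phase th Lam ph t) * (Lam * speed th t))) = H' t.
    by rewrite /GRing.scale /= /H'; field; rewrite st gt_eqF.
  exact: dH0.
have HB t : t \in `[al, be]%R -> `|H' t| <= 2 * B / (Lam * dl ^+ 2).
  rewrite in_itv /= => tab; have sd := sdl t tab; have sp0 := lt_le_trans dl0 sd.
  have t01 : 0 <= t <= 1 by move: tab => /andP[? ?]; apply/andP; split; lra.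
  have [zB1 zB2] := zB t01; have ac := dot_unit_le uth zB1 zB2.
  rewrite /H' !normrM normfV normrM (gtr0_norm Lam0) normrX.
  apply: ler_pM; rewrite ?mulr_ge0 ?invr_ge0//.
  - by rewrite mulr_ge0 ?(ltW Lam0)// exprn_ge0.
  - apply: le_trans (_ : 1 * (2 * B) <= _); last by rewrite mul1r.
    by rewrite ler_pM// ler_norml sin_geN1 sin_le1.
  - rewrite lef_pV2 ?posrE ?mulr_gt0 ?exprn_gt0//.
    by rewrite ler_pM2l// lerXn2r ?nnegrE ?(ltW dl0).
have := mean_value_le ab dH HB.
have sb t : t \in `[al, be]%R -> `|sin (phase th Lam ph t) * (Lam * speed th t)^-1| <= (Lam * dl)^-1.
  rewrite in_itv /= => tab; have sd := sdl t tab; have sp0 := lt_le_trans dl0 sd.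
  rewrite normrM normfV normrM (gtr0_norm Lam0) -[leRHS]mul1r.
  apply: ler_pM; rewrite ?invr_ge0 ?mulr_ge0 ?(ltW Lam0)//.
    by rewrite ler_norml sin_geN1 sin_le1.
  by rewrite lef_pV2 ?posrE ?mulr_gt0// ?ler_pM2l.
have s1 := sb be; have s2 := sb al; rewrite !in_itv /= ab !lexx in s1 s2.
move: (s1 isT) (s2 isT) => {}s1 {}s2 h.
have h2 : 2 * B / (Lam * dl ^+ 2) * (be - al) <= (Lam * dl)^-1.
  have -> : 2 * B / (Lam * dl ^+ 2) * (be - al) = 2 * B * (be - al) / dl * (Lam * dl)^-1.
    by field; rewrite !gt_eqF.
  rewrite ler_piMl ?invr_ge0 ?(ltW Ldl)// ler_pdivrMr// mul1r.
  by apply: le_trans hab; rewrite ler_wpM2r ?subr_ge0// ler_wpM2r ?(ltW B0)// ler_nat.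
have -> : F be - F al = (H be - H al) + (sin (phase th Lam ph be) * (Lam * speed th be)^-1
  - sin (phase th Lam ph al) * (Lam * speed th al)^-1) by rewrite /H; ring.
apply: le_trans (ler_normD _ _) _.
apply: le_trans (lerD (le_trans h h2) (le_trans (ler_normB _ _) (lerD s1 s2))) _.
by move: ((Lam * dl)^-1) => z; lra.
Qed.

(** Interpolates between the trivial bound 1 and the bound [a] that integration by parts
    supplies. *)
Lemma le_powR (a b sg : R) : 0 <= b -> b <= 1 -> b <= a -> 0 <= sg -> sg <= 1 ->
  b <= a `^ sg.
Proof.
move=> b0 b1 ba sg0 sg1; have [a1|/ltW a1] := leP 1 a.
  by rewrite (le_trans b1)// -[leLHS](powRr0 a) ler_powR.
have [->|bn0] := eqVneq b 0; first exact: powR_ge0.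
have a0 : 0 < a by rewrite (lt_le_trans _ ba)// lt_neqAle eq_sym bn0.
rewrite (le_trans ba)// -{1}(powRr1 (ltW a0)).
by apply: ger_powR => //; rewrite a0 a1.
Qed.

Lemma near_stationary_nil th : unit_vector th -> near_stationary th 0 [::].
Proof.
move=> uth; apply/asboolP; exists 0.
  rewrite /dyadic_end /dyadic_point big_ord0 lexx add0r expr0 invr1.
  by rewrite ler01.
have t01 : 0 <= (0 : R) <= 1 by rewrite lexx ler01.
have [yB1 yB2] := yB t01; apply: le_trans (dot_unit_le uth yB1 yB2) _.
by rewrite expr0 mulr1 ler_wpM2r ?(ltW B0)// ler_nat.
Qed.

Lemma last_stationary th n u : unit_vector th ->
  exists2 j, (j <= n)%N & near_stationary th j (take j u) /\
    (j = n \/ (j < n)%N /\ ~~ near_stationary th j.+1 (take j.+1 u)).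
Proof.
move=> uth; elim: n => [|n [j jn [sj hj]]].
  by exists 0%N => //; split; [rewrite take0; exact: near_stationary_nil|left].
have [h|h] := boolP (near_stationary th n.+1 (take n.+1 u)).
  by exists n.+1 => //; split=> //; left.
exists j; first exact: leqW.
split=> //; right; case: hj => [->|[jn' hj]]; first by [].
by split=> //; exact: leqW.
Qed.

(** [3 / (2 * B)] comes from [oscillation_le] at speed [4 * B * 2^-(j+1)]; the added 1 lets the
    trivial bound fit the same formula. *)
Definition oscillation_const : R := 1 + 3 / (2 * B).

(** Only the term of the last near-stationary ancestor [j] is used, the others being nonnegative. If
    [j < n], the speed on the arc exceeds [4 * B * 2^-(j+1)]; if [j = n], the bound by 1 suffices
    because [Lam <= 4^n]. *)
Lemma oscillation_pointwise th (Lam ph sg : R) (F : R -> R) n u :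
  unit_vector th -> 0 < Lam -> 0 <= sg -> sg <= 1 ->
  (forall t : R, is_derive t 1 F (cos (phase th Lam ph t))) ->
  (n <= size u)%N -> Lam <= 2 ^+ n * 2 ^+ n ->
  `|2 ^+ size u * (F (dyadic_end R u) - F (dyadic_point R u))| <=
  \sum_(j < n.+1) (near_stationary th j (take j u))%:R *
    ((oscillation_const * (2 ^+ size u / Lam)) `^ sg * pow2 (j%:R * sg)).
Proof.
move=> uth Lam0 sg0 sg1 dF nu Lamn; set al := `|_|.
have C1 : 1 <= oscillation_const by rewrite lerDl divr_ge0// mulr_ge0// ltW.
have p2 k : 0 < 2 ^+ k :> R by rewrite exprn_gt0.
have al1 : al <= 1.
  rewrite /al normrM (ger0_norm (ltW (p2 _))) -ler_pdivlMl// mulr1.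
  have := @mean_value_le R F _ _ _ 1 (ltW (dyadic_lt R u)) (fun t _ => dF t).
  rewrite dyadic_end_sub exprVn mul1r; apply.
  by move=> t _; rewrite ler_norml cos_geN1 cos_le1.
have [j jn [sj hj]] := last_stationary n u uth.
have jn1 : (j < n.+1)%N by [].
rewrite (bigD1 (Ordinal jn1)) //= sj mul1r.
apply: le_trans (_ : _ <= (oscillation_const * (2 ^+ size u / Lam)) `^ sg * pow2 (j%:R * sg)) _; last first.
  by rewrite lerDl; apply: sumr_ge0 => i _; nonneg.
rewrite pow2M pow2_nat -powRM ?exprn_ge0//; last first.
  by apply: mulr_ge0; [exact: le_trans C1|apply: divr_ge0; exact: ltW].
apply: le_powR => //; first exact: normr_ge0.
case: hj => [->|[jn' hj]].
  apply: le_trans al1 _; rewrite -mulrA -[leLHS]mulr1; apply: ler_pM => //.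
  rewrite mulrAC ler_pdivlMr// mul1r (le_trans Lamn)// ler_wpM2r ?exprn_ge0//.
  by rewrite ler_weXn2l// ler1n.
have tu : take j.+1 u ++ drop j.+1 u = u by rewrite cat_take_drop.
have [d1 d2] := dyadic_nested R (take j.+1 u) (drop j.+1 u); rewrite tu in d1 d2.
have sp t : dyadic_point R u <= t <= dyadic_end R u -> 4 * B * 2^-1 ^+ j.+1 <= `|speed th t|.
  move=> /andP[t1 t2]; rewrite leNgt; apply/negP => h; move/negP: hj; apply.
  by apply/asboolP; exists t; [rewrite (le_trans d1 t1) (le_trans t2 d2)|exact: ltW].
have dl0 : 0 < 4 * B * 2^-1 ^+ j.+1 by rewrite !mulr_gt0// exprn_gt0// invr_gt0.
have := oscillation_le uth Lam0 dl0 (dyadic_point_ge0 R u) (ltW (dyadic_lt R u))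
  (dyadic_end_le1 R u) dF sp.
rewrite dyadic_end_sub => /(_ _) h.
rewrite /al normrM (ger0_norm (ltW (p2 _))).
apply: (@le_trans _ _ (2 ^+ size u * (3 / (Lam * (4 * B * 2^-1 ^+ j.+1))))).
  rewrite ler_wpM2l ?(ltW (p2 _))//; apply: h.
  by rewrite ler_wpM2l ?mulr_ge0 ?(ltW B0)// ler_wiXn2l ?invr_ge0 ?invf_le1 ?ler1n ?ler0n ?ltr0n// (leq_trans jn' nu).
have -> : 2 ^+ size u * (3 / (Lam * (4 * B * 2^-1 ^+ j.+1))) =
    3 / (2 * B) * (2 ^+ size u / Lam) * 2 ^+ j.
  by rewrite exprVn exprS; field; rewrite !gt_eqF.
rewrite ler_wpM2r ?(ltW (p2 _))// ler_wpM2r ?divr_ge0 ?(ltW (p2 _)) ?(ltW Lam0)//.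
by rewrite /oscillation_const lerDr.
Qed.

(** In generation [j] at most [N] words are near stationary, each carrying a mass of order
    [2^(- j sg)], which cancels the factor [2^(j sg)]; hence all [n.+1] generations contribute
    alike. *)
Lemma oscillation_sum (N : R) th (Lam ph sg Mb : R) (F : R -> R)
    (p : seq bool -> R) n k :
  0 <= N -> (forall j, \sum_(u <- words j) (near_stationary th j u)%:R <= N) ->
  unit_vector th -> 0 < Lam -> 0 <= sg -> sg <= 1 ->
  (forall t : R, is_derive t 1 F (cos (phase th Lam ph t))) ->
  (n <= k)%N -> Lam <= 2 ^+ n * 2 ^+ n -> (forall u, 0 <= p u) -> 0 <= Mb ->
  (forall j v, (j <= n)%N -> v \in words j ->
    \sum_(u <- words k | take j u == v) p u <= Mb * pow2 (- (j%:R * sg))) ->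
  \sum_(u <- words k) `|2 ^+ k * (F (dyadic_end R u) - F (dyadic_point R u))| * p u <=
  n.+1%:R * (N * Mb) * (oscillation_const * (2 ^+ k / Lam)) `^ sg.
Proof.
move=> N0 hN uth Lam0 sg0 sg1 dF nk Lamn p0 Mb0 hp.
set A := (_ `^ sg); have A0 : 0 <= A by exact: powR_ge0.
apply: (@le_trans _ _ (\sum_(u <- words k) \sum_(j < n.+1)
   ((near_stationary th j (take j u))%:R * (A * pow2 (j%:R * sg))) * p u)).
  rewrite !big_seq; apply: ler_sum => u; rewrite mem_words => /eqP uk.
  rewrite -mulr_suml ler_wpM2r//.
  have := @oscillation_pointwise th Lam ph sg F n u uth Lam0 sg0 sg1 dF.
  by rewrite uk; apply.
rewrite exchange_big /=.
have -> : n.+1%:R * (N * Mb) * A = \sum_(j < n.+1) (N * Mb * A).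
  by rewrite sumr_const card_ord -mulr_natl; ring.
apply: ler_sum => j _.
have jn : (j <= n)%N by rewrite -ltnS.
apply: (@le_trans _ _ (A * pow2 (j%:R * sg) *
    \sum_(u <- words k | near_stationary th j (take j u)) p u)).
  rewrite mulr_sumr [leRHS]big_mkcond /=; apply: ler_sum => u _.
  by case: near_stationary; rewrite ?mul1r ?mul0r.
rewrite (sum_words_take (near_stationary th j) p (leq_trans jn nk)).
apply: (@le_trans _ _ (A * pow2 (j%:R * sg) * (N * (Mb * pow2 (- (j%:R * sg)))))).
  rewrite ler_wpM2l ?mulr_ge0 ?pow2_ge0//.
  apply: le_trans (ler_wpM2r _ (hN j)); last by nonneg.
  rewrite mulr_suml big_mkcond /= !big_seq; apply: ler_sum => v vj.
  by case: near_stationary; rewrite ?mul1r ?mul0r//; exact: hp.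
rewrite pow2N; have : 0 < pow2 (j%:R * sg) by exact: pow2_gt0.
by move=> pj; rewrite le_eqVlt; apply/orP; left; apply/eqP; field; rewrite gt_eqF.
Qed.

End Curve.

(** * Decay of cascade integrals *)

Lemma half_threshold (L : nat) : exists n0 : nat,
  [/\ (L + 5 <= n0 + n0)%N, (n0 + n0 <= L + 6)%N, (n0.+1 <= 4 * L.+1)%N &
      forall n, (L + 5 <= n + n)%N -> (n0 <= n)%N].
Proof. by exists (L + 6)./2; split=> [|||n]; lia. Qed.

Section FourierPath.
Variable R : realType.
Implicit Types (w : seq bool -> R) (F : R -> R).

(** The mean over the arc of [u] of the function with antiderivative [F]. In these terms the
    integral against a step of the cascade is a finite sum, and the means over two children average
    to that over the parent. *)
Definition osc F u : R :=
  2 ^+ size u * (F (dyadic_end R u) - F (dyadic_point R u)).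

Definition cascade_integral w n F : R := \sum_(v <- words n) osc F v * mass w v.

Lemma osc_split F v : osc F (rcons v false) + osc F (rcons v true) = 2 * osc F v.
Proof.
rewrite /osc !size_rcons; have [-> -> ->] := dyadic_rconsF R v.
by rewrite exprS; ring.
Qed.

Lemma cascade_integralS w n F :
  cascade_integral w n.+1 F - cascade_integral w n F =
  \sum_(u <- words n.+1) osc F u * (mass w u - parent_mass w n u).
Proof.
under [RHS]eq_bigr do rewrite mulrBr.
rewrite sumrB; congr (_ - _).
rewrite sum_words_rcons; apply: eq_big_seq => v; rewrite mem_words => /eqP vn.
have tk b : take n (rcons v b) = v by rewrite -vn -cats1 take_size_cat.
by rewrite /parent_mass !tk -mulrDl osc_split; field.
Qed.

Lemma osc_le1 F f u : (forall t : R, is_derive t 1 F (f t)) ->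
  (forall t, `|f t| <= 1) -> `|osc F u| <= 1.
Proof.
move=> dF f1; rewrite /osc normrM ger0_norm ?exprn_ge0// -ler_pdivlMl ?exprn_gt0// mulr1.
have := @mean_value_le R F _ _ _ 1 (ltW (dyadic_lt R u)) (fun t _ => dF t) (fun t _ => f1 t).
by rewrite dyadic_end_sub exprVn mul1r.
Qed.

Variables (w : seq bool -> R) (a q M K sg : R).
Hypothesis w0 : forall u, 0 <= w u.
Hypothesis a0 : 0 < a.
Hypothesis q1 : 1 < q.
Hypothesis M0 : 0 <= M.
Hypothesis K1 : 1 <= K.
Hypothesis massq : forall n,
  \sum_(v <- words n) mass w v `^ q <= K * pow2 (- (n%:R * (a * q))).
Hypothesis sg0 : 0 < sg.
Hypothesis sga : sg < a.
Hypothesis sg1 : sg <= 1.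
Variable Cb : R.
Hypothesis Cb0 : 0 <= Cb.
Hypothesis branch_le : forall n u, (size u <= n)%N ->
  branch_mass w n u <= Cb * n.+1%:R * pow2 (- ((size u)%:R * sg)).

Variables x1 x2 y1 y2 z1 z2 : R -> R.
Hypothesis dx1 : forall t : R, is_derive t 1 x1 (y1 t).
Hypothesis dx2 : forall t : R, is_derive t 1 x2 (y2 t).
Hypothesis dy1 : forall t : R, is_derive t 1 y1 (z1 t).
Hypothesis dy2 : forall t : R, is_derive t 1 y2 (z2 t).
Variables B N : R.
Hypothesis B0 : 0 < B.
Hypothesis yB : forall t : R, 0 <= t <= 1 -> `|y1 t| <= B /\ `|y2 t| <= B.
Hypothesis zB : forall t : R, 0 <= t <= 1 -> `|z1 t| <= B /\ `|z2 t| <= B.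
Hypothesis N0 : 0 <= N.
Hypothesis count_le : forall th j, unit_vector th ->
  \sum_(u <- words j) (near_stationary y1 y2 B th j u)%:R <= N.

Let K0 : 0 < K. Proof. by apply: lt_le_trans K1. Qed.

(** The geometric mean of the order [2^(- n a)] of the cut-off and the order [2^((n - L) sg)] of the
    variance sum. With the parameter [freq_scale] the variance term and [X / s] then have this
    common order, up to polynomial factors. *)
Definition freq_size n (L : nat) : R :=
  pow2 (- (n%:R * ((a - sg) / 2))) * pow2 (- (L%:R * (sg / 2))).
Definition freq_scale n (L : nat) : R := (2 * K * freq_size n L)^-1.

Lemma freq_size_gt0 n L : 0 < freq_size n L.
Proof. by rewrite mulr_gt0 ?pow2_gt0. Qed.

Lemma pow2_le_freq_size n L : (L <= n + n)%N -> pow2 (- (n%:R * a)) <= freq_size n L.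
Proof.
move=> Ln; rewrite /freq_size -pow2D ler_pow2 -subr_ge0.
have : 0 <= ((n + n)%:R - L%:R) * (sg / 2) :> R.
  by rewrite mulr_ge0 ?subr_ge0 ?ler_nat// divr_ge0// ltW.
have : 0 <= n%:R * (a - sg) / 2 :> R by rewrite !mulr_ge0// subr_ge0 ltW.
rewrite natrD; lra.
Qed.

Lemma freq_scale_cutoff n L : (L <= n + n)%N ->
  freq_scale n L * cutoff a K n <= 2^-1.
Proof.
move=> Ln; have T0 := freq_size_gt0 n L.
rewrite /freq_scale mulrC ler_pdivrMr; last by apply: mulr_gt0 T0; apply: mulr_gt0.
have -> : 2^-1 * (2 * K * freq_size n L) = K * freq_size n L by field.
apply: le_trans (cutoff_le a0 K1 n) _; rewrite ler_wpM2l ?(ltW K0)//.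
exact: pow2_le_freq_size.
Qed.

Section Frequency.
Variables (L : nat) (th : R * R) (Lam ph : R) (F : R -> R).
Hypothesis uth : unit_vector th.
Hypothesis Lam_ge : 2 ^+ L <= Lam.
Hypothesis Lam_le : Lam <= 2 ^+ (L + 5).
Hypothesis dF : forall t : R, is_derive t 1 F (cos (phase x1 x2 th Lam ph t)).

Let Lam0 : 0 < Lam. Proof. by apply: lt_le_trans Lam_ge; rewrite exprn_gt0. Qed.

Let OC : R := 2 * oscillation_const B.
Let C1 : 1 <= oscillation_const B.
Proof. by rewrite lerDl divr_ge0// mulr_ge0// ltW. Qed.

(** Serves both the masses of generation [n] ([k = n]) and the parent masses attached to generation
    [n.+1] ([k = n.+1]); the factor 2 in [OC] pays for the second case. *)
Lemma osc_weight_le (p : seq bool -> R) n k : (n <= k <= n.+1)%N ->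
  (L + 5 <= n + n)%N -> (forall u, 0 <= p u) ->
  (forall j v, (j <= n)%N -> v \in words j ->
    \sum_(u <- words k | take j u == v) p u <= branch_mass w n v) ->
  \sum_(u <- words k) `|osc F u| * p u <=
  n.+1%:R ^+ 2 * (N * Cb * OC) * pow2 ((n%:R - L%:R) * sg).
Proof.
move=> /andP[nk kn] Ln p0 hp.
have Lam2 : Lam <= 2 ^+ n * 2 ^+ n.
  by rewrite (le_trans Lam_le)// -exprD ler_weXn2l// ler1n.
have := oscillation_sum dx1 dx2 dy1 dy2 B0 yB zB (Mb := Cb * n.+1%:R) (k := k)
  N0 (fun j => count_le j uth) uth Lam0 (ltW sg0) sg1 dF nk Lam2 p0.
rewrite mulr_ge0// => /(_ isT).
have hp2 j v : (j <= n)%N -> v \in words j ->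
    \sum_(u <- words k | take j u == v) p u <= Cb * n.+1%:R * pow2 (- (j%:R * sg)).
  move=> jn vj; apply: le_trans (hp j v jn vj) _.
  by move: vj; rewrite mem_words => /eqP vj; rewrite -vj; apply: branch_le; rewrite vj.
move=> /(_ hp2); rewrite (eq_big_seq (fun u => `|osc F u| * p u)); last first.
  by move=> u; rewrite mem_words /osc => /eqP->.
move=> /le_trans; apply.
have Bd : (oscillation_const B * (2 ^+ k / Lam)) `^ sg <= OC * pow2 ((n%:R - L%:R) * sg).
  have h1 : oscillation_const B * (2 ^+ k / Lam) <= OC * pow2 (n%:R - L%:R).
    rewrite /OC [2 * _]mulrC -mulrA ler_wpM2l ?(le_trans ler01)//.
    rewrite ler_pdivrMr// pow2D pow2N !pow2_nat.
    apply: (@le_trans _ _ (2 ^+ n.+1)); first by rewrite ler_weXn2l// ler1n.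
    have -> : 2 * (2 ^+ n / 2 ^+ L) * Lam = 2 ^+ n.+1 * (Lam / 2 ^+ L) by rewrite exprS; ring.
    by rewrite ler_peMr ?exprn_ge0// ler_pdivlMr ?exprn_gt0// mul1r.
  have o0 : 0 <= oscillation_const B by exact: le_trans C1.
  have OC1 : 1 <= OC by move: C1; rewrite /OC; lra.
  have -> : pow2 ((n%:R - L%:R) * sg) = pow2 (n%:R - L%:R) `^ sg by exact: pow2M.
  apply: le_trans (_ : (OC * pow2 (n%:R - L%:R)) `^ sg <= _).
    apply: ge0_ler_powR h1; rewrite ?nnegrE ?(ltW sg0)// mulr_ge0 ?pow2_ge0 ?(le_trans ler01 OC1)//.
    by apply: divr_ge0; [exact: exprn_ge0|exact: ltW].
  rewrite powRM ?pow2_ge0 ?(le_trans ler01 OC1)// ler_wpM2r ?powR_ge0//.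
  by rewrite -[leRHS]powRr1 ?(le_trans ler01 OC1)// ler_powR.
have n0 : 0 <= n.+1%:R * (N * (Cb * n.+1%:R)) by nonneg.
apply: le_trans (ler_wpM2l n0 Bd) _; rewrite le_eqVlt; apply/orP; left; apply/eqP; ring.
Qed.

End Frequency.

(** At the first generation whose arcs resolve the wave, [osc_weight_le] bounds the integral itself.
    The later increments are controlled by [level_sum_bound], with both signs [b] for the absolute
    value, and [osc^2 <= |osc|] reduces their variance to [osc_weight_le] again. *)
Lemma fourier_path (C0 : R) : 0 <= C0 -> exists2 C : R, 0 <= C &
  forall (L : nat) (th : R * R) (Lam ph : R) F,
    unit_vector th -> 2 ^+ L <= Lam -> Lam <= 2 ^+ (L + 5) ->
    (forall t : R, is_derive t 1 F (cos (phase x1 x2 th Lam ph t))) ->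
    (forall n (b : bool), (L + 5 <= n + n)%N ->
      level_sum q M n (fun u => freq_scale n L * ((-1) ^+ b * osc F u))
        (cutoff a K n) w <= C0 * n.+1%:R) ->
    forall n, (L + 5 <= n + n)%N ->
      `|cascade_integral w n F| <= C * L.+1%:R ^+ 2 * pow2 (- (L%:R * (sg / 2))).
Proof.
move=> C00.
pose OC : R := 2 * oscillation_const B; pose E := N * Cb * OC.
pose D := E + M * K * pow2 (a * (q - 1)) + 2 * K * C0.
have o0 : 0 <= oscillation_const B by rewrite addr_ge0// divr_ge0// mulr_ge0// ltW.
have E0 : 0 <= E by rewrite /E /OC; nonneg.
have M1 : 0 <= M * K * pow2 (a * (q - 1)) by nonneg.
have D0 : 0 <= D by rewrite /D; nonneg.
have [|G G0 hG] := @geometric_growth R D ((a - sg) / 2) 2%N D0.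
  by rewrite divr_gt0// subr_gt0.
(* 16 stems from [n0.+1 <= 4 * L.+1], and the power of two from [n0 + n0 <= L + 6]. *)
exists (16 * E * pow2 (3 * sg) + G) => [|L th Lam ph F uth LamL LamU dF hlev n Ln].
  by rewrite addr_ge0//; nonneg.
pose tau : R := pow2 (- (L%:R * (sg / 2))).
have [n0 [n0L n0U n04 /(_ n Ln) n0n]] := half_threshold L.
have f1 (t : R) : `|cos (phase x1 x2 th Lam ph t)| <= 1 by rewrite ler_norml cos_geN1 cos_le1.
have pm0 k u : 0 <= parent_mass w k u by rewrite divr_ge0// mass_ge0.
have step (b : bool) k : (n0 <= k)%N ->
    (-1) ^+ b * cascade_integral w k.+1 F <= (-1) ^+ b * cascade_integral w k F +
      D * k.+1%:R ^+ 2 * pow2 (- (k%:R * ((a - sg) / 2))) * tau.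
  move=> n0k; have Lk : (L + 5 <= k + k)%N := leq_trans n0L (leq_add n0k n0k).
  have al1 u : `|(-1) ^+ b * osc F u| <= 1.
    by rewrite normrM normrX normrN1 expr1n mul1r; exact: (osc_le1 u dF f1).
  have T0 := freq_size_gt0 k L.
  have s0 : 0 < freq_scale k L.
    by rewrite invr_gt0; apply: mulr_gt0 T0; apply: mulr_gt0.
  have := level_sum_bound w0 q1 M0 K1 massq s0 al1 (hlev k b Lk).
  have -> : \sum_(u <- words k.+1) (-1) ^+ b * osc F u * (mass w u - parent_mass w k u) =
      (-1) ^+ b * cascade_integral w k.+1 F - (-1) ^+ b * cascade_integral w k F.
    rewrite -[RHS]mulrBr cascade_integralS [RHS]mulr_sumr; apply: eq_bigr => u _.
    exact: esym (mulrA _ _ _).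
  rewrite lerBlDl => /le_trans; apply; rewrite lerD2l.
  set V := \sum_(u <- _) _.
  have V0 : 0 <= V by apply: sumr_ge0 => u _; rewrite mulr_ge0 ?sqr_ge0.
  have VE : V <= k.+1%:R ^+ 2 * E * pow2 ((k%:R - L%:R) * sg).
    apply: le_trans (osc_weight_le uth LamL LamU dF (k := k.+1) (n := k) _ Lk (pm0 k) _).
    - apply: ler_sum => u _; rewrite exprMn sqrr_sign mul1r ler_wpM2r//.
      have o1 := osc_le1 u dF f1; rewrite -real_normK ?num_real// expr2.
      by rewrite ler_piMr.
    - by rewrite leqnSn leqnn.
    - move=> j v jk; rewrite mem_words => /eqP vj.
      rewrite -sum_branch_parent ?vj// [leLHS]big_mkcond /=; apply: ler_sum => u _.
      by case: ifP => _; rewrite ?mul1r ?mul0r.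
  set T := freq_size k L in T0 s0 *.
  have pT : pow2 (- (k%:R * a)) <= T by apply: pow2_le_freq_size; exact: leq_trans (leq_addr 5 L) Lk.
  have TT : pow2 (- (k%:R * a)) * pow2 ((k%:R - L%:R) * sg) = T * T.
    by rewrite /T /freq_size -!pow2D; congr pow2; field.
  have k1 : 1 <= k.+1%:R :> R by rewrite ler1n.
  have k2 : 1 <= k.+1%:R ^+ 2 :> R by rewrite exprn_ege1.
  have c1 : 2 * freq_scale k L * cutoff a K k * V <= E * k.+1%:R ^+ 2 * T.
    have -> : 2 * freq_scale k L * cutoff a K k * V = cutoff a K k * V / (K * T).
      by rewrite /freq_scale -/T; field; rewrite !gt_eqF.
    rewrite ler_pdivrMr; last exact: (mulr_gt0 K0 T0).
    apply: le_trans (ler_pM _ V0 (cutoff_le a0 K1 k) VE) _.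
      exact/ltW/cutoff_gt0.
    have -> : K * pow2 (- (k%:R * a)) * (k.+1%:R ^+ 2 * E * pow2 ((k%:R - L%:R) * sg)) =
      K * k.+1%:R ^+ 2 * E * (pow2 (- (k%:R * a)) * pow2 ((k%:R - L%:R) * sg)) by ring.
    by rewrite TT le_eqVlt; apply/orP; left; apply/eqP; ring.
  have c2 : M * K * pow2 (a * (q - 1)) * pow2 (- (k%:R * a)) <=
      M * K * pow2 (a * (q - 1)) * k.+1%:R ^+ 2 * T.
    rewrite -[leRHS]mulrA ler_wpM2l//; apply: le_trans pT _.
    by rewrite ler_peMl// ltW.
  have c3 : C0 * k.+1%:R / freq_scale k L <= 2 * K * C0 * k.+1%:R ^+ 2 * T.
    rewrite /freq_scale invrK -/T.
    have -> : C0 * k.+1%:R * (2 * K * T) = 2 * K * C0 * k.+1%:R * T by ring.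
    rewrite ler_wpM2r ?(ltW T0)// ler_wpM2l//; first by nonneg.
    by rewrite expr2 ler_peMl.
  have -> : D * k.+1%:R ^+ 2 * pow2 (- (k%:R * ((a - sg) / 2))) * tau =
      E * k.+1%:R ^+ 2 * T + M * K * pow2 (a * (q - 1)) * k.+1%:R ^+ 2 * T +
      2 * K * C0 * k.+1%:R ^+ 2 * T.
    by rewrite /D /T /freq_size -/tau; ring.
  by apply: lerD c3; exact: lerD c1 c2.
have bnd (b : bool) : (-1) ^+ b * cascade_integral w n F <=
    (-1) ^+ b * cascade_integral w n0 F + G * tau.
  exact: (hG (fun k => (-1) ^+ b * cascade_integral w k F) tau n0 (pow2_ge0 _) (step b) n n0n).
have bn : `|cascade_integral w n F| <= `|cascade_integral w n0 F| + G * tau.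
  have := bnd false; have := bnd true; rewrite expr1 expr0 !mulN1r !mul1r => h1 h2.
  rewrite ler_norml lerNl; apply/andP; split.
    by apply: le_trans h1 _; rewrite lerD2r -normrN ler_norm.
  by apply: le_trans h2 _; rewrite lerD2r ler_norm.
apply: le_trans bn _.
have L1 : 1 <= L.+1%:R ^+ 2 :> R by rewrite exprn_ege1// ler1n.
have tau0 : 0 <= tau by exact: pow2_ge0.
rewrite -/tau 2!mulrDl; apply: lerD; last first.
  by rewrite ler_wpM2r// ler_peMr.
apply: (@le_trans _ _ (\sum_(v <- words n0) `|osc F v| * mass w v)).
  apply: le_trans (ler_norm_sum _ _ _) _; apply: ler_sum => v _.
  by rewrite normrM (ger0_norm (mass_ge0 v w0)).
apply: le_trans (osc_weight_le uth LamL LamU dF (k := n0) (n := n0) _ n0L _ _) _.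
- by rewrite leqnn leqnSn.
- by move=> u; exact: mass_ge0.
- move=> j v jn; rewrite mem_words => /eqP vj.
  by rewrite /branch_mass vj.
rewrite -/OC -/E.
have n0R : n0.+1%:R ^+ 2 <= 16 * L.+1%:R ^+ 2 :> R.
  have -> : 16 * L.+1%:R ^+ 2 = (4 * L.+1%:R) ^+ 2 :> R by ring.
  by rewrite lerXn2r ?nnegrE// ?mulr_ge0// -natrM ler_nat.
have pR : pow2 ((n0%:R - L%:R) * sg) <= pow2 (3 * sg) * tau.
  rewrite -pow2D ler_pow2 -subr_ge0.
  have -> : 3 * sg + - (L%:R * (sg / 2)) - (n0%:R - L%:R) * sg =
      ((L + 6)%:R - (n0 + n0)%:R) * (sg / 2) by rewrite !natrD; field.
  by rewrite mulr_ge0 ?subr_ge0 ?ler_nat// divr_ge0// ltW.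
apply: le_trans (ler_pM _ _ (ler_wpM2r E0 n0R) pR) _; [by nonneg|by nonneg|].
by rewrite le_eqVlt; apply/orP; left; apply/eqP; ring.
Qed.

End FourierPath.

(** * Branching events *)

Section FieldExtensionality.
Variable R : realType.

Definition agree (w w' : seq bool -> R) := forall v, v != [::] -> w v = w' v.

(** The generators do not observe the empty word, and the sets with this property form a
    sigma-algebra. This reconciles glued and shifted fields, which may differ at the root. *)
Lemma measurable_agree (A : set (field R)) : measurable A ->
  forall w w', agree w w' -> A w -> A w'.
Proof.
move=> mA.
suff H : forall w w', agree w w' -> A w = A w' by move=> w w' /H ->.
pose inv := [set X : set (field R) | forall w w', agree w w' -> X w = X w'].
have : <<s @cylinders R >> `<=` inv.
  apply: smallest_sub.
  - split.
    + by [].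
    + by move=> X hX w w' ww'; rewrite setTD /setC /= (hX _ _ ww').
    + move=> F hF w w' ww'; rewrite /bigcup /=; apply/propext; split=> -[i _ Fi];
        by exists i => //; move: Fi; rewrite (hF i _ _ ww').
  - move=> _ [J [B [J0 _ ->]]] w w' ww'; apply/propext; split=> h v vJ.
    + by rewrite -ww'; [exact: h|apply: contraNneq J0 => <-].
    + by rewrite ww'; [exact: h|apply: contraNneq J0 => <-].
by move=> /(_ A mA).
Qed.

Lemma measurable_section_agree (E : set (R * field R)) y : measurable E ->
  forall w w', agree w w' -> E (y, w) -> E (y, w').
Proof.
move=> mE w w' ww' Ew.
have := measurable_agree (measurable_xsection y mE) ww'.
by rewrite /xsection /= !inE; apply.
Qed.

Lemma measurable_subtree v : measurable_fun [set: field R]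
  (fun w : field R => subtree w v : field R).
Proof.
apply: measurable_field => u u0; apply: measurable_coord.
by case: v => //; rewrite cats0.
Qed.

Lemma measurable_total_mass n : measurable_fun [set: field R] (fun w => total_mass w n).
Proof. by apply: measurable_sum => v; exact: measurable_mass. Qed.

(** The lower limit is measurable whether or not the total masses converge; where they do, it is
    their limit. *)
Definition limit_mass (w : seq bool -> R) : R :=
  fine (limn_einf (fun n => (total_mass w n)%:E)).

Lemma measurable_limit_mass : measurable_fun [set: field R] limit_mass.
Proof.
apply: measurableT_comp => //.
rewrite /limn_einf; apply: measurableT_comp => //.
by apply: measurable_fun_limn_esup => n; apply: measurableT_comp => //;
  apply/measurable_EFinP; exact: measurable_total_mass.
Qed.

Lemma limit_mass_cvg w : cvgn (total_mass w) ->
  total_mass w n @[n --> \oo] --> limit_mass w.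
Proof.
move=> cw; rewrite /limit_mass.
have ce : (total_mass w n)%:E @[n --> \oo] --> (limn (total_mass w))%:E.
  by apply: cvg_EFin => //; exact: nearW.
by rewrite (cvg_limn_einf_sup ce).1.
Qed.

End FieldExtensionality.

Section Branching.
Context d (T : measurableType d) (R : realType) (rho : set R -> \bar R).
Variables (m : probability T R) (U : seq bool -> T -> R).
Hypothesis iidU : iid_field m rho U.
Implicit Type E : set (R * field R).

Definition branch_event E b : set T :=
  [set t | E (U [:: b] t, subtree (U ^~ t) [:: b])].

Definition section_prob E (y : R) : \bar R := m [set t | E (y, (U ^~ t) : field R)].

(** The weight of a child is read at [[:: true]]: all nonempty words have the same law, so one
    number serves both branches. *)
Definition branch_prob E : \bar R := (\int[m]_t section_prob E (U [:: true] t))%E.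

Lemma measurable_branch_map b : measurable_fun [set: field R]
  (fun w : field R => (w [:: b], subtree w [:: b] : field R)).
Proof.
apply: measurable_fun_pair; first exact: measurable_coord.
exact: measurable_subtree.
Qed.

Lemma measurable_branch_event E b : measurable E -> measurable (branch_event E b).
Proof.
move=> mE; rewrite -[X in measurable X]setTI.
apply: (measurableT_comp (measurable_branch_map b) (iid_measurable iidU)) => //.
Qed.

Lemma measurable_section_event E : measurable E ->
  measurable [set z : R * T | E (z.1, (U ^~ z.2) : field R)].
Proof.
move=> mE; rewrite -[X in measurable X]setTI.
apply: (measurable_fun_pair (f := fst) (g := fun z : R * T => (U ^~ z.2) : field R)) => //.
by apply: (measurableT_comp (iid_measurable iidU)) => //; exact: measurable_snd.
Qed.

Lemma measurable_section_prob E : measurable E -> measurable_fun setT (section_prob E).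
Proof.
move=> mE.
apply: eq_measurable_fun (measurable_fun_xsection m (measurable_section_event mE)) => y _.
by rewrite /= /section_prob; congr (m _); apply/seteqP; split=> t; rewrite /xsection /= inE.
Qed.

Lemma section_prob_ge0 E y : (0 <= section_prob E y)%E.
Proof. exact: measure_ge0. Qed.

Lemma measurable_field_set (A : set (field R)) : measurable A ->
  measurable [set t | A (U ^~ t)].
Proof.
by move=> mA; rewrite -[X in measurable X]setTI; exact: (iid_measurable iidU).
Qed.

(** Once the single weight at [[:: b]] is frozen, the field below it is a shifted field with the law
    of the whole; the value at its root does not affect the section of [E]. *)
Lemma prob_branch_event E b : measurable E -> m (branch_event E b) = branch_prob E.
Proof.
move=> mE.
pose A := [set w : field R | E (w [:: b], subtree w [:: b] : field R)].
have mA : measurable A.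
  by rewrite -[X in measurable X]setTI; exact: measurable_branch_map.
rewrite -[branch_event E b]setIT -integral_indic//; last exact: measurable_branch_event.
transitivity (\int[m]_t (\1_A (U ^~ t))%:E)%E; first by apply: eq_integral => t _; rewrite !indicE.
rewrite (@iid_split _ _ _ _ _ _ iidU (pred1 [:: b])
  (fun w : field R => (\1_A w)%:E)); last 2 first.
- by apply/measurable_EFinP; exact: measurable_indic.
- by move=> w; rewrite lee_fin indicE.
rewrite /branch_prob.
rewrite -(@iid_marginal _ _ _ _ _ _ iidU [:: b] (section_prob E))//; last exact: measurable_section_prob.
apply: eq_integral => t _.
transitivity (\int[m]_t' (\1_(xsection E (U [:: b] t)) ((fun v => U ([:: b] ++ v) t') : field R))%:E)%E.
  apply: eq_integral => t' _; congr (_%:E); rewrite !indicE; congr (nat_of_bool _)%:R.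
  rewrite /xsection /A; apply/idP/idP; rewrite !inE /= ?inE /glue /= eqxx => h.
  + apply: (measurable_section_agree mE) h.
    by move=> [|c v] //= _; rewrite /subtree /=; case: eqP.
  + apply: (measurable_section_agree mE) h.
    by move=> [|c v] //= _; rewrite /subtree /=; case: eqP.
rewrite (iid_law (iid_shift iidU [:: b]) iidU (f := fun w : field R => (\1_(xsection E (U [:: b] t)) w)%:E)); last 2 first.
- by apply/measurable_EFinP; apply: measurable_indic; exact: measurable_xsection.
- by move=> w; rewrite lee_fin indicE.
rewrite /section_prob -[X in m X]setIT -integral_indic//.
  apply: eq_integral => t' _; congr (_%:E); rewrite !indicE; congr (nat_of_bool _)%:R.
  by apply/idP/idP; rewrite !inE /xsection /= inE.
rewrite [X in measurable X](_ : _ = [set t0 | (xsection E (U [:: b] t) : set (field R)) (U ^~ t0)]).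
  by apply: measurable_field_set; exact: measurable_xsection.
by apply/seteqP; split=> x; rewrite /xsection /= inE.
Qed.

(** The two branches depend on disjoint sets of words, so their complements are independent. *)
Lemma prob_no_branch E : measurable E ->
  m (~` branch_event E false `&` ~` branch_event E true) =
  ((1 - branch_prob E) * (1 - branch_prob E))%E.
Proof.
move=> mE.
pose A b := [set w : field R | ~ E (w [:: b], subtree w [:: b] : field R)].
have mA b : measurable (A b).
  apply: (@measurableC _ _ [set w : field R | E (w [:: b], subtree w [:: b] : field R)]).
  by rewrite -[X in measurable X]setTI; exact: measurable_branch_map.
have mb b : m (~` branch_event E b) = (1 - branch_prob E)%E.
  by rewrite probability_setC ?prob_branch_event//; exact: measurable_branch_event.
have mG b : measurable (~` branch_event E b).
  by apply: measurableC; exact: measurable_branch_event.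
rewrite -[X in m X]setIT -integral_indic//; last exact: measurableI.
transitivity (\int[m]_t (\1_(A false `&` A true) ((U ^~ t) : field R))%:E)%E.
  by apply: eq_integral => t _; rewrite !indicE.
(* The default [true] of [head] puts the empty word on the side of the words beginning with
   [true]. *)
rewrite (@iid_split _ _ _ _ _ _ iidU (fun v => head true v == false)
  (fun w : field R => (\1_(A false `&` A true) w)%:E)); last 2 first.
- by apply/measurable_EFinP; apply: measurable_indic; exact: measurableI.
- by move=> w; rewrite lee_fin indicE.
transitivity (\int[m]_t ((\1_(~` branch_event E false) t)%:E * m (~` branch_event E true)))%E.
  apply: eq_integral => t _.
  transitivity (\int[m]_t' ((\1_(~` branch_event E false) t)%:E * (\1_(~` branch_event E true) t')%:E))%E.
    apply: eq_integral => t' _; rewrite -EFinM; congr (_%:E).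
    have -> : glue (fun v => head true v == false) (U^~ t) (U^~ t') = (fun v => if head true v == false then U v t else U v t') by [].
    rewrite !indicE -natrM mulnb; congr (nat_of_bool _)%:R.
    rewrite /branch_event /A; apply/idP/andP; rewrite !inE /= /subtree /=; exact: id.
  rewrite ge0_integralZl_EFin ?lee_fin//; first by rewrite integral_indic// setIT.
  by apply/measurable_EFinP; exact: measurable_indic.
rewrite ge0_integralZr//; last first.
  by apply/measurable_EFinP; exact: measurable_indic.
rewrite integral_indic// setIT.
by congr (_ * _)%E; exact: mb.
Qed.

End Branching.

Definition word_of_nat (n : nat) : seq bool := odflt [::] (choice.unpickle n).

Lemma word_of_nat_surj v : exists n, word_of_nat n = v.
Proof. by exists (choice.pickle v); rewrite /word_of_nat choice.pickleK. Qed.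

Section Transfer.
Context d (T : measurableType d) (R : realType) (rho : set R -> \bar R).
Variables (m : probability T R) (U : seq bool -> T -> R).
Hypothesis iidU : iid_field m rho U.
Implicit Type A : set (field R).

Lemma prob_subtree A u : measurable A ->
  m [set t | A (subtree (U ^~ t) u)] = m [set t | A (U ^~ t)].
Proof.
move=> mA.
have key (V : seq bool -> T -> R) : iid_field m rho V ->
    m [set t | A (V ^~ t)] = (\int[m]_t (\1_A ((V ^~ t) : field R))%:E)%E.
  move=> iidV; rewrite -[X in m X]setIT -integral_indic//; last exact: (measurable_field_set iidV).
rewrite (key _ iidU) (key _ (iid_shift iidU u)).
apply: (iid_law (iid_shift iidU u) iidU (f := fun w => (\1_A w)%:E)).
- by apply/measurable_EFinP; exact: measurable_indic.
- by move=> w; rewrite lee_fin indicE.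
Qed.

Lemma ae_subtree A : measurable A -> {ae m, forall t, A (U ^~ t)} ->
  {ae m, forall t u, A (subtree (U ^~ t) u)}.
Proof.
move=> mA aeA.
have A0 : m [set t | (~` A) (U ^~ t)] = 0%E.
  by apply: measure_negligible aeA; exact: (measurable_field_set iidU (measurableC mA)).
have := @ae_foralln _ _ _ m (fun n t => A (subtree (U ^~ t) (word_of_nat n))).
move=> H; have {}H := H _; apply: (filterS _ (H _)) => [t h u|n].
  by have [n <-] := word_of_nat_surj u.
exists [set t | (~` A) (subtree (U ^~ t) (word_of_nat n))]; split=> //.
- apply: (measurable_field_set (iid_shift iidU _)); exact: measurableC.
- exact: etrans (prob_subtree _ (measurableC mA)) A0.
Qed.

End Transfer.

(** * Limit masses of subtrees *)

Section Regular.
Variable R : realType.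
Implicit Type w : seq bool -> R.

Definition regular w := forall u, cvgn (total_mass (subtree w u)).

Lemma measurable_cvg_total_mass : measurable [set w : field R | cvgn (total_mass w)].
Proof.
have mE n : measurable_fun [set: field R] (fun w => (total_mass w n)%:E).
  by apply/measurable_EFinP; exact: measurable_total_mass.
have msup : measurable_fun [set: field R] (fun w => limn_esup (fun n => (total_mass w n)%:E)).
  exact: measurable_fun_limn_esup.
have minf : measurable_fun [set: field R] (fun w => limn_einf (fun n => (total_mass w n)%:E)).
  rewrite /limn_einf; apply: measurableT_comp => //.
  by apply: measurable_fun_limn_esup => n; apply: measurableT_comp.
rewrite (_ : [set w : field R | _] = [set w : field R | (limn_esup (fun n => (total_mass w n)%:E) = limn_einf (fun n => (total_mass w n)%:E))%E] `&` [set w : field R | limn_einf (fun n => (total_mass w n)%:E) \is a fin_num]).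
  apply: measurableI.
    rewrite -[X in measurable X]setTI; exact: measurable_eqe.
  rewrite -[X in measurable X]setTI.
  apply: (minf measurableT [set x : \bar R | x \is a fin_num]).
  rewrite -(setTI [set` _]); exact: emeasurable_fin_num.
apply/seteqP; split=> w /=.
- move=> cw; have ce : (total_mass w n)%:E @[n --> \oo] --> (limn (total_mass w))%:E.
    by apply: cvg_EFin => //; exact: nearW.
  by rewrite !(cvg_limn_einf_sup ce).
- move=> [es ef]; apply/cvg_ex; exists (fine (limn_einf (fun n => (total_mass w n)%:E))).
  have ce : (total_mass w n)%:E @[n --> \oo] --> limn_einf (fun n => (total_mass w n)%:E).
    apply: (@squeeze_cvge _ _ _ _ (einfs (fun n => (total_mass w n)%:E)) _ (esups (fun n => (total_mass w n)%:E))).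
    + apply: nearW => n; apply/andP; split; [apply: ereal_inf_lbound|apply: ereal_sup_ubound];
        by exists n => /=.
    + by rewrite limn_einf_lim; exact: is_cvg_einfs.
    + by rewrite -es limn_esup_lim; exact: is_cvg_esups.
  by move: ce; rewrite -{1}(fineK ef) => /fine_cvg.
Qed.

Lemma ae_regular d (T : measurableType d) rho (m : probability T R) U :
  iid_field m rho U -> {ae m, forall t, cvgn (total_mass (U ^~ t))} ->
  {ae m, forall t, regular (U ^~ t)}.
Proof.
by move=> iidU cU; exact: (ae_subtree iidU measurable_cvg_total_mass cU).
Qed.

Lemma regular_subtree w u : regular w -> regular (subtree w u).
Proof. by move=> rw v; rewrite subtree_cat. Qed.

Lemma limit_massS w : regular w ->
  limit_mass w = (w [:: false] * limit_mass (subtree w [:: false]) +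
                  w [:: true] * limit_mass (subtree w [:: true])) / 2.
Proof.
move=> rw.
have h b : total_mass (subtree w [:: b]) n @[n --> \oo] --> limit_mass (subtree w [:: b]).
  by apply: limit_mass_cvg; exact: rw.
have hw : total_mass w n.+1 @[n --> \oo] --> limit_mass w.
  by rewrite (cvg_shiftS (total_mass w)); apply: limit_mass_cvg; exact: (rw [::]).
apply: (cvg_unique _ hw) => //=.
rewrite (_ : (fun n => _) = (fun n => (w [:: false] * total_mass (subtree w [:: false]) n +
  w [:: true] * total_mass (subtree w [:: true]) n) / 2)).
  by apply: cvgMr_tmp; apply: cvgD; apply: cvgMl_tmp; exact: h.
by apply/funext => n; rewrite total_massS.
Qed.

Lemma limit_mass_ge0 w : (forall v, 0 <= w v) -> 0 <= limit_mass w.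
Proof.
move=> w0; rewrite /limit_mass fine_ge0// limn_einf_lim.
apply: lime_ge; first exact: is_cvg_einfs.
apply: nearW => n; apply: le_ereal_inf_tmp => _ [k _ <-].
by rewrite lee_fin; apply: sumr_ge0 => v _; exact: mass_ge0.
Qed.

Lemma mass_limit_le w v : (forall u, 0 <= w u) -> regular w ->
  mass w v * limit_mass (subtree w v) <= limit_mass w.
Proof.
elim: v w => [|b v IH] w w0 rw; first by rewrite mass_nil mul1r.
have sw0 u z : 0 <= subtree w u z by exact: w0.
rewrite mass_cons -(subtree_cat w [:: b] v).
apply: (@le_trans _ _ (w [:: b] / 2 * limit_mass (subtree w [:: b]))).
  by rewrite -mulrA ler_wpM2l ?divr_ge0//; apply: IH => //; exact: regular_subtree.
have h c : 0 <= w [:: c] * limit_mass (subtree w [:: c]).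
  by rewrite mulr_ge0//; exact: limit_mass_ge0.
rewrite (limit_massS rw); move: (h false) (h true); case: b; lra.
Qed.

End Regular.

(** * Scores of words and their branching recursion *)

Section Score.
Variables (R : realType) (sg : R).
Implicit Type w : seq bool -> R.

Definition score w v : R :=
  pow2 (sg * (size v)%:R) * (mass w v * limit_mass (subtree w v)).

Definition unbounded_score w := forall k : nat, exists v, k%:R < score w v.

Lemma score_cons w b v :
  score w (b :: v) = pow2 sg / 2 * w [:: b] * score (subtree w [:: b]) v.
Proof.
rewrite /score mass_cons subtree_cat /= mulrSr mulrDr mulr1 pow2D; ring.
Qed.

(** The root adds a single finite score and a branch of zero weight only scores 0; the other scores
    are those of the branches up to a positive factor. *)
Lemma unbounded_score_branch w : (forall u, 0 <= w u) ->
  unbounded_score w <->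
  exists b, 0 < w [:: b] /\ unbounded_score (subtree w [:: b]).
Proof.
move=> w0; split=> [uw|[b [wb uw]] k].
  apply: contrapT => nu.
  have hM b : exists M, forall v, score w (b :: v) <= M.
    have [wb|] := ltP 0 (w [:: b]).
      have : ~ unbounded_score (subtree w [:: b]) by move=> h; apply: nu; exists b.
      move=> /existsNP[k nk]; exists (pow2 sg / 2 * w [:: b] * k%:R) => v.
      rewrite score_cons ler_wpM2l ?mulr_ge0 ?pow2_ge0//.
      by rewrite leNgt; apply/negP => h; apply: nk; exists v.
    move=> wb; exists 0 => v.
    have -> : score w (b :: v) = 0; last by [].
    by rewrite score_cons (_ : w [:: b] = 0) ?mulr0 ?mul0r//; apply/le_anti; rewrite wb w0.
  have [Mf hf] := hM false; have [Mt ht] := hM true.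
  pose M := `|score w [::]| + `|Mf| + `|Mt|.
  have [v] := uw (Num.truncn M).+1.
  rewrite ltNge => /negP; apply.
  have MM : M <= (Num.truncn M).+1%:R by apply: ltW; exact: truncnS_gt.
  apply: le_trans MM; rewrite /M.
  have n1 := normr_ge0 (score w [::]); have n2 := normr_ge0 Mf; have n3 := normr_ge0 Mt.
  have l1 := ler_norm (score w [::]); have l2 := ler_norm Mf; have l3 := ler_norm Mt.
  by case: v => [|[] v]; [|have := ht v|have := hf v]; lra.
have cw : 0 < pow2 sg / 2 * w [:: b] by rewrite !mulr_gt0 ?pow2_gt0.
have [v hv] := uw (Num.truncn (k%:R / (pow2 sg / 2 * w [:: b]))).+1.
exists (b :: v); rewrite score_cons.
rewrite -ltr_pdivrMl//; apply: lt_trans hv.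
by rewrite mulrC; exact: truncnS_gt.
Qed.

Lemma measurable_score v : measurable_fun [set: field R] (fun w => score w v).
Proof.
apply: measurable_funM => //; apply: measurable_funM; first exact: measurable_mass.
exact: (measurableT_comp (@measurable_limit_mass R) (measurable_subtree v)).
Qed.

Lemma measurable_unbounded_score : measurable [set w : field R | unbounded_score w].
Proof.
rewrite (_ : [set w : field R | _] = \bigcap_k \bigcup_n
  [set w : field R | k%:R < score w (word_of_nat n)]).
  apply: bigcapT_measurable => k; apply: bigcupT_measurable => n.
  rewrite -[X in measurable X]setTI.
  apply: (measurable_score _ measurableT (Y := [set x | k%:R < x])).
  by rewrite -set_itvoy; exact: measurable_itv.
apply/seteqP; split=> w /= h k.
  by move=> _; have [v hv] := h k; have [n nv] := word_of_nat_surj v; exists n => //; rewrite /mkset nv.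
by have [n _ hn] := h k I; exists (word_of_nat n).
Qed.

End Score.

(** * Unbounded scores *)

Section TailRecursion.
Context d (T : measurableType d) (R : realType).
Variables (m : {measure set T -> \bar R}) (E : set T) (X : T -> R).
Variables (f g : R -> R) (lam eta K F u0 : R).
Hypotheses (mE : measurable E) (mX : measurable_fun setT X).
Hypotheses (mf : measurable_fun setT f) (mg : measurable_fun setT g).
Hypotheses (lam0 : 0 < lam) (eta0 : 0 < eta).
Hypotheses (f0 : forall s, 0 <= f s) (fF : forall s, f s <= F) (f00 : 0 < f 0).
Hypothesis fK : forall s, K < `|s| -> f s = 0.
Hypothesis super : forall s, f s != 0 ->
  (((1 + eta) * f s)%:E <= lam%:E * \int[m]_(t in E) (f (s - X t))%:E)%E.
Hypotheses (g0 : forall u, 0 < g u) (gdec : {homo g : u v / u <= v >-> v <= u}).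
Hypothesis gsuper : forall u, u0 <= u ->
  (lam%:E * \int[m]_(t in E) (g (u - X t))%:E <= (g u)%:E)%E.

Let mshift (h : R -> R) (u : R) : measurable_fun setT h ->
  measurable_fun E (fun t => (h (u - X t))%:E).
Proof.
move=> mh; apply/measurable_EFinP; apply: measurable_funTS.
by apply: measurableT_comp => //; exact: measurable_funB.
Qed.

(* If [g >= r f(. - t0)], the two recursions improve [r] to [r (1 + eta)]. *)
Lemma no_positive_tail : False.
Proof.
have F0 : 0 < F by exact: lt_le_trans f00 (fF 0).
have K0 : 0 <= K by rewrite leNgt; apply/negP => h; move: f00; rewrite fK ?ltxx// normr0.
(* The support of [f (. - t0)] lies in [[u0, t0 + K]], where the recursion for [g] holds and where
   monotonicity gives [g >= g (t0 + K)]; this value divided by [F] is a first admissible [r]. *)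
set t0 := u0 + K; set r := g (t0 + K) / F.
have r0 : 0 < r by rewrite divr_gt0.
have step n u : r * (1 + eta) ^+ n * f (u - t0) <= g u.
  elim: n u => [|n IH] u.
    rewrite expr0 mulr1; have [uK|uK] := leP `|u - t0| K.
      rewrite /r; apply: (@le_trans _ _ (g (t0 + K))).
        by rewrite -mulrA ler_piMr ?(ltW (g0 _))// mulrC ler_pdivrMr// mul1r.
      by apply: gdec; move: uK; rewrite ler_norml => /andP[_]; lra.
    by rewrite fK// mulr0 ltW.
  have [->|fu] := eqVneq (f (u - t0)) 0; first by rewrite mulr0 ltW.
  have uu0 : u0 <= u.
    have : ~ K < `|u - t0| by move=> h; move: fu; rewrite fK// eqxx.
    by move/negP; rewrite -leNgt ler_norml /t0 => /andP[]; lra.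
  rewrite -lee_fin; apply: le_trans (gsuper uu0).
  have rn : 0 <= r * (1 + eta) ^+ n by rewrite mulr_ge0 ?exprn_ge0 ?addr_ge0 ?ltW.
  apply: (@le_trans _ _ ((r * (1 + eta) ^+ n)%:E * (lam%:E * \int[m]_(t in E) (f (u - t0 - X t))%:E))%E).
    rewrite exprSr [X in X%:E](_ : _ = (r * (1 + eta) ^+ n) * ((1 + eta) * f (u - t0))); last by ring.
    by rewrite EFinM; apply: lee_wpmul2l; [rewrite lee_fin|exact: super].
  rewrite muleCA; apply: lee_wpmul2l; first by rewrite lee_fin ltW.
  rewrite -ge0_integralZl_EFin//; last 2 first.
  - by move=> t _; rewrite lee_fin.
  - exact: mshift.
  apply: ge0_le_integral => //.
  - by move=> t _; rewrite -EFinM lee_fin mulr_ge0.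
  - apply: measurable_funeM; exact: mshift.
  - exact: mshift.
  - move=> t _; rewrite -EFinM lee_fin.
    by have := IH (u - X t); rewrite (_ : u - X t - t0 = u - t0 - X t)//; ring.
have bern n : 1 + n%:R * eta <= (1 + eta) ^+ n.
  elim: n => [|n IH]; first by rewrite mul0r addr0.
  rewrite exprS mulrS; apply: (@le_trans _ _ ((1 + eta) * (1 + n%:R * eta))).
    have : 0 <= n%:R * eta * eta by have e0 := ltW eta0; rewrite !mulr_ge0.
    by lra.
  by rewrite ler_wpM2l// addr_ge0 ?ltW.
pose N := (Num.truncn (g t0 / (r * f 0 * eta))).+1.
have := step N t0; rewrite subrr leNgt => /negP; apply.
have rfe : 0 < r * f 0 * eta by rewrite mulr_gt0// mulr_gt0.
have : g t0 / (r * f 0 * eta) < N%:R by exact: truncnS_gt.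
rewrite ltr_pdivrMr// => h; apply: lt_le_trans h _.
rewrite [leRHS](_ : _ = (r * f 0) * (1 + eta) ^+ N); last by ring.
rewrite [leLHS](_ : _ = (r * f 0) * (N%:R * eta)); last by ring.
rewrite ler_pM2l; last by rewrite mulr_gt0.
by apply: le_trans (bern N); rewrite lerDr.
Qed.

End TailRecursion.

Lemma ae_measure_eq d (T : measurableType d) (R : realType)
    (m : {measure set T -> \bar R}) (A B : set T) :
  measurable A -> measurable B -> {ae m, forall t, A t <-> B t} -> m A = m B.
Proof.
move=> mA mB AB; rewrite -[A]setIT -[B]setIT -!integral_indic//.
apply: ae_eq_integral => //.
- by apply/measurable_EFinP; exact: measurable_indic.
- by apply/measurable_EFinP; exact: measurable_indic.
- apply: filterS AB => t AB _; rewrite !indicE; congr (_%:R%:E).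
  by congr nat_of_bool; apply/idP/idP; rewrite !inE => /AB.
Qed.

(** Expanded and divided by its nonzero solution, the equation becomes linear: [a^2 x = 2 a - 1].
    This excludes [a = 0] and determines [x]. *)
Lemma fixed_point_unique (R : realType) (a p q : R) : 0 < p -> 0 < q ->
  1 - p = (1 - a * p) ^+ 2 -> 1 - q = (1 - a * q) ^+ 2 -> p = q.
Proof.
move=> p0 q0 ep eq_.
have key (x : R) : 0 < x -> 1 - x = (1 - a * x) ^+ 2 -> a ^+ 2 * x = 2 * a - 1.
  move=> x0 ex; apply: (mulfI (lt0r_neq0 x0)).
  by apply/eqP; rewrite -subr_eq0; apply/eqP; move: ex; nra.
have a0 : a != 0.
  by apply/eqP => a0; move: (key p p0 ep); rewrite a0; lra.
by apply: (mulfI (expf_neq0 2 a0)); rewrite (key p)// (key q).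
Qed.

Section FixedPoint.
Context d (T : measurableType d) (R : realType) (rho : set R -> \bar R).
Variables (m : probability T R) (U : seq bool -> T -> R).
Hypothesis iidU : iid_field m rho U.
Hypothesis U0 : forall v t, 0 <= U v t.
Hypothesis cvgU : {ae m, forall t, cvgn (total_mass (U ^~ t))}.
Implicit Type A : set (field R).

Definition field_prob A : R := fine (m [set t | A (U ^~ t)]).

Lemma field_probE A : measurable A -> (field_prob A)%:E = m [set t | A (U ^~ t)].
Proof.
by move=> mA; rewrite fineK//; apply: fin_num_measure; exact: (measurable_field_set iidU).
Qed.

(** Survival of one edge of the tree, not of the tree itself. *)
Definition survival : R := fine (m [set t | 0 < U [:: true] t]).

Lemma measurable_survival : measurable [set t | 0 < U [:: true] t].
Proof.
rewrite -[X in measurable X]setTI.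
apply: (iidU.1 _ measurableT [set x | 0 < x]).
by rewrite -set_itvoy; exact: measurable_itv.
Qed.

(* Survival and unboundedness of the score both have this form, and the fixed
   point equation has at most one positive solution. *)
Lemma branching_fixed_point A : measurable A ->
  (forall w, (forall v, 0 <= w v) -> regular w ->
    A w <-> exists b, 0 < w [:: b] /\ A (subtree w [:: b])) ->
  1 - field_prob A = (1 - survival * field_prob A) ^+ 2.
Proof.
move=> mA Arec.
pose E := [set z : R * field R | 0 < z.1 /\ A z.2].
have mE : measurable E.
  rewrite (_ : E = [set x | 0 < x] `*` A); last by apply/seteqP; split.
  by apply: measurableX => //; rewrite -set_itvoy; exact: measurable_itv.
have bE : branch_prob m U E = (survival * field_prob A)%:E.
  rewrite EFinM field_probE// fineK; last exact/fin_num_measure/measurable_survival.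
  rewrite /branch_prob muleC -[X in (_ * m X)%E]setIT -integral_indic//; last exact: measurable_survival.
  rewrite -ge0_integralZl//; last first.
    by apply/measurable_EFinP; apply: measurable_indic; exact: measurable_survival.
  apply: eq_integral => t _; rewrite /section_prob /E /= indicE.
  have [Ut|Ut] := boolP (0 < U [:: true] t).
    rewrite mem_set// mule1; congr (m _); apply/seteqP; split=> t' /=; [by case|by split].
  rewrite memNset; last exact/negP.
  rewrite mule0 [X in m X](_ : _ = set0) ?measure0//.
  by apply/seteqP; split=> t' //= [].
apply/EFin_inj; rewrite expr2 EFinM !EFinB -bE -(prob_no_branch iidU mE) field_probE//.
have mAU := measurable_field_set iidU mA.
rewrite -probability_setC//; apply: ae_measure_eq.
- exact: measurableC.
- by apply: measurableI; apply: measurableC; exact: (measurable_branch_event iidU).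
- apply: filterS (ae_regular iidU cvgU) => t rt.
  have := Arec (U ^~ t) (U0 ^~ t) rt; rewrite /branch_event /E /=.
  move=> h; split=> [nA|[nf nt] /h[[]]].
  + by split=> -[Ub Ab]; apply: nA; apply/h; [exists false|exists true].
  + by move=> [Ub Ab]; apply: nt.
  + by move=> [Ub Ab]; apply: nf.
Qed.

End FixedPoint.

Section Supercritical.
Context d (T : measurableType d) (R : realType) (m : {measure set T -> \bar R}).

(* A witness that the log-tail [g] of the largest score cannot tend to [0]: once
   small, [g] satisfies [lam * E (g (u - ln Z)) <= g u] for every [lam < 2]. *)
Definition supersolution (Z : T -> R) := exists (E : set T) (X : T -> R) (f : R -> R)
    (lam eta K F : R),
  [/\ measurable E, measurable_fun setT X,
      (forall t, E t -> 0 < Z t /\ X t <= ln (Z t)), 0 < lam < 2 & 0 < eta] /\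
  [/\ measurable_fun setT f, (forall s, 0 <= f s <= F), 0 < f 0,
      (forall s, K < `|s| -> f s = 0) &
      (forall s, f s != 0 ->
        (((1 + eta) * f s)%:E <= lam%:E * \int[m]_(t in E) (f (s - X t))%:E)%E)].

End Supercritical.

(** * The tail of the largest score *)

Section Tail.
Context d (T : measurableType d) (R : realType) (rho : set R -> \bar R).
Variables (m : probability T R) (U : seq bool -> T -> R) (sg delta : R).
Hypothesis iidU : iid_field m rho U.
Hypothesis U0 : forall v t, 0 <= U v t.
Hypothesis cvgU : {ae m, forall t, cvgn (total_mass (U ^~ t))}.
Let Z t := pow2 sg / 2 * U [:: true] t.
Hypothesis delta0 : 0 < delta.
Hypothesis Zdelta : (0 < m [set t | (expR delta <= Z t)%R])%E.
Hypothesis test : supersolution m Z.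

Let mZ : measurable_fun setT Z.
Proof. by apply: measurable_funM => //; exact: iidU.1. Qed.

Definition exceeds x : set (field R) := [set w | exists v, x < score sg w v].

Definition branch_exceeds x : set (R * field R) :=
  [set z | exists v, x < pow2 sg / 2 * z.1 * score sg z.2 v].

Lemma measurable_exceeds x : measurable (exceeds x).
Proof.
rewrite (_ : exceeds x = \bigcup_n [set w : field R | x < score sg w (word_of_nat n)]).
  apply: bigcupT_measurable => n; rewrite -[X in measurable X]setTI.
  apply: (measurable_score _ _ measurableT (Y := [set y | x < y])).
  by rewrite -set_itvoy; exact: measurable_itv.
apply/seteqP; split=> w /=; first by move=> [v hv]; have [n nv] := word_of_nat_surj v; exists n => //; rewrite /mkset nv.
by move=> [n _ hn]; exists (word_of_nat n).
Qed.

Lemma measurable_branch_exceeds x : measurable (branch_exceeds x).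
Proof.
rewrite (_ : branch_exceeds x = \bigcup_n [set z : R * field R | x < pow2 sg / 2 * z.1 * score sg z.2 (word_of_nat n)]).
  apply: bigcupT_measurable => n; rewrite -[X in measurable X]setTI.
  have mf : measurable_fun [set: R * field R] (fun z => pow2 sg / 2 * z.1 * score sg z.2 (word_of_nat n)).
    apply: measurable_funM; first exact: measurable_funM.
    by apply: (measurableT_comp (measurable_score sg (word_of_nat n))); exact: measurable_snd.
  apply: (mf measurableT [set y | x < y]).
  by rewrite -set_itvoy; exact: measurable_itv.
apply/seteqP; split=> w /=; first by move=> [v hv]; have [n nv] := word_of_nat_surj v; exists n => //; rewrite /mkset nv.
by move=> [n _ hn]; exists (word_of_nat n).
Qed.

Let g u : R := field_prob m U (exceeds (expR u)).

Let gE u : (g u)%:E = m [set t | exceeds (expR u) (U ^~ t)].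
Proof. by rewrite (field_probE iidU)//; exact: measurable_exceeds. Qed.

Let gdec : {homo g : u v / u <= v >-> v <= u}.
Proof.
move=> u v uv; rewrite -lee_fin !gE; apply: le_measure.
- by rewrite inE; exact: (measurable_field_set iidU (@measurable_exceeds _)).
- by rewrite inE; exact: (measurable_field_set iidU (@measurable_exceeds _)).
- by move=> t [w h]; exists w; apply: le_lt_trans h; rewrite ler_expR.
Qed.

Let mg : measurable_fun setT g.
Proof. exact: nonincreasing_measurable. Qed.

Let beta u := branch_prob m U (branch_exceeds (expR u)).

Let branch_exceedsP u w : exceeds u w <->
  u < score sg w [::] \/ exists b, branch_exceeds u (w [:: b], subtree w [:: b]).
Proof.
split=> [[[|b v] h]|[h|[b [v h]]]].
- by left.
- by right; exists b, v; rewrite -score_cons.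
- by exists [::].
- by exists (b :: v); rewrite score_cons.
Qed.

(** Dropping the score of the root leaves two independent branches, either of which suffices. *)
Let g_lower u : (1 - (1 - beta u) * (1 - beta u) <= (g u)%:E)%E.
Proof.
have mE := @measurable_branch_exceeds (expR u).
have mb b := measurable_branch_event iidU b mE.
rewrite -(prob_no_branch iidU mE) -probability_setC; last first.
  by apply: measurableI; exact: measurableC.
rewrite gE; apply: le_measure.
- by rewrite inE; apply: measurableC; apply: measurableI; exact: measurableC.
- by rewrite inE; exact: (measurable_field_set iidU (@measurable_exceeds _)).
- move=> t; rewrite setCI !setCK => -[h|h]; apply/branch_exceedsP; right.
    by exists false.
  by exists true.
Qed.

Let section_prob_exceeds u y : 0 < pow2 sg / 2 * y ->
  section_prob m U (branch_exceeds (expR u)) y = (g (u - ln (pow2 sg / 2 * y)))%:E.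
Proof.
move=> y0; rewrite gE /section_prob; congr (m _); apply/seteqP.
by split=> t [v h]; exists v; move: h; rewrite expRD expRN lnK// ltr_pdivrMr// mulrC.
Qed.

(** [X] may lie below [ln (Z t)] because [g] is nonincreasing. This freedom is what permits
    truncating and translating the log-weight. *)
Let beta_lower u (E : set T) (X : T -> R) : measurable E -> measurable_fun setT X ->
  (forall t, E t -> 0 < Z t /\ X t <= ln (Z t)) ->
  (\int[m]_(t in E) (g (u - X t))%:E <= beta u)%E.
Proof.
move=> mE mX hE; rewrite /beta /branch_prob.
have mS : measurable_fun setT (fun t => section_prob m U (branch_exceeds (expR u)) (U [:: true] t)).
  apply: (measurableT_comp (measurable_section_prob iidU (@measurable_branch_exceeds _))).
  exact: iidU.1.
apply: (@le_trans _ _ (\int[m]_(t in E) section_prob m U (branch_exceeds (expR u)) (U [:: true] t))%E).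
  apply: ge0_le_integral => //.
  - by move=> t _; rewrite lee_fin fine_ge0.
  - apply/measurable_EFinP; apply: measurable_funTS; apply: measurableT_comp => //.
    exact: measurable_funB.
  - exact: measurable_funTS.
  - move=> t /hE[Zt Xt]; rewrite section_prob_exceeds// lee_fin; apply: gdec.
    by rewrite lerD2l lerN2.
by apply: ge0_subset_integral => // t _; exact: section_prob_ge0.
Qed.

Let b u := fine (beta u).

Let betaE u : (b u)%:E = beta u.
Proof.
have mE := @measurable_branch_exceeds (expR u).
rewrite fineK// /beta -(prob_branch_event iidU false mE).
by apply: fin_num_measure; exact: (measurable_branch_event iidU).
Qed.

Let b_itv u : 0 <= b u <= 1.
Proof.
have mE := @measurable_branch_exceeds (expR u).
rewrite -!lee_fin betaE /beta -(prob_branch_event iidU false mE) measure_ge0 /=.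
exact: (probability_le1 m (measurable_branch_event iidU false mE)).
Qed.

Let g_lower_real u : 2 * b u - b u ^+ 2 <= g u.
Proof.
have := g_lower u; rewrite -(betaE u); move: (b u) (g u) => x y.
rewrite -(EFinB 1 x) -EFinM -EFinB lee_fin; apply: le_trans.
by rewrite (_ : 2 * x - x ^+ 2 = 1 - (1 - x) * (1 - x))//; ring.
Qed.

Let b_le_g u : b u <= g u.
Proof.
apply: le_trans (g_lower_real u); have := b_itv u; move: (b u) => x /andP[x0 x1].
have : 0 <= x * (1 - x) by rewrite mulr_ge0// subr_ge0.
by rewrite mulrBr mulr1 -expr2; lra.
Qed.

Let score_nil w : score sg w [::] = limit_mass w.
Proof. by rewrite /score mulr0 pow2_0 mass_nil !mul1r. Qed.

Definition alive : set (field R) := [set w | 0 < limit_mass w].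

Let measurable_alive : measurable alive.
Proof.
rewrite -[X in measurable X]setTI.
apply: (measurable_limit_mass measurableT (Y := [set y | 0 < y])).
by rewrite -set_itvoy; exact: measurable_itv.
Qed.

(** A positive limit mass is itself the score of the root, so some level is exceeded with positive
    probability; the event [Z >= expR delta] raises that level by [delta] in each generation. *)
Let g_pos : 0 < field_prob m U alive -> forall u, 0 < g u.
Proof.
move=> alive0.
have [u0 gu0] : exists u, 0 < g u.
  apply: contrapT => /forallNP ng.
  have : m [set t | alive (U ^~ t)] = 0%E.
    apply/(measure_negligible (measurable_field_set iidU measurable_alive)).
    have sub : [set t | alive (U ^~ t)] `<=` \bigcup_n [set t | exceeds (expR (- n%:R)) (U ^~ t)].
      move=> t /= Yt; exists (Num.truncn (- ln (limit_mass (U ^~ t)))).+1 => //.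
      exists [::]; rewrite score_nil -[ltRHS]lnK// ltr_expR ltrNl.
      exact: truncnS_gt.
    apply: (negligibleS sub).
    apply: negligible_bigcup => k.
    exists [set t | exceeds (expR (- k%:R)) (U ^~ t)]; split=> //.
      exact: (measurable_field_set iidU (@measurable_exceeds _)).
    apply: etrans (esym (gE _)) _; congr (_%:E); apply/le_anti; rewrite -[0 <= _]lee_fin gE measure_ge0 andbT.
    by rewrite leNgt; apply/negP/ng.
  by move=> h; move: alive0; rewrite -lte_fin (field_probE iidU)// h ltxx.
have step u : 0 < g u -> 0 < g (u + delta).
  move=> gu; apply: lt_le_trans (b_le_g _).
  have mE : measurable [set t | expR delta <= Z t].
    rewrite -[X in measurable X]setTI; apply: (mZ measurableT (Y := [set y | expR delta <= y])).
    by rewrite -set_itvcy; exact: measurable_itv.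
  rewrite -lte_fin betaE.
  apply: lt_le_trans (beta_lower (u + delta) mE (measurable_cst delta) _); last first.
    move=> t /= h; have Zt : 0 < Z t by exact: lt_le_trans (expR_gt0 _) h.
    by split=> //; rewrite -[leLHS]expRK ler_ln ?posrE ?expR_gt0.
  under eq_integral do rewrite addrK.
  by rewrite integral_cst// mule_gt0.
have steps k : 0 < g (u0 + k%:R * delta).
  elim: k => [|k IH]; first by rewrite mul0r addr0.
  by rewrite mulrSr mulrDl mul1r addrA; exact: step.
move=> u; apply: lt_le_trans (steps (Num.truncn ((u - u0) / delta)).+1) _.
apply: gdec; rewrite -lerBlDl -ler_pdivrMr//; apply: ltW; exact: truncnS_gt.
Qed.

(** Continuity from above: the events of exceeding [k] decrease to unboundedness, which is null
    here. *)
Let g_small : field_prob m U [set w | unbounded_score sg w] = 0 ->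
  forall e, 0 < e -> exists u0, forall u, u0 <= u -> g u <= e.
Proof.
move=> p0 e e0.
pose F k := [set t | exceeds k%:R (U ^~ t)].
have mF k : measurable (F k) by exact: (measurable_field_set iidU (@measurable_exceeds _)).
have Fcap : \bigcap_k F k = [set t | unbounded_score sg (U ^~ t)].
  by apply/seteqP; split=> t h k; [exact: h|move=> _; exact: h].
have mS := measurable_field_set iidU (@measurable_unbounded_score R sg).
have : (m \o F) x @[x --> \oo] --> m (\bigcap_k F k).
  apply: nonincreasing_cvg_mu => //.
  - by apply: (@le_lt_trans _ _ 1%E); [exact: probability_le1|exact: ltry].
  - by rewrite Fcap.
  - move=> i j ij; apply/subsetPset => t [v h]; exists v; apply: le_lt_trans h.
    by rewrite ler_nat.
rewrite Fcap -(field_probE iidU) ?p0; last exact: measurable_unbounded_score.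
move=> /fine_cvgP[_ /cvgrPdist_lt/(_ e e0)[N _ /(_ N (leqnn N)) /= hN]].
exists (ln N.+1%:R) => u uN; rewrite -lee_fin gE.
apply: (@le_trans _ _ (m (F N))).
  apply: le_measure.
  - by rewrite inE; exact: (measurable_field_set iidU (@measurable_exceeds _)).
  - by rewrite inE.
  - move=> t [v h]; exists v; apply: le_lt_trans h.
    by apply: (@le_trans _ _ N.+1%:R); [rewrite ler_nat|rewrite -[leLHS]lnK ?posrE// ler_expR].
rewrite -(fineK (fin_num_measure m _ (mF N))) lee_fin ltW//.
by apply: le_lt_trans hN; rewrite sub0r normrN ler_norm.
Qed.

(** If unboundedness had probability 0, [g] would fall below [2 - lam]. Then [2 b - b^2 >= lam b],
    and the quadratic recursion implies the linear one excluded by [no_positive_tail]. *)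
Let unbounded_pos : 0 < field_prob m U alive ->
  0 < field_prob m U [set w | unbounded_score sg w].
Proof.
move=> alive0; rewrite lt_neqAle fine_ge0// andbT eq_sym; apply/eqP => p0.
have [E [X [f [lam [eta [K [F [[mE mX hE /andP[lam0 lam2] eta0]]]]]]]]] := test.
move=> [mf fF f00 fK super].
have e0 : 0 < 2 - lam by rewrite subr_gt0.
have [u0 hu0] := g_small p0 e0.
apply: (@no_positive_tail _ _ _ m E X f g lam eta K F u0) => //.
- by move=> s; have /andP[] := fF s.
- by move=> s; have /andP[] := fF s.
- exact: g_pos.
- move=> u /hu0 gu.
  apply: (@le_trans _ _ (lam%:E * (b u)%:E)%E).
    by apply: lee_wpmul2l; [rewrite lee_fin ltW|rewrite betaE; exact: beta_lower].
  rewrite -EFinM lee_fin; apply: le_trans (g_lower_real u).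
  have := b_itv u; have := b_le_g u; move: gu; move: (g u) (b u) => x y xl yx /andP[y0 _].
  have : 0 <= (2 - lam - y) * y by rewrite mulr_ge0//; lra.
  by rewrite mulrBl mulrBl -expr2; lra.
Qed.

(** Survival and unboundedness solve the same fixed-point equation with positive probabilities, so
    the probabilities agree. A regular field of zero limit mass has only zero scores, so
    unboundedness is almost surely contained in survival and the difference is null. *)
Theorem ae_unbounded_score :
  {ae m, forall t, 0 < limit_mass (U ^~ t) -> unbounded_score sg (U ^~ t)}.
Proof.
have mA := measurable_field_set iidU measurable_alive.
have mI := measurable_field_set iidU (@measurable_unbounded_score R sg).
have reg := ae_regular iidU cvgU.
have [alive0|alive0] := ltP 0 (field_prob m U alive); last first.
  exists [set t | alive (U ^~ t)]; split=> //; last first.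
    by move=> t h; apply: contrapT => nt; apply: h => /nt.
  apply/le_anti; rewrite measure_ge0 andbT -(field_probE iidU)//.
have eqp : field_prob m U [set w | unbounded_score sg w] = field_prob m U alive.
  apply: (@fixed_point_unique _ (survival m U)) => //.
  - exact: unbounded_pos.
  - apply: (branching_fixed_point iidU U0 cvgU) => //; first exact: measurable_unbounded_score.
    by move=> w w0 _; exact: unbounded_score_branch.
  - apply: (branching_fixed_point iidU U0 cvgU) => // w w0 rw.
    rewrite /alive /= (limit_massS rw).
    have h c : 0 <= limit_mass (subtree w [:: c]) by apply: limit_mass_ge0 => v; exact: w0.
    have wh c : 0 <= w [:: c] * limit_mass (subtree w [:: c]) by rewrite mulr_ge0.
    split=> [Y|[c [wc Yc]]].
      apply: contrapT => /forallNP nb.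
      have z c : w [:: c] * limit_mass (subtree w [:: c]) = 0.
        apply/le_anti; rewrite wh andbT leNgt; apply/negP => p.
        have wc : 0 < w [:: c] by rewrite lt_neqAle w0 andbT; apply/eqP => w0'; move: p; rewrite -w0' mul0r ltxx.
        by apply: (nb c); split=> //; rewrite -(pmulr_rgt0 _ wc).
      by move: Y; rewrite !z addr0 mul0r ltxx.
    have : 0 < w [:: c] * limit_mass (subtree w [:: c]) by rewrite mulr_gt0.
    by move: (wh false) (wh true); case: c wc Yc => _ _; lra.
have IA : {ae m, forall t, (alive (U ^~ t) /\ unbounded_score sg (U ^~ t)) <-> unbounded_score sg (U ^~ t)}.
  apply: filterS reg => t rt; split=> [[]//|un]; split=> //.
  rewrite /alive /= lt_neqAle limit_mass_ge0// andbT; apply/eqP => Y0.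
  have [v] := un 0%N; rewrite /score ltNge => /negP; apply.
  rewrite mulr_ge0_le0 ?pow2_ge0//.
  by rewrite Y0; exact: mass_limit_le.
have mAI : measurable ([set t | alive (U ^~ t)] `&` [set t | unbounded_score sg (U ^~ t)]) by exact: measurableI.
have e1 := ae_measure_eq mAI mI IA.
exists ([set t | alive (U ^~ t)] `\` [set t | unbounded_score sg (U ^~ t)]); split.
- exact: measurableD.
- rewrite measureD//; last by apply: (@le_lt_trans _ _ 1%E); [exact: probability_le1|exact: ltry].
  have eA := esym (field_probE iidU measurable_alive).
  have eI := etrans e1 (esym (field_probE iidU (@measurable_unbounded_score R sg))).
  by apply: etrans (congr2 (fun x y => (x - y)%E) eA eI) _; rewrite eqp -EFinB subrr.
- by move=> t /= /not_implyP[].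
Qed.

End Tail.

(** * A test function for the tail recursion *)

Section CosineTest.
Context d (T : measurableType d) (R : realType) (m : probability T R).

Lemma bounded_integrable (E : set T) (h : T -> R) (C : R) : measurable E ->
  measurable_fun setT h -> (forall t, E t -> `|h t| <= C) ->
  m.-integrable E (EFin \o h).
Proof.
move=> mE mh hC; apply: measurable_bounded_integrable => //.
- by apply: (@le_lt_trans _ _ 1%E); [exact: probability_le1|exact: ltry].
- exact: measurable_funTS.
- exists C; split; first exact: num_real.
  by move=> M CM t Et; apply: le_trans (hC t Et) (ltW CM).
Qed.

Lemma Rintegral_fin (E : set T) (h : T -> R) (C : R) : measurable E ->
  measurable_fun setT h -> (forall t, E t -> `|h t| <= C) ->
  (\int[m]_(t in E) (h t)%:E)%E = (\int[m]_(t in E) h t)%:E.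
Proof.
move=> mE mh hC; rewrite /Rintegral fineK//.
by apply: integrable_fin_num => //; exact: bounded_integrable hC.
Qed.

Lemma cos_le0 (x : R) : pi / 2 <= `|x| <= pi / 2 + pi -> cos x <= 0.
Proof.
have -> : cos x = cos `|x| by case: ger0P => // _; rewrite cosN.
move=> /andP[x1 x2].
have -> : cos `|x| = - cos (`|x| - pi) by rewrite -cosDpi subrK.
by rewrite oppr_le0; apply: cos_ge0_pihalf; apply/andP; split; lra.
Qed.

Variables (Z X : T -> R) (E : set T) (q k K : R).
Hypotheses (mE : measurable E) (mX : measurable_fun setT X) (k0 : 0 < k).
Hypothesis XZ : forall t, E t -> 0 < Z t /\ X t <= ln (Z t).
Hypothesis XK : forall t, E t -> `|X t| <= K.
Hypothesis kK : k * K <= pi.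
Hypothesis sin0 : \int[m]_(t in E) (expR (q * X t) * sin (k * X t)) = 0.
Hypothesis cos_gt : 1 / 2 < \int[m]_(t in E) (expR (q * X t) * cos (k * X t)).

Let L := pi / 2 / k.
(* Up to the cut-off, [f] is an eigenfunction of [f -> E (f (s - X))]: the sine
   part of the tilted characteristic function of [X] vanishes. *)
Let f s := expR (- (q * s)) * cos (k * s) * \1_(`]- L, L[%classic) s.

Let f_in s : `|s| < L -> f s = expR (- (q * s)) * cos (k * s).
Proof. by move=> sL; rewrite /f indicE mem_set ?mulr1//= in_itv /= -ltr_norml. Qed.

Let f_out s : L <= `|s| -> f s = 0.
Proof.
move=> sL; rewrite /f indicE memNset ?mulr0//= in_itv /= -ltr_norml.
by apply/negP; rewrite -leNgt.
Qed.

Let kL : k * L = pi / 2.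
Proof. by rewrite /L mulrC divfK// gt_eqF. Qed.

Let cos_pos s : `|s| < L -> 0 < cos (k * s).
Proof.
move=> sL; apply: cos_gt0_pihalf; rewrite -ltr_norml normrM (gtr0_norm k0) -kL.
by rewrite ltr_pM2l.
Qed.

Let mexp (a : R) : measurable_fun setT (fun t => expR (a * X t)).
Proof. by apply: measurableT_comp => //; exact: measurable_funM. Qed.

Let mcos (b : R) : measurable_fun setT (fun t => cos (b * X t)).
Proof.
apply: (measurableT_comp (continuous_measurable_fun (@continuous_cos R))).
exact: measurable_funM.
Qed.

Let msin (b : R) : measurable_fun setT (fun t => sin (b * X t)).
Proof.
apply: (measurableT_comp (continuous_measurable_fun (@continuous_sin R))).
exact: measurable_funM.
Qed.

Let expb (t : T) : E t -> expR (q * X t) <= expR (`|q| * K).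
Proof.
move=> Et; rewrite ler_expR; apply: le_trans (ler_norm _) _.
by rewrite normrM ler_wpM2l// XK.
Qed.

Let cosb t : E t -> `|expR (q * X t) * cos (k * X t)| <= expR (`|q| * K).
Proof.
move=> Et; rewrite normrM ger0_norm ?expR_ge0// -[leRHS]mulr1.
by apply: ler_pM => //; [exact: expb|exact: cos_max].
Qed.

Let sinb t : E t -> `|expR (q * X t) * sin (k * X t)| <= expR (`|q| * K).
Proof.
move=> Et; rewrite normrM ger0_norm ?expR_ge0// -[leRHS]mulr1.
by apply: ler_pM => //; [exact: expb|exact: sin_max].
Qed.

(* Since [k |X| <= pi], the cut-off discards only nonpositive values. *)
Let f_lower s t : E t -> `|s| < L ->
  expR (- (q * s)) * cos (k * s) * (expR (q * X t) * cos (k * X t)) +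
  expR (- (q * s)) * sin (k * s) * (expR (q * X t) * sin (k * X t)) <= f (s - X t).
Proof.
move=> Et sL.
have -> : expR (- (q * s)) * cos (k * s) * (expR (q * X t) * cos (k * X t)) +
  expR (- (q * s)) * sin (k * s) * (expR (q * X t) * sin (k * X t)) =
  expR (- (q * (s - X t))) * cos (k * (s - X t)).
  rewrite (_ : - (q * (s - X t)) = - (q * s) + q * X t); last by ring.
  by rewrite mulrBr expRD cosB; ring.
have [h|h] := ltP `|s - X t| L; first by rewrite f_in.
rewrite f_out// mulr_ge0_le0 ?expR_ge0// cos_le0// normrM (gtr0_norm k0) -kL.
apply/andP; split; first by rewrite ler_pM2l.
apply: (@le_trans _ _ (k * (L + K))); last by rewrite mulrDr lerD2l.
rewrite ler_pM2l//; apply: le_trans (ler_normB _ _) _.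
by rewrite lerD ?XK// ltW.
Qed.

Lemma cosine_supersolution : supersolution m Z.
Proof.
pose C := \int[m]_(t in E) (expR (q * X t) * cos (k * X t)).
have Cgt : 1 / 2 < C := cos_gt.
have C0 : 0 < C by apply: lt_trans Cgt; rewrite divr_gt0.
have L0 : 0 < L by rewrite !divr_gt0 ?pi_gt0.
have mf : measurable_fun setT f.
  apply: measurable_funM; last exact: measurable_indic.
  apply: measurable_funM.
    by apply: measurableT_comp => //; apply: measurableT_comp => //; exact: measurable_funM.
  apply: (measurableT_comp (continuous_measurable_fun (@continuous_cos R))).
  exact: measurable_funM.
(* [lam] is the midpoint of [1 / C] and 2, and [eta] is given by [lam * C = 1 + eta]. *)
exists E, X, f, ((1 / C + 2) / 2), ((2 * C - 1) / 2), L, (expR (`|q| * L)).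
split; split=> //.
- have C1 : 0 < 1 / C by rewrite divr_gt0.
  have C2 : 1 / C < 2 by rewrite ltr_pdivrMr//; move: Cgt; lra.
  by apply/andP; split; lra.
- by move: Cgt; lra.
- move=> s; have [sL|sL] := ltP `|s| L; last by rewrite f_out// lexx expR_ge0.
  rewrite f_in// mulr_ge0 ?expR_ge0 ?(ltW (cos_pos sL))//= -[leRHS]mulr1.
  apply: ler_pM; rewrite ?expR_ge0 ?(ltW (cos_pos sL)) ?cos_le1//.
  rewrite ler_expR; apply: le_trans (ler_norm _) _.
  by rewrite normrN normrM ler_wpM2l// ltW.
- by rewrite f_in ?normr0// !mulr0 oppr0 expR0 cos0 mulr1.
- by move=> s sL; rewrite f_out// ltW.
- move=> s fs; have sL : `|s| < L by rewrite ltNge; apply/negP => h; move: fs; rewrite f_out ?eqxx.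
  have int1 : m.-integrable E (EFin \o (fun t => expR (q * X t) * cos (k * X t))).
    by apply: bounded_integrable cosb => //; exact: measurable_funM.
  have int2 : m.-integrable E (EFin \o (fun t => expR (q * X t) * sin (k * X t))).
    by apply: bounded_integrable sinb => //; exact: measurable_funM.
  set a := expR (- (q * s)) * cos (k * s); set b := expR (- (q * s)) * sin (k * s).
  have fb t : `|f t| <= expR (`|q| * L).
    have [tL|tL] := ltP `|t| L; last by rewrite f_out// normr0 expR_ge0.
    rewrite f_in// normrM ger0_norm ?expR_ge0// -[leRHS]mulr1.
    apply: ler_pM; rewrite ?expR_ge0 ?cos_max//.
    rewrite ler_expR; apply: le_trans (ler_norm _) _.
    by rewrite normrN normrM ler_wpM2l// ltW.
  have mfs : measurable_fun setT (fun t => f (s - X t)).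
    by apply: measurableT_comp => //; exact: measurable_funB.
  rewrite (Rintegral_fin (C := expR (`|q| * L)))// -EFinM lee_fin.
  have key : a * C <= \int[m]_(t in E) f (s - X t).
    have -> : a * C = \int[m]_(t in E) (a * (expR (q * X t) * cos (k * X t)) + b * (expR (q * X t) * sin (k * X t))).
      rewrite RintegralD//; last 2 first.
      - exact: (integrableZl mE a int1).
      - exact: (integrableZl mE b int2).
      by rewrite !RintegralZl// sin0 mulr0 addr0.
    apply: le_Rintegral => //.
    + exact: (integrableD mE (integrableZl mE a int1) (integrableZl mE b int2)).
    + by apply: bounded_integrable (fun t _ => fb _).
    + by move=> t Et; exact: f_lower.
  rewrite f_in//; apply: (@le_trans _ _ ((1 / C + 2) / 2 * (a * C))).
    rewrite le_eqVlt; apply/orP; left; apply/eqP; rewrite -/a.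
    by field; exact: lt0r_neq0.
  by rewrite ler_wpM2l// divr_ge0// addr_ge0// divr_ge0// ltW.
Qed.

End CosineTest.

(** * Choice of the tilt and of the frequency *)

Section Tilting.
Context d (T : measurableType d) (R : realType) (m : probability T R).
Variables (Z X : T -> R) (E : set T) (N eta delta : R).
Hypotheses (mE : measurable E) (mX : measurable_fun setT X).
Hypothesis XZ : forall t, E t -> 0 < Z t /\ X t <= ln (Z t).
Hypothesis XN : forall t, E t -> `|X t| <= N.
Hypotheses (eta0 : 0 < eta) (delta0 : 0 < delta) (N0 : 0 < N).
Hypothesis growth : forall q, 0 <= q -> (1 + eta) / 2 <= \int[m]_(t in E) expR (q * X t).
Hypothesis Xdelta : (0 < m (E `&` [set t | (delta <= X t)%R]))%E.

Let mexp (a : R) : measurable_fun setT (fun t => expR (a * X t)).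
Proof. by apply: measurableT_comp => //; exact: measurable_funM. Qed.

Let mcos (b : R) : measurable_fun setT (fun t => cos (b * X t)).
Proof.
apply: (measurableT_comp (continuous_measurable_fun (@continuous_cos R))).
exact: measurable_funM.
Qed.

Let msin (b : R) : measurable_fun setT (fun t => sin (b * X t)).
Proof.
apply: (measurableT_comp (continuous_measurable_fun (@continuous_sin R))).
exact: measurable_funM.
Qed.

Let expb q t : E t -> expR (q * X t) <= expR (`|q| * N).
Proof.
move=> Et; rewrite ler_expR; apply: le_trans (ler_norm _) _.
by rewrite normrM ler_wpM2l// XN.
Qed.

Let int_exp q : m.-integrable E (EFin \o (fun t => expR (q * X t))).
Proof.
apply: (@bounded_integrable _ _ _ m E _ (expR (`|q| * N))) => // t Et.
by rewrite ger0_norm ?expR_ge0 ?expb.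
Qed.

Let int_cos k q : m.-integrable E (EFin \o (fun t => expR (q * X t) * cos (k * X t))).
Proof.
apply: (@bounded_integrable _ _ _ m E _ (expR (`|q| * N))) => // [|t Et].
  exact: measurable_funM.
rewrite normrM ger0_norm ?expR_ge0// -[leRHS]mulr1.
by apply: ler_pM => //; [exact: expb|exact: cos_max].
Qed.

Let sinb k q t : E t -> `|expR (q * X t) * sin (k * X t)| <= expR (`|q| * N).
Proof.
move=> Et; rewrite normrM ger0_norm ?expR_ge0// -[leRHS]mulr1.
by apply: ler_pM => //; [exact: expb|exact: sin_max].
Qed.

Let int_sin k q : m.-integrable E (EFin \o (fun t => expR (q * X t) * sin (k * X t))).
Proof.
apply: (@bounded_integrable _ _ _ m E _ (expR (`|q| * N))) => // [|t]; last exact: sinb.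
exact: measurable_funM.
Qed.

(** As [|X| <= N], a small [k] makes [cos (k X)] at least [c] on all of [E], whatever the tilt, and
    [c * (1 + eta) / 2] still exceeds [1 / 2]. Asking for [k N <= pi / 2] leaves room for a later
    translation by an angle below [pi / 2]. *)
Let small_frequency : exists k, [/\ 0 < k, k * N <= pi / 2 &
  forall q, 0 <= q -> 1 / 2 < \int[m]_(t in E) (expR (q * X t) * cos (k * X t))].
Proof.
pose c := (1 + eta / 2) / (1 + eta).
have c1 : c < 1.
  by rewrite ltr_pdivrMr ?addr_gt0// mul1r ltrD2l ltr_pdivrMr//; move: eta0; lra.
have := @continuous_cos R 0 => /cvgrPdist_lt/(_ (1 - c)).
rewrite subr_gt0 => /(_ c1)/nbhs_ballP[e /= e0 he].
pose k := Num.min (e / 2) (pi / 2) / N.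
have k0 : 0 < k by rewrite divr_gt0// lt_min !divr_gt0 ?pi_gt0.
have kN : k * N = Num.min (e / 2) (pi / 2) by rewrite /k divfK// gt_eqF.
have kNe : k * N < e by rewrite kN gt_min; apply/orP; left; move: e0; lra.
exists k; split=> //; first by rewrite kN ge_min lexx orbT.
move=> q q0; apply: (@lt_le_trans _ _ (c * ((1 + eta) / 2))).
  by rewrite /c mulrA divfK ?gt_eqF ?addr_gt0// ltr_pM2r ?invr_gt0// ltrDl divr_gt0.
have c0 : 0 <= c by rewrite divr_ge0// addr_ge0// ?divr_ge0// ltW.
apply: (@le_trans _ _ (\int[m]_(t in E) (c * expR (q * X t)))).
  by rewrite RintegralZl// ler_wpM2l// growth.
apply: le_Rintegral => //; first exact: (integrableZl mE c (int_exp q)).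
move=> t Et; rewrite mulrC ler_wpM2l ?expR_ge0//.
have : ball 0 e (k * X t).
  rewrite /ball /= sub0r normrN normrM (gtr0_norm k0).
  by apply: le_lt_trans kNe; rewrite ler_pM2l// XN.
move=> /he; rewrite cos0 ltr_norml => /andP[_]; lra.
Qed.

(** A large tilt favours [X >= delta], where the sine is at least [sin (k * delta)]; where [X < 0]
    the integrand is at least -1. The value [M = expR (Q * delta)] is such that the gain is at least
    2 and the loss at most 1. *)
Let sine_positive k : 0 < k -> k * N <= pi / 2 ->
  exists Q, 0 <= Q /\ 0 < \int[m]_(t in E) (expR (Q * X t) * sin (k * X t)).
Proof.
move=> k0 kN.
have mD : measurable [set t | delta <= X t].
  rewrite -[X in measurable X]setTI; apply: (mX measurableT (Y := [set y | delta <= y])).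
  by rewrite -set_itvcy; exact: measurable_itv.
pose A := E `&` [set t | delta <= X t].
have mA : measurable A by exact: measurableI.
pose p := fine (m A).
have p0 : 0 < p by rewrite fine_gt0// Xdelta/=; apply: le_lt_trans (probability_le1 m mA) (ltry _).
have [t0 [Et0 Xt0]] : exists t, A t.
  by apply: contrapT => /forallNP nA; move: Xdelta; rewrite -/A (_ : A = set0) ?measure0 ?ltxx//;
     apply/seteqP; split.
have dN : delta <= N by apply: le_trans Xt0 _; apply: le_trans (ler_norm _) (XN Et0).
have kd0 : 0 < k * delta by rewrite mulr_gt0.
have kdN : k * delta <= pi / 2 by apply: le_trans kN; rewrite ler_pM2l.
have s0 : 0 < sin (k * delta).
  by apply: sin_gt0_pi; rewrite kd0/=; have := pi_gt0 R; lra.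
pose M := 1 + 2 / (sin (k * delta) * p).
have sp0 : 0 < sin (k * delta) * p by rewrite mulr_gt0.
have M1 : 1 <= M by rewrite lerDl divr_ge0// ltW.
have M0 : 0 < M by exact: lt_le_trans M1.
pose Q := ln M / delta.
have Q0 : 0 <= Q by rewrite divr_ge0 ?ln_ge0// ltW.
have Qd : expR (Q * delta) = M by rewrite divfK ?gt_eqF// lnK.
exists Q; split=> //.
apply: (@lt_le_trans _ _ (\int[m]_(t in E) (M * sin (k * delta) * \1_A t + - 1 * 1))).
  have i1 : m.-integrable E (EFin \o (fun t => \1_A t : R)).
    apply: (@bounded_integrable _ _ _ m E _ 1) => // [|t _].
    - exact: measurable_indic.
    - by rewrite indicE; case: (t \in A); rewrite ?normr1 ?normr0.
  have i2 : m.-integrable E (EFin \o (fun t => 1 : R)).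
    by apply: (@bounded_integrable _ _ _ m E _ 1) => // t _; rewrite normr1.
  rewrite RintegralD//; last 2 first.
  - exact: (integrableZl mE (M * sin (k * delta)) i1).
  - exact: (integrableZl mE (-1) i2).
  rewrite !RintegralZl// /Rintegral integral_indic// integral_cst// mul1e.
  rewrite (_ : A `&` E = A); last by rewrite /A setIAC setIid.
  have mE1 : fine (m E) <= 1.
    by rewrite -lee_fin fineK ?fin_num_measure//; exact: probability_le1.
  have : 2 <= M * sin (k * delta) * p.
    by rewrite /M -mulrA mulrDl mul1r divfK ?gt_eqF// lerDr ltW.
  by rewrite -/p; lra.
apply: le_Rintegral => //.
- have i1 : m.-integrable E (EFin \o (fun t => \1_A t : R)).
    apply: (@bounded_integrable _ _ _ m E _ 1) => // [|t _].
    - exact: measurable_indic.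
    - by rewrite indicE; case: (t \in A); rewrite ?normr1 ?normr0.
  have i2 : m.-integrable E (EFin \o (fun t => 1 : R)).
    by apply: (@bounded_integrable _ _ _ m E _ 1) => // t _; rewrite normr1.
  exact: (integrableD mE (integrableZl mE (M * sin (k * delta)) i1) (integrableZl mE (-1) i2)).
- move=> t Et; rewrite mulr1.
  have kX : k * X t <= pi / 2.
    by apply: le_trans kN; rewrite ler_pM2l//; apply: le_trans (ler_norm _) (XN Et).
  have kX' : - (pi / 2) <= k * X t.
    by rewrite lerNl -mulrN; apply: le_trans kN; rewrite ler_pM2l//;
       apply: le_trans (ler_norm _) _; rewrite normrN XN.
  have [dX|dX] := leP delta (X t).
    rewrite indicE mem_set// mulr1.
    have : M * sin (k * delta) <= expR (Q * X t) * sin (k * X t).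
      apply: ler_pM; [exact: ltW|exact: ltW| |].
      - by rewrite -Qd ler_expR ler_wpM2l.
      - rewrite leNgt; apply/negP; rewrite ltr_sin ?ltr_pM2l ?in_itv /= ?kX ?kX'//; last first.
          by rewrite kdN andbT; move: kd0; have := pi_gt0 R; lra.
        by rewrite ltNge dX.
    lra.
  rewrite indicE memNset; last by move=> [_ /=]; rewrite leNgt dX.
  rewrite mulr0 add0r; have [X0|X0] := leP 0 (X t).
    apply: (@le_trans _ _ 0) => //; rewrite mulr_ge0 ?expR_ge0// sin_ge0_pi//.
    by rewrite mulr_ge0 ?(ltW k0)//=; have := pi_gt0 R; move: kX; lra.
  have e1 : expR (Q * X t) <= 1 by rewrite -expR0 ler_expR mulr_ge0_le0// ltW.
  rewrite lerNl -mulrN; apply: (@le_trans _ _ (expR (Q * X t) * 1)); last by rewrite mulr1.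
  by rewrite ler_wpM2l ?expR_ge0// lerNl; have := sin_geN1 (k * X t).
Qed.

Let sine_continuous k Q : 0 <= Q ->
  {within `[0, Q], continuous (fun q => \int[m]_(t in E) (expR (q * X t) * sin (k * X t)))}.
Proof.
move=> Q0.
have ce (a : R) : continuous (fun x : R => expR (x * a)).
  move=> x; apply: continuous_comp; last exact: continuous_expR.
  by apply: cvgM; [exact: cvg_id|exact: cvg_cst].
apply: continuous_in_subspaceT => q; rewrite inE /= in_itv /= => /andP[q0 qQ].
have := @continuity_under_integral R _ T m (fun q t => expR (q * X t) * sin (k * X t)) E mE
  (-1) (Q + 1).
move=> /(_ _ _ (fun=> expR ((Q + 1) * N))); apply.
- by move=> x _; exact: int_sin.
- apply: aeW => t Et x _; apply: cvgM; [exact: ce|exact: cvg_cst].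
- by apply: (@bounded_integrable _ _ _ m E _ (expR ((Q + 1) * N))) => // t _; rewrite ger0_norm ?expR_ge0.
- move=> x; rewrite /= in_itv /= => /andP[x1 x2]; apply: aeW => t Et.
  apply: le_trans (sinb k x Et) _; rewrite ler_expR ler_wpM2r ?(ltW N0)//.
  by rewrite ler_norml; apply/andP; split; lra.
- by rewrite inE /= in_itv /=; apply/andP; split; lra.
Qed.

(* The sine condition is met by choosing the tilt [q] (intermediate values) when
   the sine moment is negative at [q = 0], and otherwise by translating [X]. *)
Lemma tilted_supersolution : supersolution m Z.
Proof.
have [k [k0 kN cosgt]] := small_frequency.
have [S0|S0] := leP 0 (\int[m]_(t in E) (expR (0 * X t) * sin (k * X t))); last first.
  have [Q [Q0 SQ]] := sine_positive k0 kN.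
  have [|q] := @IVT R _ 0 Q 0 Q0 (sine_continuous (k := k) Q0).
    by rewrite ge_min le_max (ltW S0) (ltW SQ) orbT.
  rewrite in_itv /= => /andP[q0 _] Sq.
  apply: (@cosine_supersolution _ _ _ m Z X E q k N) => //; last exact: cosgt.
  by apply: le_trans kN _; have := pi_gt0 R; lra.
set h := (X in 0 <= X) in S0.
pose C := \int[m]_(t in E) (expR (0 * X t) * cos (k * X t)).
have C2 : 1 / 2 < C by exact: cosgt.
have C0 : 0 < C by move: C2; lra.
(* Translating [X] by [a / k] rotates the pair of cosine and sine moments [(C, h)] onto the cosine
   axis, so the sine moment vanishes and the cosine moment does not decrease. Since [a >= 0], the
   translated variable stays below [ln Z]. *)
pose a := atan (h / C).
have a0 : 0 <= a by rewrite -(atan0 R) le_atan// divr_ge0// ltW.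
have api : a < pi / 2 by exact: atan_ltpi2.
have cosa : 0 < cos a by rewrite cos_gt0_pihalf// api atan_gtNpi2.
have sina : C * sin a = h * cos a.
  have := atanK (h / C); rewrite -/a /tan => /(congr1 ( *%R^~ (C * cos a))).
  rewrite mulrCA divfK ?gt_eqF// => ->; rewrite mulrA divfK ?gt_eqF//.
have sina0 : 0 <= sin a.
  by rewrite -(pmulr_rge0 _ C0) sina mulr_ge0// ltW.
pose X' t := X t - a / k.
have kX' t : k * X' t = k * X t - a by rewrite mulrBr mulrCA divff ?mulr1// gt_eqF.
have ic := int_cos k 0; have is_ := int_sin k 0.
apply: (@cosine_supersolution _ _ _ m Z X' E 0 k (N + a / k)) => //.
- exact: measurable_funB.
- move=> t /XZ[Zt Xt]; split=> //; apply: le_trans Xt.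
  by rewrite gerBl divr_ge0// ltW.
- move=> t Et; apply: le_trans (ler_normB _ _) _.
  by rewrite lerD ?XN// ger0_norm// divr_ge0// ltW.
- rewrite mulrDr mulrCA divff ?gt_eqF// mulr1.
  by move: api kN; lra.
- transitivity (\int[m]_(t in E) (cos a * (expR (0 * X t) * sin (k * X t)) + - sin a * (expR (0 * X t) * cos (k * X t)))).
    by apply: eq_Rintegral => t _; rewrite kX' !mul0r expR0 sinB; ring.
  rewrite RintegralD//; last 2 first.
  - exact: (integrableZl mE (cos a) is_).
  - exact: (integrableZl mE (- sin a) ic).
  by rewrite !RintegralZl// -/C -/h mulNr [sin a * C]mulrC sina [cos a * h]mulrC subrr.
- apply: lt_le_trans C2 _.
  rewrite [leRHS](_ : _ = \int[m]_(t in E) (cos a * (expR (0 * X t) * cos (k * X t)) + sin a * (expR (0 * X t) * sin (k * X t)))); last first.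
    by apply: eq_Rintegral => t _; rewrite kX' !mul0r expR0 cosB; ring.
  rewrite RintegralD//; last 2 first.
  - exact: (integrableZl mE (cos a) ic).
  - exact: (integrableZl mE (sin a) is_).
  rewrite !RintegralZl// -/C -/h.
  apply: (@le_trans _ _ (cos a * (cos a * C + sin a * h))).
    rewrite mulrDr [cos a * (sin a * h)]mulrCA [cos a * h]mulrC -sina.
    rewrite (_ : cos a * (cos a * C) + sin a * (C * sin a) = (cos a ^+ 2 + sin a ^+ 2) * C); last by ring.
    by rewrite cos2Dsin2 mul1r.
  rewrite ler_piMl ?cos_le1// addr_ge0// mulr_ge0// ltW//.
Qed.

End Tilting.

(** * Reduction to a bounded log-weight *)

Section Truncation.
Context d (T : measurableType d) (R : realType) (m : probability T R).
Variables (Z : T -> R) (delta : R).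
Hypothesis mZ : measurable_fun setT Z.
Hypothesis delta0 : 0 < delta.
Hypothesis Zdelta : (0 < m [set t | (expR delta <= Z t)%R])%E.
Hypothesis growth : forall q, 0 <= q ->
  ((1 / 2)%:E < \int[m]_(t in [set t | (0 < Z t)%R]) (expR (q * ln (Z t)))%:E)%E.

Let D := [set t | 0 < Z t].
Let E (n : nat) := [set t | expR (- n%:R) <= Z t].
Let X (n : nat) t := Num.min (ln (Z t)) n%:R.
Let G n q := \int[m]_(t in E n) expR (q * X n t).

Let mD : measurable D.
Proof.
rewrite -[X in measurable X]setTI; apply: (mZ measurableT (Y := [set y | 0 < y])).
by rewrite -set_itvoy; exact: measurable_itv.
Qed.

Let mE n : measurable (E n).
Proof.
rewrite -[X in measurable X]setTI; apply: (mZ measurableT (Y := [set y | expR (- n%:R) <= y])).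
by rewrite -set_itvcy; exact: measurable_itv.
Qed.

Let mX n : measurable_fun setT (X n).
Proof.
apply: measurable_minr => //.
by apply: measurableT_comp => //; exact: measurable_ln.
Qed.

Let ED n : E n `<=` D.
Proof. by move=> t; apply: lt_le_trans; exact: expR_gt0. Qed.

Let Eln n t : E n t -> - n%:R <= ln (Z t).
Proof. by move=> Et; rewrite -ler_expR lnK// posrE; exact: (ED Et). Qed.

Let XN n t : E n t -> `|X n t| <= n%:R.
Proof.
move=> Et; rewrite ler_norml ge_min lexx orbT andbT le_min Eln//=.
by rewrite (@le_trans _ _ 0)// oppr_le0.
Qed.

Let Emono n p : (n <= p)%N -> E n `<=` E p.
Proof. by move=> np t; apply: le_trans; rewrite ler_expR lerN2 ler_nat. Qed.

Let Xmono n p t : (n <= p)%N -> X n t <= X p t.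
Proof. by move=> np; rewrite /X le_min2// ler_nat. Qed.

Let mexp n q : measurable_fun setT (fun t => expR (q * X n t)).
Proof. by apply: measurableT_comp => //; exact: measurable_funM. Qed.

Let expb n q t : E n t -> expR (q * X n t) <= expR (`|q| * n%:R).
Proof.
move=> Et; rewrite ler_expR; apply: le_trans (ler_norm _) _.
by rewrite normrM ler_wpM2l// XN.
Qed.

Let int_exp n q : m.-integrable (E n) (EFin \o (fun t => expR (q * X n t))).
Proof.
apply: (@bounded_integrable _ _ _ m (E n) _ (expR (`|q| * n%:R))) => // t Et.
by rewrite ger0_norm ?expR_ge0 ?expb.
Qed.

Let GE n q : (G n q)%:E = (\int[m]_(t in E n) (expR (q * X n t))%:E)%E.
Proof.
by rewrite (@Rintegral_fin _ _ _ m (E n) _ (expR (`|q| * n%:R))) // => t Et; rewrite ger0_norm ?expR_ge0 ?expb.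
Qed.

Let Gmono n p q : 0 <= q -> (n <= p)%N -> G n q <= G p q.
Proof.
move=> q0 np; rewrite -lee_fin !GE.
apply: (@le_trans _ _ (\int[m]_(t in E n) (expR (q * X p t))%:E)%E).
  apply: ge0_le_integral => //.
  - by apply/measurable_EFinP; exact: measurable_funTS.
  - by apply/measurable_EFinP; exact: measurable_funTS.
  - by move=> t _; rewrite lee_fin ler_expR ler_wpM2l// Xmono.
apply: ge0_subset_integral => //.
- by apply/measurable_EFinP; exact: measurable_funTS.
- exact: Emono.
Qed.

Let Gpointwise q : 0 <= q -> exists n, 1 / 2 < G n q.
Proof.
move=> q0; apply: contrapT => /forallNP nG.
have := growth q0; rewrite ltNge => /negP; apply.
pose h n t := (expR (q * X n t) * \1_(E n) t)%:E.
have hmono t : {homo h ^~ t : n p / (n <= p)%N >-> (n <= p)%E}.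
  move=> n p np; rewrite /h lee_fin !indicE.
  apply: ler_pM; rewrite ?expR_ge0//.
    by rewrite ler_expR ler_wpM2l// Xmono.
  have [Et|] := boolP (t \in E n); last by rewrite ler0n.
  by rewrite (_ : t \in E p)//; move: Et; rewrite !inE; exact: Emono.
have hlim t : D t -> h n t @[n --> \oo] --> (expR (q * ln (Z t)))%:E.
  move=> Dt; apply: cvg_near_cst; near=> n.
  have ln_n : `|ln (Z t)| <= n%:R by near: n; exact: nbhs_infty_ger.
  have Et : E n t.
    rewrite /E /= -[leRHS]lnK// ler_expR lerNl; apply: le_trans ln_n.
    by rewrite -normrN ler_norm.
  rewrite /h indicE mem_set// mulr1 /X; congr ((expR (q * _))%:E).
  by apply/min_idPl; apply: le_trans ln_n; exact: ler_norm.
have mh n : measurable_fun D (h n).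
  apply/measurable_EFinP; apply: measurable_funTS; exact: measurable_funM.
have h0 n t : D t -> (0 <= h n t)%E by move=> _; rewrite lee_fin mulr_ge0 ?expR_ge0.
have := @cvg_monotone_convergence _ _ _ m D mD h mh h0 (fun t _ => hmono t).
rewrite (eq_integral (fun t => (expR (q * ln (Z t)))%:E)); last first.
  by move=> t; rewrite inE => Dt; apply/cvg_lim => //; exact: hlim.
move=> hcvg; rewrite -(cvg_lim _ hcvg)//; apply: lime_le; first by apply/cvg_ex; eexists; exact: hcvg.
apply: nearW => n.
apply: (@le_trans _ _ (G n q)%:E); last by rewrite lee_fin leNgt; apply/negP/nG.
rewrite GE [leRHS](_ : _ = \int[m]_(t in D `&` E n) (expR (q * X n t))%:E)%E; last first.
  by congr integral; apply/esym/setIidPr; exact: ED.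
rewrite integral_mkcondr le_eqVlt; apply/orP; left; apply/eqP; apply: eq_integral => t _.
by rewrite /h patchE indicE; case: ifPn => _; rewrite ?mulr1 ?mulr0.
Unshelve. all: by end_near. Qed.

Let Gcontinuous n (q : R) : G n x @[x --> q] --> G n q.
Proof.
have ce (a : R) : continuous (fun x : R => expR (x * a)).
  move=> x; apply: continuous_comp; last exact: continuous_expR.
  by apply: cvgM; [exact: cvg_id|exact: cvg_cst].
have := @continuity_under_integral R _ T m (fun q t => expR (q * X n t)) (E n) (mE n)
  (q - 1) (q + 1).
move=> /(_ _ _ (fun=> expR ((`|q| + 1) * n%:R))); apply.
- by move=> x _; exact: int_exp.
- by apply: aeW => t Et x _; exact: ce.
- by apply: (@bounded_integrable _ _ _ m (E n) _ (expR ((`|q| + 1) * n%:R))) => // t _; rewrite ger0_norm ?expR_ge0.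
- move=> x; rewrite /= in_itv /= => /andP[x1 x2]; apply: aeW => t Et.
  rewrite ger0_norm ?expR_ge0//; apply: le_trans (expb _ Et) _.
  rewrite ler_expR ler_wpM2r// ler_norml.
  by have := ler_norm q; have := ler_norm (- q); rewrite normrN => ? ?; apply/andP; split; lra.
- by rewrite inE /= in_itv /=; apply/andP; split; lra.
Qed.

(** With [p] the probability of [Z >= expR delta], a tilt [q >= ln (1 / p) / delta] makes the
    integrand at least [1 / p] on that event. *)
Let Glarge : exists Q, forall n q, delta <= n%:R -> Q <= q -> 1 <= G n q.
Proof.
pose A := [set t | expR delta <= Z t].
have mA : measurable A.
  rewrite -[X in measurable X]setTI; apply: (mZ measurableT (Y := [set y | expR delta <= y])).
  by rewrite -set_itvcy; exact: measurable_itv.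
pose p := fine (m A).
have p0 : 0 < p by rewrite fine_gt0// Zdelta/=; apply: le_lt_trans (probability_le1 m mA) (ltry _).
exists (Num.max 0 (ln p^-1 / delta)) => n q dn; rewrite ge_max => /andP[q0 qQ].
have eq_ : p^-1 <= expR (q * delta).
  by rewrite -[leLHS]lnK ?posrE ?invr_gt0// ler_expR -ler_pdivrMr.
have AE : A `<=` E n.
  by move=> t; apply: le_trans; rewrite ler_expR; move: dn delta0; lra.
rewrite -lee_fin GE.
apply: (@le_trans _ _ (\int[m]_(t in A) (p^-1)%:E)%E).
  have mAp : m A = p%:E by rewrite fineK// fin_num_measure.
  rewrite integral_cst// [X in (_ * X)%E](_ : _ = p%:E); last exact: mAp.
  by rewrite -EFinM lee_fin mulVf ?gt_eqF.
apply: (@le_trans _ _ (\int[m]_(t in A) (expR (q * X n t))%:E)%E).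
  apply: ge0_le_integral => //.
  - by move=> t _; rewrite lee_fin invr_ge0 ltW.
  - by apply/measurable_EFinP; exact: measurable_funTS.
  - move=> t At; rewrite lee_fin; apply: le_trans eq_ _.
    rewrite ler_expR ler_wpM2l// le_min dn andbT -ler_expR lnK//.
    by rewrite posrE; exact: ED (AE _ At).
apply: ge0_subset_integral => //.
by apply/measurable_EFinP; exact: measurable_funTS.
Qed.

(** A Dini argument: [G n] is continuous in [q], nondecreasing in [n], and exceeds [1 / 2] at each
    [q] for some [n]. Compactness gives one [n] for all [q] in [[0, Q]], and [Glarge] covers the
    larger ones. *)
Lemma supersolution_exists : supersolution m Z.
Proof.
have [Q hQ] := Glarge.
(* The slack shrinks while the truncation level grows, so a single large [n] can serve for both. *)
pose eta (n : nat) : R := n.+1%:R^-1.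
have eta1 n : eta n <= 1 by rewrite invf_le1// ler1n.
have near_unif : \forall n \near \oo, `[0, Q]%classic `<=`
    [set q | 0 <= q -> (1 + eta n) / 2 <= G n q].
  have cpt : compact `[(0 : R), Q]%classic by exact: segment_compact.
  apply: (iffLR (compact_near_coveringP _) cpt nat \oo (fun n q => 0 <= q -> (1 + eta n) / 2 <= G n q)).
  move=> q; rewrite /= in_itv /= => /andP[q0 _].
  have [p hp] := Gpointwise q0.
  have e0 : 0 < G p q - 1 / 2 by rewrite subr_gt0.
  have := @Gcontinuous p q => /cvgrPdist_lt/(_ _ (divr_gt0 e0 (ltr0Sn _ 1))) hc.
  have hn : \forall n \near \oo, eta n <= G p q - 1 / 2 /\ (p <= n)%N.
    near=> n; split; last by near: n; exact: nbhs_infty_ge.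
    rewrite invf_ple ?posrE//; apply: (@le_trans _ _ n%:R); last by rewrite ler_nat.
    by near: n; exact: nbhs_infty_ger.
  exists ([set x | `|G p q - G p x| < (G p q - 1 / 2) / 2],
          [set n | eta n <= G p q - 1 / 2 /\ (p <= n)%N]) => //=.
  move=> [x n] /= [hx [hn1 pn]] x0; apply: le_trans (Gmono x0 pn).
  move: hx; rewrite ltr_norml => /andP[_]; lra.
have [n [hn dn n0]] : exists n, [/\ `[0, Q]%classic `<=`
    [set q | 0 <= q -> (1 + eta n) / 2 <= G n q], delta <= n%:R & (0 < n)%N].
  near \oo => n; exists n; split.
  - by near: n.
  - by near: n; exact: nbhs_infty_ger.
  - by near: n; exact: nbhs_infty_gt.
apply: (@tilted_supersolution _ _ _ m Z (X n) (E n) n%:R (eta n) delta) => //.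
- by move=> t Et; split; [exact: ED Et|rewrite ge_min lexx].
- exact: XN.
- by rewrite invr_gt0.
- by rewrite ltr0n.
- move=> q q0; have [qQ|qQ] := leP q Q; first by apply: hn => //=; rewrite in_itv /= q0.
  apply: le_trans (hQ n q dn (ltW qQ)); move: (eta1 n); lra.
- rewrite (_ : _ `&` _ = [set t | expR delta <= Z t])//.
  apply/seteqP; split=> t /=.
    move=> [Et]; rewrite le_min dn andbT => h; rewrite -[leRHS]lnK ?ler_expR// posrE; exact: ED Et.
  move=> h; have Et : E n t by apply: le_trans h; rewrite ler_expR; move: dn delta0; lra.
  by split=> //; rewrite le_min dn andbT -ler_expR lnK// posrE; exact: ED Et.
Unshelve. all: by end_near. Qed.

End Truncation.

(** Jensen by way of the Young inequality [q x <= x^q + (q - 1)], integrated. *)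
Lemma moment_ge1 d (T : measurableType d) (R : realType) (m : probability T R)
    (U : T -> R) (q : R) : measurable_fun setT U -> (forall t, 0 <= U t) ->
  (\int[m]_t (U t)%:E = 1)%E -> 1 < q -> (1 <= \int[m]_t (U t `^ q)%:E)%E.
Proof.
move=> mU U0 meanU q1; have q0 : 0 < q by exact: lt_trans q1.
have mUq : measurable_fun setT (fun t => U t `^ q).
  exact: (measurableT_comp (measurable_powR q)).
have young t : q * U t <= U t `^ q + (q - 1).
  have p0 : 0 < q / (q - 1) by rewrite divr_gt0// subr_gt0.
  have pq : q^-1 + (q / (q - 1))^-1 = 1.
    by rewrite invf_div; field; exact: lt0r_neq0.
  have := conjugate_powR (U0 t) ler01 q0 p0 pq.
  rewrite mulr1 powR1 invf_div mul1r => h.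
  rewrite (_ : _ + _ = q * (U t `^ q / q + (q - 1) / q)).
    by rewrite ler_pM2l.
  by field; exact: lt0r_neq0.
have : (q%:E <= \int[m]_t (U t `^ q)%:E + (q - 1)%:E)%E.
  rewrite (_ : q%:E = \int[m]_t (q * U t)%:E)%E; last first.
    under eq_integral do rewrite EFinM.
    rewrite ge0_integralZl_EFin ?meanU ?mule1 ?ltW//.
      by move=> t _; rewrite lee_fin.
    exact/measurable_EFinP.
  rewrite (_ : (q - 1)%:E = \int[m]_t (q - 1)%:E)%E; last first.
    by rewrite integral_cst// [X in (_ * X)%E](_ : _ = 1%E) ?mule1//; exact: probability_setT.
  rewrite -ge0_integralD//.
  - apply: ge0_le_integral => //.
    + by move=> t _; rewrite lee_fin mulr_ge0// ltW.
    + by apply/measurable_EFinP; exact: measurable_funM.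
    + by apply/measurable_EFinP; exact: measurable_funD.
    + by move=> t _; rewrite -EFinD lee_fin.
  - by move=> t _; rewrite lee_fin powR_ge0.
  - exact/measurable_EFinP.
  - by move=> t _; rewrite lee_fin subr_ge0 ltW.
case: (\int[m]_t (U t `^ q)%:E)%E => [r| |]//; rewrite ?leey//.
by rewrite -EFinD !lee_fin; lra.
Qed.

(** * Lower bounds for the moments of Z *)

Section MomentGrowth.
Context d (T : measurableType d) (R : realType) (m : probability T R).
Variables (U : T -> R) (A sg : R).
Hypotheses (mU : measurable_fun setT U) (U0 : forall t, 0 <= U t).
Hypothesis meanU : (\int[m]_t (U t)%:E = 1)%E.
Hypothesis entropy_pos : (\int[m]_t (U t * Num.max (log2 (U t)) 0)%:E < +oo)%E.
Hypothesis entropy_lt1 : (\int[m]_t (U t * log2 (U t))%:E < 1)%E.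
Hypotheses (A_lt : A < sg) (sg0 : 0 < sg).
Hypothesis exponent_le : forall q M, 1 < q -> (\int[m]_t (U t `^ q)%:E = M%:E)%E ->
  q - 1 - log2 M <= A * q.

Let c : R := pow2 sg / 2.
Let Z t := c * U t.

Let c0 : 0 < c. Proof. by rewrite divr_gt0 ?pow2_gt0. Qed.

Let ln20 : 0 < ln (2 : R). Proof. by rewrite ln_gt0// ltr1n. Qed.

Let c_expR q : expR (q * ln c) = pow2 ((sg - 1) * q).
Proof.
rewrite /c lnM ?posrE ?pow2_gt0 ?invr_gt0// lnV ?posrE// /pow2 ln_powR.
by rewrite /powR pnatr_eq0 /=; congr expR; ring.
Qed.

Let ZU t : (0 < Z t) = (0 < U t). Proof. by rewrite /Z pmulr_rgt0. Qed.

Let D := [set t | 0 < U t].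

Let mD : measurable D.
Proof.
rewrite -[X in measurable X]setTI; apply: (mU measurableT (Y := [set y | 0 < y])).
by rewrite -set_itvoy; exact: measurable_itv.
Qed.

Let mlnU : measurable_fun setT (fun t => ln (U t)).
Proof. by apply: measurableT_comp => //; exact: measurable_ln. Qed.

Let mexp q : measurable_fun setT (fun t => expR (q * ln (U t))).
Proof. by apply: measurableT_comp => //; exact: measurable_funM. Qed.

Let expZ q t : D t -> expR (q * ln (Z t)) = pow2 ((sg - 1) * q) * expR (q * ln (U t)).
Proof. by move=> Dt; rewrite /Z lnM ?posrE// mulrDr expRD c_expR. Qed.

Let int_expZ q : (\int[m]_(t in [set t | (0 < Z t)%R]) (expR (q * ln (Z t)))%:E =
  (pow2 ((sg - 1) * q))%:E * \int[m]_(t in D) (expR (q * ln (U t)))%:E)%E.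
Proof.
rewrite -ge0_integralZl_EFin//; last 2 first.
- by apply/measurable_EFinP; exact: measurable_funTS.
- by rewrite pow2_ge0.
rewrite (_ : [set t | 0 < Z t] = D); last by apply/seteqP; split=> t /=; rewrite ZU.
by apply: eq_integral => t; rewrite inE => Dt; rewrite -EFinM expZ.
Qed.

Let int_powR q : 0 < q -> (\int[m]_(t in D) (expR (q * ln (U t)))%:E = \int[m]_t (U t `^ q)%:E)%E.
Proof.
move=> q0; rewrite [LHS]integral_mkcond; apply: eq_integral => t _.
rewrite patchE; case: ifPn => [|/negP]; rewrite inE => Dt; first by rewrite /powR gt_eqF.
have -> : U t = 0 by apply/le_anti; rewrite U0 andbT leNgt; apply/negP.
by rewrite powR0// gt_eqF.
Qed.

(** For a finite moment [M], [exponent_le] reads [log2 M >= q - 1 - A q], and the factor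
    [2^((sg - 1) q)] turns this into the stated exponent; an infinite moment is only better. *)
Let growth_large q : 1 < q ->
  ((pow2 (q * (sg - A) - 1))%:E <= \int[m]_(t in [set t | (0 < Z t)%R]) (expR (q * ln (Z t)))%:E)%E.
Proof.
move=> q1; have q0 : 0 < q by exact: lt_trans q1.
rewrite int_expZ int_powR//.
have i0 : (0 <= \int[m]_t (U t `^ q)%:E)%E by apply: integral_ge0 => t _; rewrite lee_fin powR_ge0.
case eM : (\int[m]_t (U t `^ q)%:E)%E (@exponent_le q) i0 => [M| |] // h i0; last first.
  by rewrite gt0_muley ?leey// lte_fin pow2_gt0.
have {}h := h M q1 erefl.
rewrite -EFinM lee_fin.
have M0 : 0 < M.
  by apply: lt_le_trans (ltr01 : 0 < 1 :> R) _; rewrite -lee_fin -eM; exact: moment_ge1.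
have ME : M = pow2 (log2 M).
  by rewrite /pow2 /powR pnatr_eq0 /= /log2 divfK ?gt_eqF// lnK.
rewrite ME -pow2D ler_pow2; move: h; rewrite mulrBl mulrBr !mul1r mulrC; lra.
Qed.

Let mUlog : measurable_fun setT (fun t => U t * log2 (U t)).
Proof. by apply: measurable_funM => //; exact: measurable_funM. Qed.

Let i1 : m.-integrable setT (EFin \o (fun t => 1 : R)).
Proof. by apply: (@bounded_integrable _ _ _ m setT _ 1) => // t _; rewrite normr1. Qed.

Let iU : m.-integrable setT (EFin \o U).
Proof.
apply/integrableP; split; first exact/measurable_EFinP.
under eq_integral do rewrite /= ger0_norm//.
by rewrite meanU ltry.
Qed.

(** The negative part is bounded, as [x ln (1 / x) <= 1]. *)
Let entropy_integrable : m.-integrable setT (EFin \o (fun t => U t * log2 (U t))).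
Proof.
have mpos : measurable_fun setT (fun t => U t * Num.max (log2 (U t)) 0).
  by apply: measurable_funM => //; apply: measurable_maxr => //; exact: measurable_funM.
have pos0 t : 0 <= U t * Num.max (log2 (U t)) 0 by rewrite mulr_ge0// le_max lexx orbT.
have ipos : m.-integrable setT (EFin \o (fun t => U t * Num.max (log2 (U t)) 0)).
  apply/integrableP; split; first exact/measurable_EFinP.
  by under eq_integral do rewrite /= ger0_norm//.
apply: (@le_integrable _ _ _ m setT measurableT _
  (EFin \o (fun t => U t * Num.max (log2 (U t)) 0 + (ln 2)^-1 * 1))).
- exact/measurable_EFinP.
- move=> t _; rewrite /= lee_fin mulr1.
  have i2 : 0 <= (ln (2 : R))^-1 by rewrite invr_ge0 ltW.
  rewrite [leRHS]ger0_norm; last exact: addr_ge0.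
  have [l0|l0] := leP (log2 (U t)) 0; last first.
    by rewrite ger0_norm; [rewrite lerDl|rewrite mulr_ge0// ltW].
  rewrite mulr0 add0r normrM ger0_norm// ler0_norm//.
  have := U0 t; rewrite le_eqVlt => /orP[/eqP<-|Ut]; first by rewrite mul0r.
  rewrite /log2 -mulNr mulrA ler_piMl// -lnV ?posrE//.
  have : ln (U t)^-1 <= (U t)^-1 - 1.
    have := @le_ln1Dx R ((U t)^-1 - 1); rewrite (addrC 1) subrK; apply.
    by rewrite ltrBrDr addNr invr_gt0.
  move=> /(ler_wpM2l (U0 t)); rewrite mulrBr divff ?gt_eqF//; move: Ut; lra.
- exact: (integrableD measurableT ipos (integrableZl measurableT (ln 2)^-1 i1)).
Qed.

Let ell := \int[m]_t (U t * log2 (U t)).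

Let ell_lt1 : ell < 1.
Proof.
rewrite -lte_fin /ell /Rintegral fineK//.
exact: integrable_fin_num.
Qed.

(** Jensen under the law of density [U]: on [U > 0], [U^q] is [U] times [expR ((q - 1) ln U)]. The
    tangent line of the exponential at [y0] gives the pointwise inequality to integrate. *)
Let growth_small q : 0 <= q -> q <= 1 ->
  ((pow2 ((q - 1) * ell))%:E <= \int[m]_(t in D) (expR (q * ln (U t)))%:E)%E.
Proof.
move=> q0 q1; pose f t := expR (q * ln (U t)) * \1_D t.
have mf : measurable_fun setT f by exact: measurable_funM.
have f0 t : 0 <= f t by rewrite mulr_ge0 ?expR_ge0.
have -> : (\int[m]_(t in D) (expR (q * ln (U t)))%:E = \int[m]_t (f t)%:E)%E.
  rewrite integral_mkcond; apply: eq_integral => t _.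
  by rewrite /f patchE indicE; case: ifPn => _; rewrite ?mulr1 ?mulr0.
have fi : m.-integrable setT (EFin \o f).
  apply: (@le_integrable _ _ _ m setT measurableT _ (EFin \o (fun t => 1 + U t))).
  - exact/measurable_EFinP.
  - move=> t _; rewrite /= lee_fin !ger0_norm ?addr_ge0// /f indicE.
    have [|Dt] := boolP (t \in D); last by rewrite mulr0 addr_ge0.
    rewrite inE => Dt; rewrite mulr1; have [l0|l0] := leP (ln (U t)) 0.
      by rewrite (@le_trans _ _ 1) ?lerDl// -expR0 ler_expR mulr_ge0_le0.
    rewrite (@le_trans _ _ (U t)) ?lerDr// -[leRHS]lnK ?posrE// ler_expR.
    by rewrite ler_piMl// ltW.
  - exact: (integrableD measurableT i1 iU).
have -> : (\int[m]_t (f t)%:E = (\int[m]_t f t)%:E)%E.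
  by rewrite /Rintegral fineK//; exact: integrable_fin_num.
rewrite lee_fin; pose y0 := (q - 1) * ell * ln 2.
have ey : pow2 ((q - 1) * ell) = expR y0 by rewrite /pow2 /powR pnatr_eq0.
pose a := expR y0 * (1 - y0); pose b := expR y0 * ((q - 1) * ln 2).
apply: (@le_trans _ _ (\int[m]_t (a * U t + b * (U t * log2 (U t))))).
  rewrite RintegralD//; last 2 first.
  - exact: (integrableZl measurableT a iU).
  - exact: (integrableZl measurableT b entropy_integrable).
  rewrite !RintegralZl// -/ell.
  have -> : \int[m]_t U t = 1 by rewrite /Rintegral meanU.
  by rewrite ey /a /b /y0 le_eqVlt; apply/orP; left; apply/eqP; ring.
apply: le_Rintegral => //.
  exact: (integrableD measurableT (integrableZl measurableT a iU) (integrableZl measurableT b entropy_integrable)).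
move=> t _; have [Dt|Dt] := boolP (t \in D); last first.
  have -> : U t = 0.
    by apply/le_anti; rewrite U0 andbT leNgt; apply/negP => h; move: Dt; rewrite mem_set.
  by rewrite mul0r !mulr0 addr0.
rewrite /f indicE Dt mulr1; move: Dt; rewrite inE => Dt.
have -> : q * ln (U t) = ln (U t) + (q - 1) * ln (U t) by ring.
rewrite expRD lnK ?posrE//.
have -> : a * U t + b * (U t * log2 (U t)) = U t * (expR y0 * (1 + ((q - 1) * ln (U t) - y0))).
  by rewrite /a /b /log2; field; exact: lt0r_neq0.
rewrite ler_wpM2l//.
rewrite (_ : expR ((q - 1) * ln (U t)) = expR y0 * expR ((q - 1) * ln (U t) - y0)).
  by rewrite ler_wpM2l ?expR_ge0//; exact: expR_ge1Dx.
by rewrite -expRD; congr expR; ring.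
Qed.

(** For [q <= 1] the exponent is [-1 + sg q + (1 - q) (1 - ell)], above -1 because [sg > 0] and the
    entropy [ell] is below 1. For [q > 1] the condition [A < sg] decides. *)
Lemma moment_growth q : 0 <= q ->
  ((1 / 2)%:E < \int[m]_(t in [set t | (0 < Z t)%R]) (expR (q * ln (Z t)))%:E)%E.
Proof.
move=> q0; have half : 1 / 2 = pow2 (-1) :> R by rewrite pow2N /pow2 powRr1// div1r.
have [q1|q1] := leP q 1; last first.
  apply: lt_le_trans (growth_large q1); rewrite lte_fin half ltr_pow2.
  by rewrite ltrBrDr addNr mulr_gt0 ?subr_gt0// (lt_trans _ q1).
rewrite int_expZ; apply: (@lt_le_trans _ _ ((pow2 ((sg - 1) * q))%:E * (pow2 ((q - 1) * ell))%:E)%E).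
  rewrite -EFinM -pow2D lte_fin half ltr_pow2.
  have -> : (sg - 1) * q + (q - 1) * ell = -1 + (sg * q + (1 - q) * (1 - ell)) by ring.
  rewrite ltrDl; move: q0; rewrite le_eqVlt => /orP[/eqP<-|q0].
    by rewrite mulr0 add0r subr0 mul1r subr_gt0.
  by rewrite ltr_wpDr ?mulr_gt0// mulr_ge0 ?subr_ge0// ltW.
by apply: lee_wpmul2l; [rewrite lee_fin pow2_ge0|exact: growth_small].
Qed.

(** Otherwise [Z <= 1] almost surely, and all its moments would be at most 1, against [growth_large]
    at a [q] with [q (sg - A) >= 2]. *)
Lemma moment_exceeds : exists delta, 0 < delta /\ (0 < m [set t | (expR delta <= Z t)%R])%E.
Proof.
have mZ : measurable_fun setT Z by exact: measurable_funM.
have mS n : measurable [set t | expR n.+1%:R^-1 <= Z t].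
  rewrite -[X in measurable X]setTI; apply: (mZ measurableT [set y | expR n.+1%:R^-1 <= y]).
  by rewrite -set_itvcy; exact: measurable_itv.
apply: contrapT => /forallNP nd.
have Zle1 : {ae m, forall t, Z t <= 1}.
  have : m.-negligible (\bigcup_n [set t | expR n.+1%:R^-1 <= Z t]).
    apply: negligible_bigcup => n; exists [set t | expR n.+1%:R^-1 <= Z t]; split=> //.
    apply/le_anti; rewrite measure_ge0 andbT leNgt; apply/negP => h.
    by apply: (nd n.+1%:R^-1).
  apply: negligibleS => t /= /negP; rewrite -ltNge => Z1.
  have l0 : 0 < ln (Z t) by rewrite ln_gt0.
  exists (Num.truncn (ln (Z t))^-1) => //=.
  rewrite -[leRHS]lnK ?posrE ?(lt_trans _ Z1)// ler_expR invf_ple ?posrE//.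
  by apply: ltW; exact: truncnS_gt.
pose q := Num.max 2 (2 / (sg - A)).
have sA : 0 < sg - A by rewrite subr_gt0.
have q2 : 2 <= q by rewrite le_max lexx.
have q1 : 1 < q by apply: lt_le_trans q2; rewrite ltr1n.
have := growth_large q1; rewrite leNgt => /negP; apply.
apply: (@le_lt_trans _ _ 1%E); last first.
  rewrite lte_fin -[ltLHS](pow2_0 R) ltr_pow2 subr_gt0.
  apply: (@lt_le_trans _ _ 2); first by rewrite ltr1n.
  by rewrite -ler_pdivrMr// le_max lexx orbT.
have mD' : measurable [set t | 0 < Z t].
  by rewrite (_ : [set t | 0 < Z t] = D)//; apply/seteqP; split=> t /=; rewrite ZU.
apply: (@le_trans _ _ (\int[m]_(t in [set t | (0 < Z t)%R]) 1)%E).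
  apply: ae_ge0_le_integral => //.
  - apply/measurable_EFinP; apply: measurable_funTS; apply: measurableT_comp => //.
    by apply: measurable_funM => //; apply: measurableT_comp => //; exact: measurable_ln.
  - apply: filterS Zle1 => t Z1 Zt; rewrite lee_fin -expR0 ler_expR.
    by rewrite mulr_ge0_le0 ?ln_le0// (le_trans _ q2).
rewrite integral_cst// mul1e; exact: probability_le1.
Qed.

End MomentGrowth.

(** * Measures on the circle *)

(** The integral from 0 is written as a difference of two integrals from a lower end depending on
    [x], which handles both signs of [x]. Near a given [t] that end can be replaced by the fixed
    [- N], and the fundamental theorem applies. *)
Lemma antiderivative (R : realType) (f : R -> R) : continuous f ->
  exists F : R -> R, forall t : R, is_derive t 1 F (f t).
Proof.
move=> cf.
have fi (a b : R) (ba bb : bool) : lebesgue_measure.-integrable [set` Interval (BSide ba a) (BSide bb b)] (EFin \o f).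
  have [ab|ab] := leP a b.
    apply: (@integrableS _ _ _ lebesgue_measure `[a, b]%classic) => //.
      by apply: subset_itvScc; rewrite bnd_simp.
    by apply: continuous_compact_integrable; [exact: segment_compact|exact: continuous_subspaceT].
  by rewrite set_itv_ge ?integrable_set0// -leNgt; case: ba bb => -[]; rewrite bnd_simp ?ab ?ltW.
pose G M x := \int[lebesgue_measure]_(s in `[- M, x]) f s.
pose H M x := \int[lebesgue_measure]_(s in `]- M, x]) f s.
pose F x := G (`|x| + 1) x - G (`|x| + 1) 0.
have GH M N x : N <= M -> - N <= x -> G M x = G M (- N) + H N x.
  move=> NM Nx; have := @Rintegral_itvB R f (BLeft (- M)) (BRight x) (- N) (fi _ _ _ _).
  by rewrite !bnd_simp lerN2 => /(_ NM Nx); rewrite -/(G M x) -/(G M (- N)) -/(H N x); lra.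
have cancel (x y z : R) : x + y - (x + z) = y - z by lra.
exists F => t.
pose N : R := `|t| + 2^-1.
have N0 : 0 < N by rewrite ltr_wpDl.
have tN : `|t| < N by rewrite ltrDl.
have FH y : `|y - t| < 2^-1 -> F y = H N y - H N 0.
  move=> yt.
  have yN : `|y| <= N.
    have := ler_normD (y - t) t; rewrite subrK /N; lra.
  have Ny : N <= `|y| + 1.
    have := ler_normD (t - y) y; rewrite subrK distrC /N; lra.
  rewrite /F (GH _ N y Ny) ?(GH _ N 0 Ny); last 2 first.
  - by rewrite oppr_le0 ltW.
  - by rewrite lerNl; apply: le_trans yN; rewrite -normrN ler_norm.
  exact: cancel.
have Nt : - N < t by rewrite ltrNl; apply: le_lt_trans tN; rewrite -normrN ler_norm.
have tt1 : t < t + 1 by rewrite ltrDl.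
have [dH eH] := @continuous_FTC1 R f (BRight (- N)) t (t + 1) tt1 (fi _ _ _ _) Nt (cf t).
apply: (@near_eq_is_derive _ _ _ (fun y => H N y - H N 0)).
  near=> y; apply/esym/FH; rewrite distrC; near: y.
  by apply: (@cvgr_dist_lt _ _ _ _ _ id t) => //; rewrite invr_gt0.
rewrite -[f t]subr0; apply: is_deriveB.
by rewrite -eH derive1E; apply: DeriveDef.
Unshelve. all: by end_near. Qed.

Import HBNNSimple.

(** The integral is built from simple functions and so sees [mu] only on measurable sets. The steps
    of the cascade and the laws of the weights are plain set functions, to which this applies. *)
Lemma eq_setfun_integral d (T : measurableType d) (R : realType)
    (mu nu : set T -> \bar R) (f : T -> \bar R) :
  (forall A, measurable A -> mu A = nu A) ->
  (\int[mu]_x f x = \int[nu]_x f x)%E.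
Proof.
move=> eq_mu; rewrite /integral.
have eqs (h : {nnsfun T >-> R}) : sintegral mu h = sintegral nu h.
  by rewrite /sintegral; apply: eq_fsbigr => x _; rewrite eq_mu//; exact: measurable_sfunP.
by congr (ereal_sup _ - ereal_sup _)%E; apply: eq_imagel => h _; exact: eqs.
Qed.

(** * The circle as a measurable space *)

Section TorusMeasure.
Variable R : realType.
Implicit Type h : torus R -> R.

Lemma continuous_to_torus : continuous (@to_torus R).
Proof. exact: pi_continuous. Qed.

Lemma to_torus_eq (x y : R) : to_torus x = to_torus y <-> (x - y) \is a Num.int.
Proof. by split=> [/eqmodP|h]; last exact/eqmodP. Qed.

Lemma measurable_to_torus : measurable_fun setT (@to_torus R).
Proof.
apply: (@measurability _ _ _ _ _ _ (@open (torus R))) => // _ [A oA <-].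
rewrite setTI; apply: open_measurable.
by move/continuousP: continuous_to_torus; exact.
Qed.

Lemma measurable_continuous_torus h : continuous h -> measurable_fun setT h.
Proof.
move=> ch; apply: (measurability _ (RGenOpens.measurableE R)).
move=> _ [_ [a [b ->] <-]]; rewrite setTI; apply: sub_sigma_algebra.
by move/continuousP: ch; apply; exact: interval_open.
Qed.

Lemma int_lt1_eq0 (z : R) : `|z| < 1 -> z \is a Num.int -> z = 0.
Proof.
move=> z1 /intrP[i ei]; move: z1; rewrite ei -intr_norm (_ : 1 = 1%:~R)// ltr_int.
by case: i {ei} => [[|n]|n].
Qed.

Lemma to_torus_inj (x y : R) : 0 <= x < 1 -> 0 <= y < 1 -> to_torus x = to_torus y -> x = y.
Proof.
move=> /andP[x0 x1] /andP[y0 y1] /to_torus_eq h; apply/eqP; rewrite -subr_eq0.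
by apply/eqP/int_lt1_eq0 => //; rewrite ltr_norml; apply/andP; split; lra.
Qed.

Lemma dyadic_arc_preimage v :
  (@to_torus R) @^-1` @dyadic_arc R v `&` `[0, 1[ =
  `[dyadic_point R v, dyadic_end R v[%classic.
Proof.
have v0 := dyadic_point_ge0 R v; have v1 := dyadic_end_le1 R v.
apply/seteqP; split=> x /=.
- rewrite in_itv /= => -[[y /= + yx] /andP[x0 x1]]; rewrite -/(dyadic_end R v) !in_itv /= => /andP[y0 y1].
  rewrite (@to_torus_inj x y) ?y0//; first by rewrite x0.
  by rewrite (le_trans v0)// (lt_le_trans y1).
- rewrite in_itv /= => /andP[x0 x1]; split.
    by exists x => //=; rewrite in_itv /= x0.
  by rewrite in_itv /= (le_trans v0)// (lt_le_trans x1).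
Qed.

Lemma open_to_torus (A : set R) : open A -> open ((@to_torus R) @` A).
Proof.
move=> oA; rewrite /open /= /quotient_open.
rewrite (_ : _ @^-1` _ = \bigcup_(i in [set i : R | i \is a Num.int]) [set x | A (x + i)]).
  apply: bigcup_open => i _.
  have ci : continuous (fun x : R => x + i) by move=> x; apply: cvgD; [exact: cvg_id|exact: cvg_cst].
  by move/continuousP: ci => /(_ _ oA).
apply/seteqP; split=> x /=.
- move=> [y Ay] /to_torus_eq yx; exists (y - x) => //=.
  by rewrite addrC subrK.
- move=> [i /= ii Ax]; exists (x + i) => //; apply/to_torus_eq.
  by rewrite addrC addKr.
Qed.

Lemma to_torus_surj (p : torus R) : exists x : R, to_torus x = p.
Proof. by exists (repr p); rewrite /to_torus reprK. Qed.

Lemma to_torus_period (a : R) (p : torus R) : exists x, a <= x < a + 1 /\ to_torus x = p.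
Proof.
have [x <-] := to_torus_surj p; exists (x - (Num.floor (x - a))%:~R); split.
  have /andP[] := floor_itv (x - a); rewrite intrD => h1 h2; apply/andP; split; lra.
by apply/to_torus_eq; rewrite addrAC subrr add0r rpredN intr_int.
Qed.

(** The arc is its left end, a closed point, together with the image of an open interval; the
    complement of the point is the image of an open interval of length 1. *)
Lemma measurable_dyadic_arc v : measurable (@dyadic_arc R v).
Proof.
have lt_v := dyadic_lt R v; rewrite /dyadic_arc -/(dyadic_end R v).
set a := dyadic_point R v in lt_v *.
have -> : `[a, dyadic_end R v[%classic = [set a] `|` `]a, dyadic_end R v[.
  apply/seteqP; split=> x /=; rewrite !in_itv /=.
    by rewrite le_eqVlt => /andP[/orP[/eqP->|->]]; [left|right].
  by move=> [->|/andP[/ltW-> ->]]//; rewrite lexx.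
rewrite image_setU image_set1; apply: measurableU; last first.
  by apply: sub_sigma_algebra; apply: open_to_torus; exact: interval_open.
rewrite -[X in measurable X]setCK; apply: measurableC; apply: sub_sigma_algebra.
rewrite (_ : ~` _ = (@to_torus R) @` `]a, a + 1[).
  by apply: open_to_torus; exact: interval_open.
apply/seteqP; split=> p /=.
- move=> pa; have [x [/andP[ax xa] xp]] := to_torus_period a p.
  exists x => //=; rewrite in_itv /= xa andbT lt_neqAle ax andbT.
  by apply/eqP => xa'; apply: pa; rewrite -xp xa'.
- move=> [x]; rewrite /= in_itv /= => /andP[ax xa] <- /to_torus_eq h.
  have : x - a = 0 by apply: int_lt1_eq0 => //; rewrite ltr_norml; apply/andP; split; lra.
  by lra.
Qed.

Lemma integral_mrestr (D : set R) (mD : measurable D) (h : R -> \bar R) :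
  measurable_fun setT h -> (forall x, 0 <= h x)%E ->
  (\int[mrestr lebesgue_measure mD]_x h x = \int[lebesgue_measure]_(x in D) h x)%E.
Proof.
move=> mh h0.
pose mu : {measure set (measurableTypeR R) -> \bar R} := mrestr lebesgue_measure mD.
transitivity (\int[mu]_x h x)%E => //.
rewrite (@ge0_negligible_integral _ _ _ mu setT (~` D) h)//.
- rewrite setDE setCK setTI; apply: eq_measure_integral => A mA AD.
  by rewrite /mu /= /mrestr (setIidl AD).
- exact: measurableC.
- by rewrite /mu /= /mrestr setICl measure0.
Qed.

(** Provides a genuine measure, a sum of scaled push-forwards of restricted Lebesgue measures, to
    stand for a step of the cascade when integrals are computed. *)
Lemma step_measure (s : seq (seq bool)) (q : seq bool -> R) : (forall v, 0 <= q v) ->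
  exists M : {measure set (torus R) -> \bar R},
  (forall A, measurable A -> M A =
    \sum_(v <- s) (q v)%:E * lebesgue_measure (`[dyadic_point R v, dyadic_end R v[%classic `&` @to_torus R @^-1` A))%E /\
  (forall h : torus R -> \bar R, measurable_fun setT h -> (forall x, 0 <= h x)%E ->
    \int[M]_x h x =
    \sum_(v <- s) (q v)%:E * \int[lebesgue_measure]_(x in `[dyadic_point R v, dyadic_end R v[) h (to_torus x))%E.
Proof.
move=> q0; elim: s => [|v s [M [hM hI]]].
  exists mzero; split=> [A mA|h mh h0]; rewrite big_nil//; exact: integral_measure_zero.
pose Mv' : {measure set (torus R) -> \bar R} := measure_function_pushforward__canonical__measure_function_Measure (mrestr lebesgue_measure (measurable_itv `[dyadic_point R v, dyadic_end R v[)) measurable_to_torus.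
exists (measure_add (mscale (NngNum (q0 v)) Mv') M); split=> [A mA|h mh h0]; rewrite big_cons.
  by apply: etrans (measure_addE _ _ A) _; congr (_ + _)%E; [rewrite /mscale /= /pushforward /mrestr setIC|exact: hM].
rewrite ge0_integral_measure_add// ge0_integral_mscale// hI//; congr (_ * _ + _)%E.
rewrite ge0_integral_pushforward//; last exact: measurable_to_torus.
rewrite preimage_setT integral_mrestr//; last by move=> x; exact: h0.
by apply: measurableT_comp => //; exact: measurable_to_torus.
Qed.

End TorusMeasure.

Section CascadeIntegral.
Context d (T : measurableType d) (R : realType) (P : probability T R).
Variables (W : seq bool -> {RV P >-> R}) (t : T).
Let w v := W v t.
Hypothesis w0 : forall v, v != [::] -> 0 <= w v.

Lemma cascade_densityE n x : cascade_density W n t x =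
  \sum_(v <- words n) weight w v * \1_(dyadic_arc v) x.
Proof. by rewrite -sum_tuple_words. Qed.

Lemma weight_ge0 v : 0 <= weight w v.
Proof. by apply: prodr_ge0 => j _; apply: w0; case: v j => [[]|]. Qed.

Lemma cascade_stepE n A : measurable A -> cascade_step W n t A =
  (\sum_(v <- words n) (weight w v)%:E * lebesgue_measure (`[dyadic_point R v, dyadic_end R v[%classic `&` @to_torus R @^-1` A))%E.
Proof.
move=> mA; pose Tl : {measure set (torus R) -> \bar R} := measure_function_pushforward__canonical__measure_function_Measure (mrestr lebesgue_measure (measurable_itv `[0, 1[)) (@measurable_to_torus R).
transitivity (\int[Tl]_(x in A) (\sum_(v <- words n) (weight w v)%:E * (\1_(dyadic_arc v) x)%:E))%E.
  apply: (@eq_integral _ _ _ Tl) => x _; rewrite cascade_densityE -sumEFin.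
  by apply: eq_bigr => v _; rewrite EFinM.
have mi v : measurable_fun A (fun x => (\1_(dyadic_arc v) x)%:E : \bar R).
  by apply/measurable_EFinP; apply: measurable_indic; exact: measurable_dyadic_arc.
rewrite ge0_integral_sum//; last 2 first.
- by move=> v; apply: measurable_funeM.
- by move=> v x _; rewrite mule_ge0// lee_fin ?weight_ge0.
apply: eq_bigr => v _; rewrite ge0_integralZl_EFin ?weight_ge0//.
rewrite integral_indic//; last exact: measurable_dyadic_arc.
rewrite /Tl /= /pushforward /mrestr -dyadic_arc_preimage preimage_setI.
by congr (_ * lebesgue_measure _)%E; rewrite setIAC.
Qed.

Lemma cascade_step_integral n (f : torus R -> R) (F : R -> R) : continuous f ->
  (forall x : R, is_derive x 1 F (f (to_torus x))) ->
  (\int[cascade_step W n t]_x (f x)%:E = (cascade_integral w n F)%:E)%E.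
Proof.
move=> cf dF.
have [M [hM hI]] := step_measure (words n) weight_ge0.
rewrite (@eq_setfun_integral _ _ _ _ M); last first.
  by move=> A mA; rewrite cascade_stepE// -hM.
have cfp : continuous (f \o @to_torus R).
  by move=> x; apply: continuous_comp; [exact: continuous_to_torus|exact: cf].
have mf := measurable_continuous_torus cf.
have fi v : lebesgue_measure.-integrable `[dyadic_point R v, dyadic_end R v] (EFin \o (f \o @to_torus R)).
  by apply: continuous_compact_integrable; [exact: segment_compact|exact: continuous_subspaceT].
have fi' v : lebesgue_measure.-integrable `[dyadic_point R v, dyadic_end R v[ (EFin \o (f \o @to_torus R)).
  apply: integrableS (fi v) => //; apply: subset_itvScc; rewrite bnd_simp//.
rewrite integralE !hI//; last 2 first.
- by apply: measurable_funeneg; exact/measurable_EFinP.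
- by apply: measurable_funepos; exact/measurable_EFinP.
have mitv v : measurable (`[dyadic_point R v, dyadic_end R v[%classic : set (measurableTypeR R)) by exact: measurable_itv.
have ftc v : (\int[lebesgue_measure]_(x in `[dyadic_point R v, dyadic_end R v[) (f (to_torus x))%:E =
    (F (dyadic_end R v) - F (dyadic_point R v))%:E)%E.
  rewrite integral_itv_bndo_bndc; last first.
    by apply/measurable_EFinP; apply: measurable_funTS; exact: continuous_measurable_fun.
  rewrite (continuous_FTC2 (F := F) (dyadic_lt R v)) ?EFinB//.
  - exact: continuous_subspaceT.
  - split=> [x _| |].
    + exact: ex_derive.
    + apply: cvg_at_right_filter; apply: differentiable_continuous; apply/derivable1_diffP; exact: ex_derive.
    + apply: cvg_at_left_filter; apply: differentiable_continuous; apply/derivable1_diffP; exact: ex_derive.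
  - by move=> x _; rewrite derive1E derive_val.
pose leb : {measure set (measurableTypeR R) -> \bar R} := lebesgue_measure.
pose p v := fine (\int[leb]_(x in `[dyadic_point R v, dyadic_end R v[) ((EFin \o (f \o @to_torus R))^\+ x))%E.
pose n' v := fine (\int[leb]_(x in `[dyadic_point R v, dyadic_end R v[) ((EFin \o (f \o @to_torus R))^\- x))%E.
have pE v : (\int[lebesgue_measure]_(x in `[dyadic_point R v, dyadic_end R v[) ((fun y => (f y)%:E)^\+ (to_torus x)) = (p v)%:E)%E.
  rewrite fineK; last exact: (integrable_fin_num (mitv v) (integrable_funepos (mitv v) (fi' v))).
  by apply: (@eq_integral _ _ _ leb) => x _; rewrite !funeposE.
have nE v : (\int[lebesgue_measure]_(x in `[dyadic_point R v, dyadic_end R v[) ((fun y => (f y)%:E)^\- (to_torus x)) = (n' v)%:E)%E.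
  rewrite fineK; last exact: (integrable_fin_num (mitv v) (integrable_funeneg (mitv v) (fi' v))).
  by apply: (@eq_integral _ _ _ leb) => x _; rewrite !funenegE.
have pn v : p v - n' v = F (dyadic_end R v) - F (dyadic_point R v).
  apply: EFin_inj; rewrite -ftc EFinB !fineK.
  - by apply/esym; apply: etrans (@integralE _ _ _ leb _ _) _.
  - exact: (integrable_fin_num (mitv v) (integrable_funeneg (mitv v) (fi' v))).
  - exact: (integrable_fin_num (mitv v) (integrable_funepos (mitv v) (fi' v))).
under eq_bigr do rewrite pE -EFinM.
under [X in (_ - X)%E]eq_bigr do rewrite nE -EFinM.
rewrite !sumEFin -EFinB -sumrB /cascade_integral; congr (_%:E); apply: eq_bigr => v _.
by rewrite -mulrBr pn /osc /mass; field; rewrite expf_neq0.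
Qed.

End CascadeIntegral.

Lemma sum_words_cat_le (R : realType) v j (G : seq bool -> R) : (forall u, 0 <= G u) ->
  \sum_(u <- words j) G (v ++ u) <= \sum_(u <- words (size v + j)) G u.
Proof.
elim: v G => [//|b v IH] G G0.
rewrite [size _]/= addSn sum_words_cons; apply: le_trans (IH (fun u => G (b :: u)) _) _ => //.
have s0 c : 0 <= \sum_(u <- words (size v + j)) G (c :: u) by exact: sumr_ge0.
by case: b; rewrite ?lerDl ?lerDr.
Qed.

Section TorusIntegral.
Variables (R : realType) (m : {measure set (torus R) -> \bar R}).
Hypothesis mfin : (m [set: torus R] < +oo)%E.
Implicit Type f : torus R -> R.

Lemma continuous_comp_to_torus f : continuous f -> continuous (f \o @to_torus R).
Proof. by move=> cf x; apply: continuous_comp; [exact: continuous_to_torus|exact: cf]. Qed.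

Lemma torus_bounded f : continuous f -> exists2 C : R, 0 < C & forall p, `|f p| <= C.
Proof.
move=> cf; have [C C0 hC] := continuous_bounded (continuous_comp_to_torus cf).
exists C => // p; have [x [/andP[x0 x1] <-]] := to_torus_period 0 p.
by apply: hC; rewrite x0 ltW//; move: x1; rewrite add0r.
Qed.

Lemma integrable_torus f : continuous f -> m.-integrable setT (EFin \o f).
Proof.
move=> cf; have [C C0 hC] := torus_bounded cf.
apply: measurable_bounded_integrable => //; first exact: measurable_continuous_torus.
exists C; split; first exact: num_real.
by move=> M CM p _; apply: le_trans (hC p) (ltW CM).
Qed.

Lemma Rintegral_torusE f : continuous f ->
  (\int[m]_p (f p)%:E = (\int[m]_p f p)%:E)%E.
Proof.
by move=> cf; rewrite /Rintegral fineK//; apply: integrable_fin_num => //; exact: integrable_torus.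
Qed.

Lemma continuous_sum (T' : topologicalType) (I : eqType) (s : seq I) (f : I -> T' -> R) :
  (forall i, continuous (f i)) -> continuous (fun p => \sum_(i <- s) f i p).
Proof.
move=> cf p; elim: s => [|i s IH].
  under eq_fun do rewrite big_nil; exact: cst_continuous.
by under eq_fun do rewrite big_cons; apply: (@continuousD _ _ _ (f i)); [exact: cf|exact: IH].
Qed.

Lemma Rintegral_torus_sum (I : eqType) (s : seq I) (f : I -> torus R -> R) :
  (forall i, continuous (f i)) ->
  \int[m]_p (\sum_(i <- s) f i p) = \sum_(i <- s) \int[m]_p f i p.
Proof.
move=> cf; elim: s => [|i s IH].
  under eq_Rintegral do rewrite big_nil; rewrite big_nil /Rintegral.
  by rewrite integral0.
under eq_Rintegral do rewrite big_cons.
rewrite big_cons RintegralD//; last 2 first.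
- exact: integrable_torus.
- by apply: (@integrable_torus (fun p => \sum_(j <- s) f j p)); exact: continuous_sum.
by rewrite IH.
Qed.

Lemma le_Rintegral_torus_norm f (C : R) : continuous f -> (forall p, `|f p| <= C) ->
  `|\int[m]_p f p| <= C * fine (m setT).
Proof.
move=> cf fC.
have cn : continuous (fun p => `|f p|).
  by move=> p; apply: continuous_comp; [exact: cf|exact: norm_continuous].
have cC : continuous (fun _ : torus R => C) by exact: cst_continuous.
apply: (@le_trans _ _ (\int[m]_p `|f p|)).
  by apply: le_normr_Rintegral => //; exact: integrable_torus.
apply: (@le_trans _ _ (\int[m]_p C)).
  by apply: le_Rintegral => //; exact: integrable_torus.
by rewrite Rintegral_cst.
Qed.

Variable w : seq bool -> R.
Hypothesis cvg_w : forall f (F : R -> R), continuous f ->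
  (forall x : R, is_derive x 1 F (f (to_torus x))) ->
  cascade_integral w n F @[n --> \oo] --> \int[m]_p f p.

Lemma total_mass_cvg_torus : total_mass w n @[n --> \oo] --> fine (m setT).
Proof.
have c1 : continuous (fun _ : torus R => 1 : R) by exact: cst_continuous.
have h := cvg_w c1 (fun x => is_derive_id x 1); move: h; rewrite Rintegral_cst// mul1r.
rewrite (_ : (fun n => cascade_integral w n id) = total_mass w) //.
apply/funext => n; rewrite /total_mass /cascade_integral; apply: eq_bigr => v _.
by rewrite /osc /dyadic_end addrAC subrr add0r mulfV ?mul1r// expf_neq0.
Qed.

Lemma limit_mass_torus : limit_mass w = fine (m setT).
Proof.
apply: (cvg_unique _ (limit_mass_cvg _) total_mass_cvg_torus) => //.
by apply/cvg_ex; eexists; exact: total_mass_cvg_torus.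
Qed.

Hypothesis w0 : forall v, v != [::] -> 0 <= w v.

Lemma mass_ge0_nonempty v : 0 <= mass w v.
Proof.
apply: divr_ge0 => //; apply: prodr_ge0 => j _; apply: w0.
by case: v j => [[]|].
Qed.

(** In the cascade integrals only the descendants of [v] are kept; there the mean of [f] is at least
    [k]. The limit over generations gives the mass of the arc. *)
Lemma Rintegral_torus_ge f v (k : R) : continuous f -> (forall p, 0 <= f p) -> 0 <= k ->
  (forall t, dyadic_point R v <= t <= dyadic_end R v -> k <= f (to_torus t)) ->
  cvgn (total_mass (subtree w v)) ->
  k * (mass w v * limit_mass (subtree w v)) <= \int[m]_p f p.
Proof.
move=> cf f0 k0 fk cv.
have [F dF] := antiderivative (continuous_comp_to_torus cf).
have osc_ge (u : seq bool) (c : R) :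
    (forall t, dyadic_point R u <= t <= dyadic_end R u -> c <= f (to_torus t)) -> c <= osc F u.
  move=> fc; have ul := dyadic_lt R u.
  have h := @MVT_segment R F (f \o @to_torus R) _ _ (ltW ul)
    (fun x _ => dF x) (is_derive_within_continuous (fun x _ => dF x)).
  have [x xu e] := h; rewrite /osc e /dyadic_end addrAC subrr add0r mulrCA divff ?mulr1 ?expf_neq0//.
  by apply: fc; move: xu; rewrite in_itv.
have lower j : k * (mass w v * total_mass (subtree w v) j) <= cascade_integral w (size v + j) F.
  rewrite /cascade_integral.
  apply: le_trans (sum_words_cat_le v j _); last first.
    by move=> u; apply: mulr_ge0; [apply: osc_ge|exact: mass_ge0_nonempty].
  rewrite /total_mass !mulr_sumr; apply: ler_sum => u _.
  rewrite mass_cat ler_wpM2r//.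
    by rewrite -mass_cat; exact: mass_ge0_nonempty.
  apply: osc_ge => t /andP[t1 t2]; apply: fk.
  by have [n1 n2] := dyadic_nested R v u; rewrite (le_trans n1)//= (le_trans t2).
have l1 : (fun j => k * (mass w v * total_mass (subtree w v) j)) @ \oo --> k * (mass w v * limit_mass (subtree w v)).
  by apply: cvgMl_tmp; apply: cvgMl_tmp; exact: limit_mass_cvg.
have l2 : (fun j => cascade_integral w (size v + j) F) @ \oo --> \int[m]_p f p.
  have := cvg_w cf dF; rewrite -(cvg_shiftn (size v)).
  by under eq_fun do rewrite /= addnC.
by apply: (ler_cvg_to l1 l2); apply: nearW.
Qed.

End TorusIntegral.

(** * Fourier decay controls the mass of arcs *)

(** Each distance occurs for at most [2 N] pairs. *)
Lemma double_sum_dist (R : realType) (G : nat -> R) N : (forall l, 0 <= G l) ->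
  \sum_(0 <= j < N) \sum_(0 <= k < N) G ((j - k) + (k - j))%N <=
  2 * N%:R * \sum_(0 <= l < N) G l.
Proof.
move=> G0; elim: N => [|N IH]; first by rewrite !big_geq// mulr0.
have tail : \sum_(0 <= j < N) G (N - j)%N = \sum_(0 <= l < N) G l.+1.
  rewrite big_nat_rev /=; apply: eq_big_nat => i /andP[_ iN].
  by congr G; lia.
have TS : \sum_(0 <= l < N.+1) G l = G 0%N + \sum_(0 <= l < N) G l.+1.
  by rewrite big_nat_recl.
have TN : \sum_(0 <= l < N.+1) G l = \sum_(0 <= l < N) G l + G N by rewrite big_nat_recr.
rewrite big_nat_recr //=.
rewrite (_ : \sum_(0 <= k < N.+1) G (N - k + (k - N))%N = \sum_(0 <= l < N.+1) G l); last first.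
  rewrite big_nat_recr //= subnn TS addrC -tail; congr (_ + _).
  by apply: eq_big_nat => i /andP[_ iN]; congr G; lia.
rewrite (_ : \sum_(0 <= j < N) \sum_(0 <= k < N.+1) G (j - k + (k - j))%N =
  \sum_(0 <= j < N) \sum_(0 <= k < N) G (j - k + (k - j))%N + \sum_(0 <= l < N) G l.+1); last first.
  rewrite -tail -big_split /=; apply: eq_big_nat => j /andP[_ jN].
  by rewrite big_nat_recr //=; congr (_ + G _); lia.
have T0 : 0 <= \sum_(0 <= l < N) G l by exact: sumr_ge0.
have GN := G0 N; have G00 := G0 0%N.
have mono : 2 * N%:R * \sum_(0 <= l < N) G l <= 2 * N%:R * \sum_(0 <= l < N.+1) G l.
  by rewrite ler_wpM2l ?mulr_ge0// TN lerDl.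
rewrite -[N.+1%:R]natr1 mulrDr mulrDl mulr1; move: IH mono G00; rewrite TS; lra.
Qed.

(** The dyadic block from [2^k] to [2^(k+1)] contributes at most [2^(k (1 - th))], a geometric
    sequence of ratio [r > 1] as [th < 1]. The constant satisfies [C (r - 1) = r >= 1], which closes
    the induction. *)
Lemma power_sum_le (R : realType) (th : R) : 0 <= th < 1 ->
  exists2 C : R, 0 <= C & forall k,
    \sum_(0 <= l < 2 ^ k) l.+1%:R `^ (- th) <= C * pow2 (k%:R * (1 - th)).
Proof.
move=> /andP[th0 th1]; pose r : R := pow2 (1 - th).
have r1 : 1 < r by rewrite -[ltLHS](pow2_0 R) ltr_pow2 subr_gt0.
have rr : 0 < r - 1 by rewrite subr_gt0.
have C1 : 0 <= 1 + (r - 1)^-1 by rewrite addr_ge0// invr_ge0 ltW.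
exists (1 + (r - 1)^-1) => //; elim=> [|k IH].
  by rewrite expn0 big_nat1 powR1 mul0r pow2_0 mulr1 lerDl invr_ge0 ltW.
have k2 : (2 ^ k <= 2 ^ k.+1)%N by rewrite leq_exp2l.
rewrite (big_cat_nat (n := (2 ^ k)%N)) //=.
have step : \sum_(2 ^ k <= l < 2 ^ k.+1) l.+1%:R `^ (- th) <= pow2 (k%:R * (1 - th)).
  apply: (@le_trans _ _ (\sum_(2 ^ k <= l < 2 ^ k.+1) (pow2 (- (k%:R * th)) : R))).
    apply: ler_sum_nat => l /andP[kl _].
    rewrite powRN pow2N lef_pV2 ?posrE ?powR_gt0 ?pow2_gt0//.
    rewrite pow2M pow2_nat; apply: ge0_ler_powR => //; rewrite ?nnegrE ?exprn_ge0//.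
    by rewrite -natrX ler_nat; apply: leq_trans kl _.
  rewrite sumr_const_nat expnS mul2n -addnn addnK -[_ *+ _]mulr_natl natrX -pow2_nat -pow2D.
  by rewrite ler_pow2 mulrBr mulr1.
apply: le_trans (lerD IH step) _.
have -> : k.+1%:R * (1 - th) = k%:R * (1 - th) + (1 - th) by rewrite -[k.+1%:R]natr1; ring.
rewrite pow2D -/r.
rewrite (_ : (1 + (r - 1)^-1) * (pow2 (k%:R * (1 - th)) * r) =
  (1 + (r - 1)^-1) * pow2 (k%:R * (1 - th)) + (1 + (r - 1)^-1) * (r - 1) * pow2 (k%:R * (1 - th))); last by ring.
rewrite lerD2l ler_peMl ?pow2_ge0// mulrDl mul1r mulVf ?gt_eqF//.
by rewrite lerDr ltW.
Qed.

Lemma cos_ge_half (R : realType) (x : R) : `|x| <= 1 / 2 -> 1 / 2 <= cos x.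
Proof.
move=> x2; have -> : cos x = cos `|x| by case: ger0P => // _; rewrite cosN.
have := @mean_value_le R cos (fun y => - sin y) 0 `|x| 1 (normr_ge0 x) (fun t _ => is_derive_cos t).
rewrite subr0 mul1r cos0 => /(_ (fun t _ => _)) h.
have : `|cos `|x| - 1| <= `|x| by apply: h => t; rewrite normrN sin_max.
by rewrite ler_norml => /andP[h1 _]; lra.
Qed.

Section Fejer.
Variables (R : realType) (m : {measure set (torus R) -> \bar R}) (w : seq bool -> R).
Hypothesis mfin : (m [set: torus R] < +oo)%E.
Hypothesis cvg_w : forall (f : torus R -> R) (F : R -> R), continuous f ->
  (forall x : R, is_derive x 1 F (f (to_torus x))) ->
  cascade_integral w n F @[n --> \oo] --> \int[m]_p f p.
Hypothesis w0 : forall v, v != [::] -> 0 <= w v.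
Variable gamma : torus R -> R * R.
Hypothesis cgamma : continuous gamma.

Definition wave (xi : R * R) (ph : R) (p : torus R) : R := cos (2 * pi * dot (gamma p) xi + ph).

Lemma continuous_dot xi : continuous (fun p => dot (gamma p) xi).
Proof.
have c1 : continuous (fun p => (gamma p).1).
  by move=> p; apply: continuous_comp; [exact: cgamma|exact: cvg_fst].
have c2 : continuous (fun p => (gamma p).2).
  by move=> p; apply: continuous_comp; [exact: cgamma|exact: cvg_snd].
move=> p; apply: (@continuousD _ _ _ (fun p => (gamma p).1 * xi.1)).
- by apply: (@continuousM _ _ (fun p => (gamma p).1) (cst xi.1)); [exact: c1|exact: cst_continuous].
- by apply: (@continuousM _ _ (fun p => (gamma p).2) (cst xi.2)); [exact: c2|exact: cst_continuous].
Qed.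

Lemma continuous_wave xi ph : continuous (wave xi ph).
Proof.
move=> p; apply: (@continuous_comp _ _ _ (fun p => 2 * pi * dot (gamma p) xi + ph) cos); last exact: continuous_cos.
apply: (@continuousD _ _ _ (fun p => 2 * pi * dot (gamma p) xi) (cst ph)); last exact: cst_continuous.
by apply: (@continuousM _ _ (cst (2 * pi)) (fun p => dot (gamma p) xi)); [exact: cst_continuous|exact: continuous_dot].
Qed.

Variables x1 x2 y1 y2 z1 z2 : R -> R.
Hypothesis gammaE : forall t, gamma (to_torus t) = (x1 t, x2 t).
Hypothesis dx1 : forall t : R, is_derive t 1 x1 (y1 t).
Hypothesis dx2 : forall t : R, is_derive t 1 x2 (y2 t).
Hypothesis dy1 : forall t : R, is_derive t 1 y1 (z1 t).
Hypothesis dy2 : forall t : R, is_derive t 1 y2 (z2 t).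
Variables B D sg : R.
Hypothesis B0 : 0 < B.
Hypothesis zB : forall t : R, 0 <= t <= 1 -> `|z1 t| <= B /\ `|z2 t| <= B.
Hypothesis speed0 : forall t : R, 0 < euclidean_norm (y1 t, y2 t).
Hypothesis D0 : 0 <= D.
Hypotheses (sg0 : 0 < sg) (sg2 : sg < 2).
Hypothesis decay : forall xi ph, 0 < euclidean_norm xi ->
  `|\int[m]_p wave xi ph p| <= D * euclidean_norm xi `^ (- (sg / 2)).

(** The unit of frequency: with displacement at most [2 * B * h^2] and [N h^2 <= 1], all phases
    [N * 2 pi * beta * (2 B h^2)] are at most [1 / 2]. *)
Let beta : R := (8 * pi * B)^-1.

Let beta0 : 0 < beta.
Proof. by rewrite invr_gt0 !mulr_gt0// pi_gt0. Qed.

(* The frequencies are multiples of the normal at the left end [a] of the arc, so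
   that by Taylor the phases vary only by [O(N h^2)] on an arc of length [h]. *)
Lemma exists_normal (t : R) : exists n1 n2 : R,
  n1 ^+ 2 + n2 ^+ 2 = 1 /\ y1 t * n1 + y2 t * n2 = 0.
Proof.
set s := euclidean_norm (y1 t, y2 t); have s0 : 0 < s by exact: speed0.
have sE : s ^+ 2 = y1 t ^+ 2 + y2 t ^+ 2.
  by rewrite /s /euclidean_norm sqr_sqrtr// addr_ge0 ?sqr_ge0.
exists (- y2 t / s), (y1 t / s); split.
  rewrite !expr_div_n -mulrDl sqrrN addrC -sE divff// expf_neq0// gt_eqF//.
by field; rewrite gt_eqF.
Qed.

Section Normal.
Variables a n1 n2 : R.
Hypothesis n_unit : n1 ^+ 2 + n2 ^+ 2 = 1.
Hypothesis normal : y1 a * n1 + y2 a * n2 = 0.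

Let n_le1 : `|n1| <= 1 /\ `|n2| <= 1.
Proof.
have s1 := sqr_ge0 n1; have s2 := sqr_ge0 n2.
by split; rewrite -(@ler_sqr _ _ 1) ?nnegrE// -normrX ger0_norm ?sqr_ge0// expr1n; move: n_unit; lra.
Qed.

Let psi u := x1 u * n1 + x2 u * n2 - (x1 a * n1 + x2 a * n2).
Let psi' u := y1 u * n1 + y2 u * n2.
Let psi'' u := z1 u * n1 + z2 u * n2.

Let dpsi (u : R) : is_derive u 1 psi (psi' u).
Proof.
have d1 := dx1 u; have d2 := dx2 u; apply: is_derive_eq.
by rewrite /psi' /GRing.scale /=; ring.
Qed.

Let dpsi' (u : R) : is_derive u 1 psi' (psi'' u).
Proof.
have d1 := dy1 u; have d2 := dy2 u; apply: is_derive_eq.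
by rewrite /psi'' /GRing.scale /=; ring.
Qed.

Let psi''B u : 0 <= u <= 1 -> `|psi'' u| <= 2 * B.
Proof.
move=> u01; have [b1 b2] := zB u01; have [l1 l2] := n_le1.
apply: le_trans (ler_normD _ _) _; rewrite !normrM.
have k1 : `|z1 u| * `|n1| <= B * 1 by exact: ler_pM.
have k2 : `|z2 u| * `|n2| <= B * 1 by exact: ler_pM.
by apply: le_trans (lerD k1 k2) _; lra.
Qed.

Lemma normal_displacement_le (h t : R) : 0 <= a -> a + h <= 1 -> a <= t <= a + h ->
  `|psi t| <= 2 * B * h ^+ 2.
Proof.
move=> a0 ah /andP[at_ th].
have h0 : 0 <= h by lra.
have psi'B u : a <= u <= t -> `|psi' u| <= 2 * B * h.
  move=> /andP[au ut]; rewrite -[psi' u]subr0 -normal -/(psi' a).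
  apply: (@le_trans _ _ (2 * B * (u - a))).
    apply: (mean_value_le (f := psi') (f' := psi'') au) => r; rewrite in_itv /= => /andP[ar ru]; first exact: dpsi'.
    by apply: psi''B; apply/andP; split; lra.
  by rewrite ler_wpM2l ?mulr_ge0 ?(ltW B0)//; lra.
have -> : psi t = psi t - psi a by rewrite /psi; ring.
rewrite expr2 mulrA; apply: (@le_trans _ _ (2 * B * h * (t - a))).
  apply: (mean_value_le (f := psi) (f' := psi') at_) => r; rewrite in_itv /= => /andP[ar rt]; first exact: dpsi.
  by apply: psi'B; rewrite ar.
by rewrite ler_wpM2l ?mulr_ge0 ?(ltW B0)//; lra.
Qed.

Let height p : R := dot (gamma p) (n1, n2) - dot (x1 a, x2 a) (n1, n2).

Let height_le (h t : R) : 0 <= a -> a + h <= 1 -> a <= t <= a + h ->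
  `|height (to_torus t)| <= 2 * B * h ^+ 2.
Proof. by rewrite /height gammaE; exact: normal_displacement_le. Qed.

(** The squared modulus of a sum of [N] exponentials, divided by [N^2]; the double sum displays it
    as a combination of waves, to which the decay applies term by term. *)
Definition fejer_kernel (N : nat) p : R := (N%:R ^+ 2)^-1 *
  \sum_(0 <= j < N) \sum_(0 <= k < N) cos ((j%:R - k%:R) * (2 * pi * beta * height p)).

Let kernel_sqr N p : fejer_kernel N p = (N%:R ^+ 2)^-1 *
  ((\sum_(0 <= j < N) cos (j%:R * (2 * pi * beta * height p))) ^+ 2 +
   (\sum_(0 <= j < N) sin (j%:R * (2 * pi * beta * height p))) ^+ 2).
Proof.
rewrite /fejer_kernel; congr (_ * _); rewrite !expr2 !mulr_suml -big_split /=.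
apply: eq_bigr => j _; rewrite !mulr_sumr -big_split /=.
by apply: eq_bigr => k _; rewrite mulrBl cosB.
Qed.

Lemma fejer_kernel_ge0 N p : 0 <= fejer_kernel N p.
Proof. by rewrite kernel_sqr mulr_ge0 ?invr_ge0 ?exprn_ge0 ?addr_ge0 ?sqr_ge0. Qed.

(** All [N] phases are at most [1 / 2] in absolute value, so the sum of cosines is at least [N / 2];
    its square over [N^2] is the constant. *)
Lemma fejer_kernel_ge (N : nat) (h t : R) : (0 < N)%N -> N%:R * h ^+ 2 <= 1 ->
  0 <= a -> a + h <= 1 -> a <= t <= a + h -> 1 / 4 <= fejer_kernel N (to_torus t).
Proof.
move=> N0 Nh a0 ah at_; rewrite kernel_sqr.
set th := 2 * pi * beta * height (to_torus t).
have N0' : 0 < N%:R :> R by rewrite ltr0n.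
have th_le : N%:R * `|th| <= 1 / 2.
  rewrite /th normrM ger0_norm; last by rewrite !mulr_ge0 ?pi_ge0// ltW.
  apply: (@le_trans _ _ (N%:R * (2 * pi * beta * (2 * B * h ^+ 2)))).
    rewrite ler_wpM2l// ler_wpM2l ?height_le//.
    by rewrite !mulr_ge0 ?pi_ge0// ltW.
  rewrite [leLHS](_ : _ = (N%:R * h ^+ 2) / 2); first by rewrite ler_pM2r ?invr_gt0.
  have be : beta * (8 * pi * B) = 1 by rewrite /beta mulVf// gt_eqF// !mulr_gt0 ?pi_gt0.
  have -> : N%:R * h ^+ 2 / 2 = N%:R * h ^+ 2 * (beta * (8 * pi * B)) / 2 by rewrite be mulr1.
  by move: (beta) => b; field.
have cos_ge : N%:R / 2 <= \sum_(0 <= j < N) cos (j%:R * th).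
  apply: (@le_trans _ _ (\sum_(0 <= j < N) (1 / 2 : R))).
    rewrite sumr_const_nat subn0 -[X in _ <= X]mulr_natl; lra.
  apply: ler_sum_nat => j /andP[_ jN]; apply: cos_ge_half.
  rewrite normrM normr_nat; apply: le_trans th_le; rewrite ler_wpM2r// ler_nat.
  exact: ltnW.
rewrite ler_pdivlMl ?exprn_gt0//.
apply: (@le_trans _ _ ((N%:R / 2) ^+ 2)).
  by rewrite expr_div_n (_ : 2 ^+ 2 = 4)//; [rewrite mul1r|ring].
apply: (@le_trans _ _ ((\sum_(0 <= j < N) cos (j%:R * th)) ^+ 2)); last by rewrite lerDl sqr_ge0.
by rewrite lerXn2r ?nnegrE ?divr_ge0//; exact: le_trans cos_ge; rewrite divr_ge0.
Qed.

End Normal.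

Let th := sg / 2.
Let A0 := fine (m setT).

Let A0_ge0 : 0 <= A0. Proof. by rewrite fine_ge0. Qed.

(** Shifted by one so that [l = 0] is included, where only the total mass [A0] is available;
    [l >= (l + 1) / 2] for positive [l] accounts for [beta / 2]. *)
Let G (l : nat) : R := (A0 + D * (beta / 2) `^ (- th)) * l.+1%:R `^ (- th).

Let th_itv : 0 <= th < 1. Proof. by rewrite /th; apply/andP; split; move: sg0 sg2; lra. Qed.

Let G0 l : 0 <= G l.
Proof. by rewrite mulr_ge0 ?powR_ge0// addr_ge0// mulr_ge0 ?powR_ge0. Qed.

Let wave_le (n1 n2 ph : R) (j k : nat) : n1 ^+ 2 + n2 ^+ 2 = 1 ->
  `|\int[m]_p wave ((j%:R - k%:R) * beta * n1, (j%:R - k%:R) * beta * n2) ph p| <=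
  G ((j - k) + (k - j))%N.
Proof.
move=> n_unit; set l := (_ + _)%N.
have jkl : `|j%:R - k%:R| = l%:R :> R.
  rewrite /l; case: (leqP k j) => [kj|/ltnW jk].
    by rewrite -natrB// normr_nat (eqP (_ : k - j == 0)%N) ?addn0// subn_eq0.
  by rewrite distrC -natrB// normr_nat (eqP (_ : j - k == 0)%N) ?add0n// subn_eq0.
have xiE : euclidean_norm ((j%:R - k%:R) * beta * n1, (j%:R - k%:R) * beta * n2) = l%:R * beta.
  rewrite /euclidean_norm [X in Num.sqrt X](_ : _ = ((j%:R - k%:R) * beta) ^+ 2 * (n1 ^+ 2 + n2 ^+ 2)); last first.
    by rewrite [LHS]/=; ring.
  by rewrite n_unit mulr1 sqrtr_sqr normrM jkl ger0_norm// ltW.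
case: l jkl xiE => [|l] jkl xiE.
  apply: (@le_trans _ _ (1 * A0)).
    apply: (le_Rintegral_torus_norm mfin); first exact: continuous_wave.
    by move=> p; exact: cos_max.
  by rewrite mul1r /G powR1 mulr1 lerDl mulr_ge0 ?powR_ge0.
apply: le_trans (decay _ _) _; first by rewrite xiE mulr_gt0.
rewrite xiE /G mulrDl; apply: (@le_trans _ _ (D * (beta / 2) `^ (- th) * l.+2%:R `^ (- th))); last first.
  by rewrite lerDr mulr_ge0 ?powR_ge0.
rewrite -mulrA ler_wpM2l// -powRM//; last by rewrite divr_ge0// ltW.
rewrite !powRN lef_pV2 ?posrE ?powR_gt0 ?mulr_gt0 ?divr_gt0//.
apply: ge0_ler_powR; rewrite ?nnegrE ?mulr_ge0 ?divr_ge0 ?(ltW beta0)//.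
  exact: ltW.
rewrite (_ : l.+1%:R * beta = beta / 2 * (2 * l.+1%:R)); last by move: (beta) => b; field.
rewrite ler_wpM2l ?divr_ge0 ?(ltW beta0)//.
by rewrite -natrM ler_nat; lia.
Qed.

(** With [N = 4^(size v)] and arc length [2^-(size v)] one has [N h^2 = 1], so the kernel is at
    least [1 / 4] on the arc. Its integral is at most of order [N^(- sg / 2)], that is
    [2^(- sg (size v))]; [sg < 2] keeps the power sum in its growing range. *)
Lemma score_le_of_decay : exists C : R, forall v, cvgn (total_mass (subtree w v)) ->
  pow2 (sg * (size v)%:R) * (mass w v * limit_mass (subtree w v)) <= C.
Proof.
have [C0 C00 hC0] := power_sum_le th_itv.
exists (8 * (A0 + D * (beta / 2) `^ (- th)) * C0) => v cv.
set mv := size v; pose N := (2 ^ (mv + mv))%N.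
have N0 : (0 < N)%N by rewrite expn_gt0.
have N0' : 0 < N%:R :> R by rewrite ltr0n.
set a := dyadic_point R v.
have [n1 [n2 [n_unit normal]]] := exists_normal a.
pose ph (j k : nat) : R := - ((j%:R - k%:R) * (2 * pi * beta * dot (x1 a, x2 a) (n1, n2))).
have kernel_wave p : fejer_kernel a n1 n2 N p = (N%:R ^+ 2)^-1 *
    \sum_(0 <= j < N) \sum_(0 <= k < N)
    wave ((j%:R - k%:R) * beta * n1, (j%:R - k%:R) * beta * n2) (ph j k) p.
  rewrite /fejer_kernel; congr (_ * _); apply: eq_bigr => j _; apply: eq_bigr => k _.
  by rewrite /wave /ph /dot /=; congr cos; ring.
have cw j k : continuous (wave ((j%:R - k%:R) * beta * n1, (j%:R - k%:R) * beta * n2) (ph j k)).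
  exact: continuous_wave.
have ck : continuous (fejer_kernel a n1 n2 N).
  rewrite (funext kernel_wave) => p.
  apply: (@continuousM _ _ (cst ((N%:R ^+ 2)^-1)) (fun p => \sum_(0 <= j < N) \sum_(0 <= k < N) wave ((j%:R - k%:R) * beta * n1, (j%:R - k%:R) * beta * n2) (ph j k) p)).
    exact: cst_continuous.
  by apply: continuous_sum => j; apply: continuous_sum => k; exact: cw.
have lower : 1 / 4 * (mass w v * limit_mass (subtree w v)) <= \int[m]_p fejer_kernel a n1 n2 N p.
  apply: (Rintegral_torus_ge cvg_w w0) => //.
  - move=> p; exact: fejer_kernel_ge0.
  - by move=> t at_; apply: (@fejer_kernel_ge a n1 n2 n_unit normal N ((2 ^+ mv)^-1)) => //;
      [rewrite /N natrX exprD -expr2 exprVn mulfV// expf_neq0// expf_neq0|exact: dyadic_point_ge0|exact: dyadic_end_le1].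
have upper : \int[m]_p fejer_kernel a n1 n2 N p <=
    (N%:R ^+ 2)^-1 * (2 * N%:R * \sum_(0 <= l < N) G l).
  under eq_Rintegral do rewrite kernel_wave.
  rewrite RintegralZl//; last first.
    apply: (integrable_torus mfin (f := fun p => \sum_(0 <= j < N) \sum_(0 <= k < N) wave ((j%:R - k%:R) * beta * n1, (j%:R - k%:R) * beta * n2) (ph j k) p)).
    by apply: continuous_sum => j; apply: continuous_sum => k; exact: cw.
  rewrite ler_wpM2l ?invr_ge0 ?exprn_ge0//; apply: le_trans (double_sum_dist N G0).
  rewrite (Rintegral_torus_sum mfin); last by move=> j; apply: continuous_sum => k; exact: cw.
  apply: ler_sum => j _; rewrite (Rintegral_torus_sum mfin); last by move=> k; exact: cw.
  by apply: ler_sum => k _; apply: le_trans (ler_norm _) _; exact: wave_le.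
have Gsum : \sum_(0 <= l < N) G l <= (A0 + D * (beta / 2) `^ (- th)) * (C0 * pow2 ((mv + mv)%:R * (1 - th))).
  rewrite /G -mulr_sumr ler_wpM2l//; first by rewrite addr_ge0// mulr_ge0 ?powR_ge0.
  exact: hC0.
set K := A0 + D * (beta / 2) `^ (- th) in Gsum *.
have K0 : 0 <= K by rewrite addr_ge0// mulr_ge0 ?powR_ge0.
have : 1 / 4 * (mass w v * limit_mass (subtree w v)) <= 2 * K * C0 * pow2 (- (sg * mv%:R)).
  apply: le_trans lower _; apply: le_trans upper _.
  apply: (@le_trans _ _ ((N%:R ^+ 2)^-1 * (2 * N%:R * (K * (C0 * pow2 ((mv + mv)%:R * (1 - th))))))).
    by rewrite ler_wpM2l ?invr_ge0 ?exprn_ge0// ler_wpM2l// mulr_ge0.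
  have -> : pow2 ((mv + mv)%:R * (1 - th)) = N%:R * pow2 (- (sg * mv%:R)) :> R.
    by rewrite /N natrX -pow2_nat -pow2D; congr pow2; rewrite natrD /th; field.
  by rewrite le_eqVlt; apply/orP; left; apply/eqP; field; rewrite gt_eqF.
rewrite -(ler_pM2l (pow2_gt0 (sg * mv%:R))) => h.
have pp : pow2 (sg * mv%:R) * pow2 (- (sg * mv%:R)) = 1 :> R by rewrite -pow2D subrr pow2_0.
have -> : 8 * K * C0 = 4 * (pow2 (sg * mv%:R) * (2 * K * C0 * pow2 (- (sg * mv%:R)))).
  transitivity (8 * K * C0 * (pow2 (sg * mv%:R) * pow2 (- (sg * mv%:R)))); first by rewrite pp mulr1.
  by move: (K) => K'; ring.
have -> : pow2 (sg * mv%:R) * (mass w v * limit_mass (subtree w v)) =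
  4 * (pow2 (sg * mv%:R) * (1 / 4 * (mass w v * limit_mass (subtree w v)))) by field.
by rewrite ler_pM2l.
Qed.

End Fejer.

(** * Almost sure decay *)

Lemma ln_natr_le (R : realType) (s k : nat) : (s <= 2 ^ k)%N -> ln s%:R <= 2 * k%:R :> R.
Proof.
move=> sk; case: s sk => [|s] sk; first by rewrite ln0// mulr_ge0.
have l2 : ln 2 < 2 :> R by exact: ln_sublinear.
apply: (@le_trans _ _ (ln (2 ^+ k))).
  by rewrite ler_ln ?posrE ?exprn_gt0// -natrX ler_nat.
by rewrite lnXn// -[_ *+ k]mulr_natr ler_wpM2r// ltW.
Qed.

(** Mesh [2^-L]; with indices below [2^(2 L + 4)] it approximates all frequencies with coordinates
    up to [2^(L + 1)]. The number of points is exponential in [L], so its logarithm is linear. *)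
Definition grid (R : realType) (L j k : nat) : R * R :=
  (j%:R / 2 ^+ L - 2 ^+ (L + 2), k%:R / 2 ^+ L - 2 ^+ (L + 2)).

Section AlmostSureDecay.
Context d (T : measurableType d) (R : realType) (rho : set R -> \bar R).
Variables (m : probability T R) (U : seq bool -> T -> R).
Hypothesis iidU : iid_field m rho U.
Hypothesis U0 : forall v t, 0 <= U v t.
Hypothesis meanU : (\int[m]_t (U [:: true] t)%:E = 1)%E.
Variables (q M a sg : R).
Hypothesis q1 : 1 < q.
Hypothesis momentU : (\int[m]_t (U [:: true] t `^ q)%:E = M%:E)%E.
Hypothesis a_lt : 2 * (2^-1 `^ q * M) * pow2 (a * q) < 1.
Hypothesis sg0 : 0 < sg.
Hypothesis sga : sg < a.
Hypothesis sg1 : sg <= 1.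

Let a0 : 0 < a. Proof. exact: lt_trans sga. Qed.

Lemma ae_branch_level_sum (K : R) : 1 <= K ->
  {ae m, forall t, exists C0 : R, 0 <= C0 /\ forall n u, (size u <= n)%N ->
    level_sum q M n (fun v => branch_scale a K n * (take (size u) v == u)%:R)
      (cutoff a K n) (U ^~ t) <= C0 * n.+1%:R}.
Proof.
move=> K1; have cK n := cutoff_gt0 a K1 n.
(* All words of length at most [n], listed as prefixes with repetitions; at most [2^(2 n + 1)]
   entries, so the logarithm and [n ln 2] stay below [6 * n.+1]. *)
pose r n : seq (seq bool) := [seq take k u | k <- iota 0 n.+1, u <- words n].
have := @ae_level_sum _ _ _ _ _ _ iidU U0 meanU q M q1 momentU _ r
  (fun n u v => branch_scale a K n * (take (size u) v == u)%:R) (cutoff a K) cK.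
have h n (u v : seq bool) : `|branch_scale a K n * (take (size u) v == u)%:R| * cutoff a K n <= 2^-1.
  have n0 : 0 < n.+1%:R :> R by rewrite ltr0n.
  have s0 : 0 < branch_scale a K n.
    by rewrite invr_gt0; apply: mulr_gt0 => //; apply: mulr_gt0.
  have e : branch_scale a K n * cutoff a K n = 2^-1 * n.+1%:R^-1.
    by rewrite /branch_scale; field; rewrite !gt_eqF.
  rewrite normrM (gtr0_norm s0) mulrAC e; case: eqP => _; rewrite ?normr0 ?mulr0 ?invr_ge0//.
  by rewrite normr1 mulr1 ler_piMr ?invr_ge0// invf_le1// ler1n.
move=> /(_ h); apply: filterS => t [C hC].
exists (`|C| + 6); split; first by rewrite addr_ge0.
move=> n u un.
have ur : u \in r n.
  apply/allpairsP; exists (size u, u ++ nseq (n - size u) false); split.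
  - by rewrite mem_iota add0n ltnS.
  - by rewrite /= mem_words size_cat size_nseq subnKC.
  - by rewrite /= take_size_cat.
apply: le_trans (hC n u ur) _.
have sr : (size (r n) <= 2 ^ (n + n).+1)%N.
  rewrite size_allpairs size_iota size_words -addSn expnD leq_mul2r; apply/orP; right.
  by rewrite ltnW// ltn_expl.
have := ln_natr_le R sr; have l2 : ln 2 < 2 :> R by exact: ln_sublinear.
have nl : n%:R * ln 2 <= n%:R * 2 :> R by rewrite ler_wpM2l// ltW.
have Cn : C <= `|C| * n.+1%:R.
  by apply: le_trans (ler_norm C) _; rewrite ler_peMr// ler1n.
have -> : (n + n).+1%:R = n%:R + n%:R + 1 :> R by rewrite -natr1 natrD.
move=> h1; rewrite mulrDl; apply: le_trans (_ : _ <= C + 6 * n.+1%:R) _.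
  by rewrite -natr1; move: h1 nl; lra.
by rewrite lerD2r.
Qed.

Variable prim : R * R -> bool -> R -> R.
Variable f : R * R -> bool -> R -> R.
Hypothesis prim_derive : forall xi p (t : R), is_derive t 1 (prim xi p) (f xi p t).
Hypothesis f_le1 : forall xi p t, `|f xi p t| <= 1.

(** Generation [n] tests at once every frequency octave with [L + 5 <= 2 n]. Together with the phase
    [p] and the sign [s] there are at most [2^(10 n + 10)] tests. *)
Lemma ae_frequency_level_sum (K : R) : 1 <= K ->
  {ae m, forall t, exists C0 : R, 0 <= C0 /\ forall (n L j k : nat) (p s : bool),
    (L + 5 <= n + n)%N -> (j < 2 ^ (2 * L + 4))%N -> (k < 2 ^ (2 * L + 4))%N ->
    level_sum q M n
      (fun u => freq_scale a K sg n L * ((-1) ^+ s * osc (prim (grid R L j k) p) u))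
      (cutoff a K n) (U ^~ t) <= C0 * n.+1%:R}.
Proof.
move=> K1; have cK n := cutoff_gt0 a K1 n.
pose r n : seq (nat * nat * nat * bool * bool) :=
  [seq (x, s) | x <- [seq (x, p) | x <- [seq (x, k) | x <-
    [seq (L, j) | L <- iota 0 (n + n), j <- iota 0 (2 ^ (4 * n + 4))%N],
     k <- iota 0 (2 ^ (4 * n + 4))%N], p <- [:: false; true]], s <- [:: false; true]].
(* The value 0 outside [L <= 2 n] makes the smallness condition on the coefficients hold for every
   index. *)
pose c n (i : nat * nat * nat * bool * bool) (u : seq bool) : R :=
  let: (L, j, k, p, s) := i in
  if (L <= n + n)%N then
    freq_scale a K sg n L * ((-1) ^+ s * osc (prim (grid R L j k) p) u)
  else 0.
have := @ae_level_sum _ _ _ _ _ _ iidU U0 meanU q M q1 momentU _ r c (cutoff a K) cK.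
have h n i (u : seq bool) : `|c n i u| * cutoff a K n <= 2^-1.
  case: i => [[[[L j] k] p] s]; rewrite /c; case: ifPn => Ln; last first.
    by rewrite normr0 mul0r invr_ge0.
  have T0 := freq_size_gt0 a sg n L.
  have s0 : 0 < freq_scale a K sg n L.
    by rewrite invr_gt0; apply: mulr_gt0 T0; apply: mulr_gt0 => //; exact: lt_le_trans K1.
  rewrite normrM (gtr0_norm s0) normrM normrX normrN1 expr1n mul1r mulrAC.
  apply: le_trans (freq_scale_cutoff a0 K1 sg0 sga Ln).
  rewrite ler_piMr//; first by rewrite mulr_ge0// ltW.
  exact: osc_le1.
move=> /(_ h); apply: filterS => t [C hC].
exists (`|C| + 22); split; first by rewrite addr_ge0.
move=> n L j k p s Ln jL kL.
have ir : (L, j, k, p, s) \in r n.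
  have L2 : (2 ^ (2 * L + 4) <= 2 ^ (4 * n + 4))%N by rewrite leq_exp2l//; lia.
  have bb (b : bool) : b \in [:: false; true] by case: b.
  apply/allpairsP; exists (L, j, k, p, s); split; [|exact: bb|by []].
  apply/allpairsP; exists (L, j, k, p); split; [|exact: bb|by []].
  apply/allpairsP; exists (L, j, k); split; [|by rewrite mem_iota add0n (leq_trans kL)|by []].
  apply/allpairsP; exists (L, j); split; [| |by []]; rewrite mem_iota add0n.
    by rewrite (leq_trans _ Ln)// -addn1 leq_add2l.
  exact: leq_trans jL L2.
have Ln' : (L <= n + n)%N by apply: leq_trans Ln; exact: leq_addr.
have := hC n _ ir; rewrite /c Ln' => /le_trans; apply.
have sr : (size (r n) <= 2 ^ (10 * n + 10))%N.
  rewrite !size_allpairs !size_iota /=.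
  have -> : (10 * n + 10 = (n + n) + ((4 * n + 4) + (4 * n + 4)) + 2)%N by lia.
  rewrite !expnD (_ : 2 ^ 2 = 2 * 2)%N// !mulnA !leq_mul2r; do ?[apply/orP; right].
  rewrite -!expnD; apply: ltnW; exact: ltn_expl.
have := ln_natr_le R sr; have l2 : ln 2 < 2 :> R by exact: ln_sublinear.
have nl : n%:R * ln 2 <= n%:R * 2 :> R by rewrite ler_wpM2l// ltW.
have Cn : C <= `|C| * n.+1%:R.
  by apply: le_trans (ler_norm C) _; rewrite ler_peMr// ler1n.
rewrite natrD natrM => h1; rewrite mulrDl; apply: le_trans (_ : _ <= C + 22 * n.+1%:R) _.
  by rewrite -natr1; move: h1 nl; lra.
by rewrite lerD2r.
Qed.

Variables x1 x2 y1 y2 z1 z2 : R -> R.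
Hypothesis dx1 : forall t : R, is_derive t 1 x1 (y1 t).
Hypothesis dx2 : forall t : R, is_derive t 1 x2 (y2 t).
Hypothesis dy1 : forall t : R, is_derive t 1 y1 (z1 t).
Hypothesis dy2 : forall t : R, is_derive t 1 y2 (z2 t).
Hypothesis cz1 : continuous z1.
Hypothesis cz2 : continuous z2.
Variables B c : R.
Hypothesis B0 : 0 < B.
Hypothesis yB : forall t : R, 0 <= t <= 1 -> `|y1 t| <= B /\ `|y2 t| <= B.
Hypothesis zB : forall t : R, 0 <= t <= 1 -> `|z1 t| <= B /\ `|z2 t| <= B.
Hypothesis c0 : 0 < c.
Hypothesis det_ge : forall t : R, c <= `|y1 t * z2 t - y2 t * z1 t|.
Hypothesis fE : forall xi p t, f xi p t =
  cos (2 * pi * (x1 t * xi.1 + x2 t * xi.2) + (if p then - (pi / 2) else 0)).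

(** The constant [K] of the cut-off depends on the realisation, whereas the level sums are
    controlled for a fixed one. They are therefore controlled almost surely for all positive
    integers, and [K] is chosen afterwards, path by path. *)
Lemma ae_decay : {ae m, forall t, exists C : R, 0 <= C /\
  forall (L j k : nat) (p : bool) n,
    (j < 2 ^ (2 * L + 4))%N -> (k < 2 ^ (2 * L + 4))%N ->
    2 ^+ L <= 2 * pi * euclidean_norm (grid R L j k) ->
    2 * pi * euclidean_norm (grid R L j k) <= 2 ^+ (L + 5) ->
    (L + 5 <= n + n)%N ->
    `|cascade_integral (U ^~ t) n (prim (grid R L j k) p)| <=
      C * L.+1%:R ^+ 2 * pow2 (- (L%:R * (sg / 2)))}.
Proof.
have M0 := moment_ge0 momentU.
have [N N0 hN] := count_near_stationary dy1 dy2 cz1 cz2 B0 yB zB c0 det_ge.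
have h1 := ae_foralln (fun K : nat => @ae_branch_level_sum K.+1%:R (ltac:(by rewrite ler1n))).
have h2 := ae_foralln (fun K : nat => @ae_frequency_level_sum K.+1%:R (ltac:(by rewrite ler1n))).
have h3 := ae_mass_moment iidU U0 momentU a_lt.
apply: filterS3 h1 h2 h3 => t h1 h2 [Cm hm].
pose K : R := (Num.truncn `|Cm|).+1%:R.
have K1 : 1 <= K by rewrite ler1n.
have CmK : Cm <= K.
  by apply: le_trans (ler_norm _) _; apply: ltW; exact: truncnS_gt.
have massq n : \sum_(v <- words n) mass (U ^~ t) v `^ q <= K * pow2 (- (n%:R * (a * q))).
  by apply: le_trans (hm n) _; rewrite ler_wpM2r ?pow2_ge0.
have [Cb' [Cb'0 hb']] := h1 (Num.truncn `|Cm|); have [C0 [C00 hf]] := h2 (Num.truncn `|Cm|).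
have w0 u : 0 <= U u t by exact: U0.
have [Cb Cb0 hb] := branch_mass_bound w0 a0 q1 M0 K1 massq Cb'0 sg0 sga hb'.
have [C Cge0 hC] := fourier_path w0 a0 q1 M0 K1 massq sg0 sga sg1 Cb0 hb
  dx1 dx2 dy1 dy2 B0 yB zB N0 (fun th j => hN th j) C00.
exists C; split=> // L j k p n jL kL lamL lamU Ln.
set xi := grid R L j k in lamL lamU *; pose lam := euclidean_norm xi.
have pi0 : 0 < pi :> R by exact: pi_gt0.
have lam0 : 0 < lam.
  have : 0 < 2 * pi * lam by apply: lt_le_trans lamL; rewrite exprn_gt0.
  by rewrite pmulr_rgt0// mulr_gt0.
pose th : R * R := (xi.1 / lam, xi.2 / lam).
have uth : unit_vector th.
  rewrite /unit_vector /th /= !expr_div_n -mulrDl /lam /euclidean_norm sqr_sqrtr.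
    rewrite divff//; apply: contraTneq lam0; rewrite /lam /euclidean_norm => ->.
    by rewrite sqrtr0 ltxx.
  by rewrite addr_ge0 ?sqr_ge0.
apply: (hC L th (2 * pi * lam) (if p then - (pi / 2) else 0) _ uth lamL lamU _ _ n Ln).
  move=> s; rewrite (_ : cos _ = f xi p s); first exact: prim_derive.
  rewrite fE /phase /th /=; congr (cos (_ + _)).
  by field; rewrite (gt_eqF lam0) expf_neq0.
by move=> n' b Ln'; exact: hf.
Qed.

End AlmostSureDecay.

(** * From grid frequencies to the plane *)

Section EuclideanNorm.
Variable R : realType.
Implicit Types x y xi : R * R.

Lemma euclidean_norm_sqr x : euclidean_norm x ^+ 2 = x.1 ^+ 2 + x.2 ^+ 2.
Proof. by rewrite /euclidean_norm sqr_sqrtr// addr_ge0 ?sqr_ge0. Qed.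

Lemma euclidean_norm_ge0 x : 0 <= euclidean_norm x.
Proof. exact: sqrtr_ge0. Qed.

Lemma coord_le_euclidean_norm x : `|x.1| <= euclidean_norm x /\ `|x.2| <= euclidean_norm x.
Proof.
have s1 := sqr_ge0 x.1; have s2 := sqr_ge0 x.2.
by split; rewrite -ler_sqr ?nnegrE ?euclidean_norm_ge0// -normrX ger0_norm ?sqr_ge0//
  euclidean_norm_sqr; lra.
Qed.

Lemma euclidean_norm_le x y :
  euclidean_norm x <= euclidean_norm y + (`|x.1 - y.1| + `|x.2 - y.2|).
Proof.
have [c1 c2] := coord_le_euclidean_norm y; have e0 := euclidean_norm_ge0 y.
set a := `|x.1 - y.1|; set b := `|x.2 - y.2|; set e := euclidean_norm y in c1 c2 e0 *.
have a0 : 0 <= a by exact: normr_ge0.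
have b0 : 0 <= b by exact: normr_ge0.
rewrite -ler_sqr ?nnegrE ?euclidean_norm_ge0 ?addr_ge0// euclidean_norm_sqr.
have x1E : `|x.1| <= `|y.1| + a by rewrite -[x.1](subrK y.1) addrC; exact: ler_normD.
have x2E : `|x.2| <= `|y.2| + b by rewrite -[x.2](subrK y.2) addrC; exact: ler_normD.
have q1 : x.1 ^+ 2 <= (`|y.1| + a) ^+ 2.
  by rewrite -real_normK ?num_real// lerXn2r ?nnegrE ?addr_ge0.
have q2 : x.2 ^+ 2 <= (`|y.2| + b) ^+ 2.
  by rewrite -real_normK ?num_real// lerXn2r ?nnegrE ?addr_ge0.
have yE : `|y.1| ^+ 2 + `|y.2| ^+ 2 = e ^+ 2 by rewrite !real_normK ?num_real// -euclidean_norm_sqr.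
have p1 : `|y.1| * a <= e * a by rewrite ler_wpM2r.
have p2 : `|y.2| * b <= e * b by rewrite ler_wpM2r.
have p3 : 0 <= a * b by rewrite mulr_ge0.
move: q1 q2 yE p1 p2 p3; rewrite !sqrrD mulrDr !mulr2n.
move: (x.1 ^+ 2) (x.2 ^+ 2) (`|y.1| ^+ 2) (`|y.2| ^+ 2) (e ^+ 2) (`|y.1| * a) (`|y.2| * b) (e * a) (e * b) (a * b) (a ^+ 2) (b ^+ 2).
by move=> *; lra.
Qed.

Lemma cos_lipschitz (a b : R) : `|cos a - cos b| <= `|a - b|.
Proof.
wlog ab : a b / b <= a.
  by move=> h; have [/h//|/ltW/h] := leP b a; rewrite distrC (distrC b).
have := @mean_value_le R cos (fun y : R => - sin y) b a 1 ab (fun t _ => is_derive_cos t).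
rewrite mul1r (ger0_norm (x := a - b)) ?subr_ge0//; apply.
by move=> t _; rewrite normrN sin_max.
Qed.

Lemma dyadic_scale (x : R) : 2 <= x -> exists L : nat, [/\ (0 < L)%N, 2 ^+ L <= x & x < 2 ^+ L.+1].
Proof.
move=> x2; have x0 : 0 <= x by lra.
have [n1 n2] : (Num.truncn x)%:R <= x /\ x < (Num.truncn x).+1%:R.
  by split; [rewrite truncn_le|exact: truncnS_gt].
have n3 : (2 <= Num.truncn x)%N by rewrite truncn_ge_nat.
have n0 : (0 < Num.truncn x)%N by exact: leq_trans n3.
have /andP[k1 k2] := trunc_log_bounds (isT : 1 < 2)%N n0.
exists (trunc_log 2 (Num.truncn x)); split.
- by rewrite trunc_log_gt0 n3.
- by apply: le_trans n1; rewrite -natrX ler_nat.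
- by apply: lt_le_trans n2 _; rewrite -natrX ler_nat.
Qed.

Lemma grid_coord (c : R) (L : nat) : `|c| <= 2 ^+ L.+1 -> exists j : nat,
  (j < 2 ^ (2 * L + 4))%N /\ `|c - (j%:R / 2 ^+ L - 2 ^+ (L + 2))| <= (2 ^+ L)^-1.
Proof.
rewrite ler_norml => /andP[c1 c2].
set y := (c + 2 ^+ (L + 2)) * 2 ^+ L.
have e2 : 2 ^+ (L + 2) = 2 * 2 ^+ L.+1 :> R by rewrite -exprS addn2.
have p0 : 0 < 2 ^+ L :> R by rewrite exprn_gt0.
have p1 : 0 < 2 ^+ L.+1 :> R by rewrite exprn_gt0.
have y0 : 0 <= y by rewrite mulr_ge0 ?(ltW p0)// e2; lra.
have [n1 n2] : (Num.truncn y)%:R <= y /\ y < (Num.truncn y).+1%:R.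
  by split; [rewrite truncn_le|exact: truncnS_gt].
exists (Num.truncn y); split.
  rewrite -(ltr_nat R); apply: le_lt_trans n1 _.
  apply: (@lt_le_trans _ _ ((4 * 2 ^+ L.+1) * 2 ^+ L)).
    by rewrite ltr_pM2r// e2; lra.
  rewrite natrX (_ : (2 * L + 4 = L + L + 4)%N); last by rewrite mul2n addnn.
  rewrite !exprD exprS; have : 0 < 2 ^+ L * 2 ^+ L :> R by rewrite mulr_gt0.
  move: (2 ^+ L) => z; lra.
rewrite (_ : c - _ = (y - (Num.truncn y)%:R) / 2 ^+ L); last first.
  by rewrite /y mulrBl mulfK ?gt_eqF//; ring.
have i0 : 0 <= (2 ^+ L)^-1 :> R by rewrite invr_ge0 ltW.
rewrite normrM (ger0_norm i0) ler_piMl//.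
by rewrite ger0_norm ?subr_ge0// lerBlDl natr1 ltW.
Qed.

End EuclideanNorm.

Section GridToPlane.
Variables (R : realType) (m : {measure set (torus R) -> \bar R}).
Hypothesis mfin : (m [set: torus R] < +oo)%E.
Variable gamma : torus R -> R * R.
Hypothesis cgamma : continuous gamma.
Variable B : R.
Hypothesis gammaB : forall p, `|(gamma p).1| <= B /\ `|(gamma p).2| <= B.

Lemma wave_lipschitz xi xi' ph :
  `|\int[m]_p wave gamma xi ph p - \int[m]_p wave gamma xi' ph p| <=
  2 * pi * B * (`|xi.1 - xi'.1| + `|xi.2 - xi'.2|) * fine (m setT).
Proof.
have cw z : continuous (wave gamma z ph) by exact: continuous_wave.
rewrite -RintegralB//; [|exact: integrable_torus|exact: integrable_torus].
apply: (le_Rintegral_torus_norm mfin).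
  by move=> p; apply: (@continuousB _ _ _ (wave gamma xi ph)); exact: cw.
move=> p; apply: le_trans (cos_lipschitz _ _) _.
have [g1 g2] := gammaB p.
rewrite (_ : _ - _ = 2 * pi * ((gamma p).1 * (xi.1 - xi'.1) + (gamma p).2 * (xi.2 - xi'.2))); last first.
  by rewrite /dot; ring.
have p0 : 0 <= 2 * pi :> R by rewrite mulr_ge0// pi_ge0.
rewrite normrM (ger0_norm p0) -mulrA ler_wpM2l//.
apply: le_trans (ler_normD _ _) _; rewrite !normrM mulrDr.
by rewrite lerD// ler_wpM2r.
Qed.

Variables (C sg sg' : R) (ph : bool -> R).
Hypotheses (C0 : 0 <= C) (sg'0 : 0 < sg') (sg'sg : sg' < sg) (sg1 : sg' <= 2).
Hypothesis grid_decay : forall (L j k : nat) (p : bool),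
  (j < 2 ^ (2 * L + 4))%N -> (k < 2 ^ (2 * L + 4))%N ->
  2 ^+ L <= 2 * pi * euclidean_norm (grid R L j k) ->
  2 * pi * euclidean_norm (grid R L j k) <= 2 ^+ (L + 5) ->
  `|\int[m]_t wave gamma (grid R L j k) (ph p) t| <=
    C * L.+1%:R ^+ 2 * pow2 (- (L%:R * (sg / 2))).

(** A grid point lies within [2^-L] of [xi] in each coordinate, and this error is at most
    [2^(- L sg' / 2)] since [sg' <= 2]. The polynomial factor is absorbed by [sg' < sg]. *)
Lemma wave_decay : exists2 C' : R, 0 <= C' & forall xi p, 2 <= euclidean_norm xi ->
  `|\int[m]_t wave gamma xi (ph p) t| <= C' * euclidean_norm xi `^ (- (sg' / 2)).
Proof.
have e0 : 0 < (sg - sg') / 2 by rewrite divr_gt0// subr_gt0.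
have [C1 C10 hC1] := succ_exp_le_pow2 2 e0.
have B0 : 0 <= B by have [b _] := gammaB (to_torus 0); exact: le_trans b.
pose A0 := fine (m setT); have A00 : 0 <= A0 by rewrite fine_ge0.
have K0 : 0 <= C * C1 + 4 * pi * B * A0.
  by rewrite addr_ge0 ?mulr_ge0 ?pi_ge0 ?(ltW C10).
exists (2 * (C * C1 + 4 * pi * B * A0)); first by rewrite mulr_ge0.
move=> xi p xi2; have [L [L0 xl xu]] := dyadic_scale xi2.
have [x1 x2] := coord_le_euclidean_norm xi.
have [j [jL hj]] := grid_coord (le_trans x1 (ltW xu)).
have [k [kL hk]] := grid_coord (le_trans x2 (ltW xu)).
pose g := grid R L j k.
have P0 : 0 < 2 ^+ L :> R by rewrite exprn_gt0.
have P2 : 2 <= 2 ^+ L :> R.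
  by case: (L) L0 => // l _; rewrite exprS ler_peMr// exprn_ege1// ler1n.
have Pi : (2 ^+ L)^-1 <= 1 / 2 :> R.
  by rewrite div1r lef_pV2 ?posrE.
have d1 : `|xi.1 - g.1| <= (2 ^+ L)^-1 by exact: hj.
have d2 : `|xi.2 - g.2| <= (2 ^+ L)^-1 by exact: hk.
have lo := euclidean_norm_le xi g.
have up := euclidean_norm_le g xi.
rewrite (distrC g.1) (distrC g.2) in up.
have pi1 : 1 <= pi :> R by apply: le_trans (pi_ge2 R); rewrite ler1n.
(* Five octaves of slack between the bounds absorb the factor [2 pi], the octave of [xi] and the
   distance to the grid; [2^L >= 2] secures the lower bound. *)
have gL : 2 ^+ L <= 2 * pi * euclidean_norm g.
  apply: (@le_trans _ _ (2 * 1 * euclidean_norm g)); first by move: lo xl P2 d1 d2 Pi; lra.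
  by rewrite ler_wpM2r ?euclidean_norm_ge0// ler_wpM2l.
have gU : 2 * pi * euclidean_norm g <= 2 ^+ (L + 5).
  apply: (@le_trans _ _ (2 * 4 * euclidean_norm g)).
    rewrite ler_wpM2r ?euclidean_norm_ge0// ler_wpM2l//.
    by have := pihalf_02 R; lra.
  by rewrite exprD; move: up xu P2 d1 d2 Pi; rewrite exprS; lra.
have h1 := grid_decay p jL kL gL gU.
have h2 := wave_lipschitz xi g (ph p).
have pl : pow2 (- (L%:R * (sg' / 2))) <= 2 * euclidean_norm xi `^ (- (sg' / 2)).
  have E0 : 0 < euclidean_norm xi by apply: lt_le_trans xi2.
  rewrite pow2N powRN -[2 * _]invrK invfM invrK lef_pV2 ?posrE ?pow2_gt0 ?mulr_gt0 ?invr_gt0 ?powR_gt0//.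
  rewrite mulrC ler_pdivrMr//.
  apply: (@le_trans _ _ (pow2 (L.+1%:R) `^ (sg' / 2))).
    apply: ge0_ler_powR; rewrite ?nnegrE ?euclidean_norm_ge0 ?pow2_ge0 ?divr_ge0 ?(ltW sg'0)//.
    by rewrite pow2_nat ltW.
  rewrite -pow2M -[L.+1%:R]natr1 mulrDl mul1r pow2D ler_wpM2l ?pow2_ge0//.
  rewrite -[leRHS]powRr1//; rewrite -/(pow2 1) ler_pow2; move: sg1; lra.
have t1 : C * L.+1%:R ^+ 2 * pow2 (- (L%:R * (sg / 2))) <= C * C1 * pow2 (- (L%:R * (sg' / 2))).
  have -> : C * C1 * pow2 (- (L%:R * (sg' / 2))) = C * (C1 * pow2 (L%:R * ((sg - sg') / 2))) * pow2 (- (L%:R * (sg / 2))).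
    by rewrite -!mulrA; congr (_ * (_ * _)); rewrite -pow2D; congr pow2; field.
  by rewrite ler_wpM2r ?pow2_ge0// ler_wpM2l.
have t2 : 2 * pi * B * (`|xi.1 - g.1| + `|xi.2 - g.2|) * A0 <= 4 * pi * B * A0 * pow2 (- (L%:R * (sg' / 2))).
  have dd : `|xi.1 - g.1| + `|xi.2 - g.2| <= 2 * pow2 (- (L%:R * (sg' / 2))).
    have : (2 ^+ L)^-1 <= pow2 (- (L%:R * (sg' / 2))) :> R.
      rewrite -pow2_nat -pow2N ler_pow2 lerN2 ler_piMr//.
      by move: sg1; lra.
    by move: d1 d2; lra.
  have -> : 4 * pi * B * A0 * pow2 (- (L%:R * (sg' / 2))) = 2 * pi * B * (2 * pow2 (- (L%:R * (sg' / 2)))) * A0 by ring.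
  by rewrite ler_wpM2r// ler_wpM2l// !mulr_ge0// pi_ge0.
rewrite -mulrA [X in _ <= X]mulrCA; apply: (@le_trans _ _ ((C * C1 + 4 * pi * B * A0) * pow2 (- (L%:R * (sg' / 2))))); last first.
  by rewrite ler_wpM2l.
rewrite mulrDl; apply: le_trans (lerD (le_trans h1 t1) (le_trans h2 t2)).
rewrite -/A0; set u := \int[m]_t _; set u' := \int[m]_t _.
have e : u = u' + (u - u') by rewrite addrC subrK.
by rewrite {1}e; exact: ler_normD.
Qed.

End GridToPlane.

(** * The curve and its Fourier transform *)

Section CurveCoordinates.
Variables (R : realType) (gamma : torus R -> R * R).
Hypothesis curve : nondegenerate_C2_Jordan_curve gamma.

Let g : R -> R * R := gamma \o @to_torus R.

Lemma is_derive_coords (f : R -> R * R) (t : R) : derivable f t 1 ->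
  is_derive t 1 (fun s => (f s).1) (derive1 f t).1 /\
  is_derive t 1 (fun s => (f s).2) (derive1 f t).2.
Proof.
move=> df; rewrite derive1E.
have key (pr : R * R -> R) : continuous pr ->
    (forall (h : R) (u v : R * R), pr (h *: (u - v)) = h *: (pr u - pr v)) ->
    is_derive t 1 (fun s => pr (f s)) (pr ('D_1 f t)).
  move=> cpr prE.
  have h : (pr \o (fun h : R => h^-1 *: ((f \o shift t) (h *: 1) - f t))) @ 0^' --> pr ('D_1 f t).
    by apply: (cvg_comp _ _ df); exact: cpr.
  have e : pr \o (fun h : R => h^-1 *: ((f \o shift t) (h *: 1) - f t)) =
      (fun h : R => h^-1 *: (((fun s => pr (f s)) \o shift t) (h *: 1) - pr (f t))).
    by apply/funext => z; rewrite /= prE.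
  rewrite e in h.
  apply: DeriveDef; first by apply/cvg_ex; eexists; exact: h.
  exact: cvg_lim h.
split; apply: key => //.
- by move=> p; exact: cvg_fst.
- by move=> p; exact: cvg_snd.
Qed.

Record coordinates (x1 x2 y1 y2 z1 z2 : R -> R) (B c : R) : Prop := Coordinates {
  coordE : forall t, gamma (to_torus t) = (x1 t, x2 t);
  coord_dx1 : forall t : R, is_derive t 1 x1 (y1 t);
  coord_dx2 : forall t : R, is_derive t 1 x2 (y2 t);
  coord_dy1 : forall t : R, is_derive t 1 y1 (z1 t);
  coord_dy2 : forall t : R, is_derive t 1 y2 (z2 t);
  coord_cz1 : continuous z1;
  coord_cz2 : continuous z2;
  coord_B0 : 0 < B;
  coord_xB : forall p, `|(gamma p).1| <= B /\ `|(gamma p).2| <= B;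
  coord_yB : forall t : R, 0 <= t <= 1 -> `|y1 t| <= B /\ `|y2 t| <= B;
  coord_zB : forall t : R, 0 <= t <= 1 -> `|z1 t| <= B /\ `|z2 t| <= B;
  coord_c0 : 0 < c;
  coord_det : forall t, c <= `|y1 t * z2 t - y2 t * z1 t|;
  coord_speed : forall t, 0 < euclidean_norm (y1 t, y2 t)
}.

Lemma curve_coordinates : exists x1 x2 y1 y2 z1 z2 B c, coordinates x1 x2 y1 y2 z1 z2 B c.
Proof.
case: curve => cgamma _ [dg ddg cz] speed det.
have cfst : continuous (fst : R * R -> R) by move=> p; exact: cvg_fst.
have csnd : continuous (snd : R * R -> R) by move=> p; exact: cvg_snd.
pose z t : R * R := derive1n 2 g t.
have zE t : derive1 (derive1 g) t = z t by rewrite /z derive1nS derive1n1.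
have cz1 : continuous (fun t => (z t).1).
  by move=> t; apply: continuous_comp; [exact: cz|exact: cfst].
have cz2 : continuous (fun t => (z t).2).
  by move=> t; apply: continuous_comp; [exact: cz|exact: csnd].
have dy (t : R) : is_derive t 1 (fun s => (derive1 g s).1) (z t).1 /\ is_derive t 1 (fun s => (derive1 g s).2) (z t).2.
  by rewrite -zE; exact: is_derive_coords (ddg t).
have cy1 : continuous (fun t => (derive1 g t).1).
  move=> t; apply: differentiable_continuous; apply/derivable1_diffP.
  by have [? _] := (dy t).1.
have cy2 : continuous (fun t => (derive1 g t).2).
  move=> t; apply: differentiable_continuous; apply/derivable1_diffP.
  by have [? _] := (dy t).2.
have cg1 : continuous (fun p => (gamma p).1).
  by move=> p; apply: continuous_comp; [exact: cgamma|exact: cfst].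
have cg2 : continuous (fun p => (gamma p).2).
  by move=> p; apply: continuous_comp; [exact: cgamma|exact: csnd].
have [X1 X10 hX1] := torus_bounded cg1.
have [X2 X20 hX2] := torus_bounded cg2.
have [Y1 Y10 hY1] := continuous_bounded cy1.
have [Y2 Y20 hY2] := continuous_bounded cy2.
have [Z1 Z10 hZ1] := continuous_bounded cz1.
have [Z2 Z20 hZ2] := continuous_bounded cz2.
exists (fun t => (g t).1), (fun t => (g t).2), (fun t => (derive1 g t).1), (fun t => (derive1 g t).2),
  (fun t => (z t).1), (fun t => (z t).2), (X1 + X2 + Y1 + Y2 + Z1 + Z2),
  (inf (range (fun t => `|det2 (derive1 g t) (derive1n 2 g t)|))).
constructor.
- by move=> t; rewrite /g /=; case: (gamma _).
- by move=> t; case: (is_derive_coords (dg t)).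
- by move=> t; case: (is_derive_coords (dg t)).
- by move=> t; case: (dy t).
- by move=> t; case: (dy t).
- exact: cz1.
- exact: cz2.
- by do !apply: addr_gt0.
- by move=> p; split; [apply: le_trans (hX1 p) _|apply: le_trans (hX2 p) _]; move: X10 X20 Y10 Y20 Z10 Z20; lra.
- by move=> t t01; split; [apply: le_trans (hY1 t t01) _|apply: le_trans (hY2 t t01) _]; move: X10 X20 Y10 Y20 Z10 Z20; lra.
- by move=> t t01; split; [apply: le_trans (hZ1 t t01) _|apply: le_trans (hZ2 t t01) _]; move: X10 X20 Y10 Y20 Z10 Z20; lra.
- exact: det.
- move=> t; apply: ge_inf; last by exists t.
  by exists 0 => _ [s _ <-]; exact: normr_ge0.
- move=> t; apply: lt_le_trans speed _; apply: ge_inf; last first.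
    by exists t => //; case: (derive1 g t).
  by exists 0 => _ [s _ <-]; exact: euclidean_norm_ge0.
Qed.

End CurveCoordinates.

Section FourierPushforward.
Variables (R : realType) (m : {measure set (torus R) -> \bar R}).
Hypothesis mfin : (m [set: torus R] < +oo)%E.
Variable gamma : torus R -> R * R.
Hypothesis cgamma : continuous gamma.

Lemma measurable_curve : measurable_fun setT gamma.
Proof.
rewrite (_ : gamma = fun p => ((gamma p).1, (gamma p).2)); last first.
  by apply/funext => p; case: (gamma p).
apply: measurable_fun_pair; apply: measurable_continuous_torus => p.
- by apply: continuous_comp; [exact: cgamma|exact: cvg_fst].
- by apply: continuous_comp; [exact: cgamma|exact: cvg_snd].
Qed.

Lemma integral_curve (h : R -> R) (f : R -> R) xi ph : continuous h ->
  (forall p, h (- (2 * pi * dot (gamma p) xi)) = f (wave gamma xi ph p)) ->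
  continuous f ->
  fine (\int[pushforward m gamma]_x (h (- (2 * pi * dot x xi)))%:E) =
  \int[m]_p f (wave gamma xi ph p).
Proof.
move=> ch hf cf; rewrite /Rintegral; congr fine.
have cfw : continuous (fun p => f (wave gamma xi ph p)).
  by move=> p; apply: continuous_comp; [exact: continuous_wave|exact: cf].
have mdot : measurable_fun setT (fun x : R * R => h (- (2 * pi * dot x xi))).
  apply: (measurableT_comp (continuous_measurable_fun ch)).
  apply: measurableT_comp => //; apply: measurable_funM => //.
  by apply: measurable_funD; apply: measurable_funM.
have e : (EFin \o (fun x => h (- (2 * pi * dot x xi)))) \o gamma = EFin \o (fun p => f (wave gamma xi ph p)).
  by apply/funext => p /=; rewrite hf.
have := @integral_pushforward _ _ _ _ R gamma measurable_curve m setT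
  (EFin \o (fun x => h (- (2 * pi * dot x xi)))).
move=> H; apply: etrans (H _ _ _) _ => //.
- exact/measurable_EFinP.
- by rewrite e preimage_setT; exact: integrable_torus.
- by rewrite preimage_setT; apply: (@eq_integral _ _ _ m) => p _; rewrite -[LHS]/(((EFin \o (fun x => h (- (2 * pi * dot x xi)))) \o gamma) p) e.
Qed.

Lemma fourier_curve xi : fourier (pushforward m gamma) xi =
  Complex (\int[m]_p wave gamma xi 0 p) (- \int[m]_p wave gamma xi (- (pi / 2)) p).
Proof.
rewrite /fourier /complex_integral /expi /=; congr Complex.
  apply: (integral_curve (f := id)) => //; first exact: continuous_cos.
  - by move=> p; rewrite cosN /wave addr0.
  - by move=> x; exact: cvg_id.
rewrite (integral_curve (f := fun x => -1 * x) (ph := - (pi / 2))); last 3 first.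
- exact: continuous_sin.
- by move=> p; rewrite sinN /wave mulN1r; congr (- _); rewrite -sinDpihalf subrK.
- by move=> x; apply: cvgM; [exact: cvg_cst|exact: cvg_id].
rewrite RintegralZl ?mulN1r//; apply: (integrable_torus mfin).
exact: continuous_wave.
Qed.

Lemma fourier_le xi : ComplexField.Normc.normc (fourier (pushforward m gamma) xi) <=
  `|\int[m]_p wave gamma xi 0 p| + `|\int[m]_p wave gamma xi (- (pi / 2)) p|.
Proof.
rewrite fourier_curve /=; set a := \int[m]_p _; set b := \int[m]_p _.
rewrite -ler_sqr ?nnegrE ?sqrtr_ge0 ?addr_ge0// sqr_sqrtr ?addr_ge0 ?sqr_ge0//.
rewrite sqrrN sqrrD !real_normK ?num_real//.
have : 0 <= `|a| * `|b| by rewrite mulr_ge0.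
rewrite mulr2n; lra.
Qed.

(** All phases are required, since centring the kernel at an arc gives each of its waves a phase; by
    the addition formula they are combinations of the real and imaginary parts. *)
Lemma wave_le_fourier xi ph : `|\int[m]_p wave gamma xi ph p| <=
  2 * ComplexField.Normc.normc (fourier (pushforward m gamma) xi).
Proof.
rewrite fourier_curve [ComplexField.Normc.normc _]/=.
set a := \int[m]_p wave gamma xi 0 p; set b := \int[m]_p wave gamma xi (- (pi / 2)) p.
have cw z : continuous (wave gamma xi z) by exact: continuous_wave.
have -> : \int[m]_p wave gamma xi ph p = cos ph * a + - sin ph * b.
  rewrite -!RintegralZl//; [|exact: integrable_torus|exact: integrable_torus].
  rewrite -RintegralD//; last 2 first.
  - exact: (integrableZl measurableT _ (integrable_torus mfin (cw 0))).
  - exact: (integrableZl measurableT _ (integrable_torus mfin (cw (- (pi / 2))))).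
  apply: eq_Rintegral => p _; rewrite /wave addr0 cosD.
  have -> : cos (2 * pi * dot (gamma p) xi + - (pi / 2)) = sin (2 * pi * dot (gamma p) xi).
    by rewrite -sinDpihalf subrK.
  by ring.
have a_le : `|a| <= Num.sqrt (a ^+ 2 + (- b) ^+ 2).
  rewrite -ler_sqr ?nnegrE ?sqrtr_ge0// sqr_sqrtr ?addr_ge0 ?sqr_ge0// real_normK ?num_real//.
  by rewrite lerDl sqr_ge0.
have b_le : `|b| <= Num.sqrt (a ^+ 2 + (- b) ^+ 2).
  rewrite -ler_sqr ?nnegrE ?sqrtr_ge0// sqr_sqrtr ?addr_ge0 ?sqr_ge0// real_normK ?num_real//.
  by rewrite sqrrN lerDr sqr_ge0.
apply: le_trans (ler_normD _ _) _; rewrite !normrM normrN mulrDl mul1r.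
apply: lerD; [apply: le_trans a_le|apply: le_trans b_le].
- by rewrite ler_piMl// cos_max.
- by rewrite ler_piMl// sin_max.
Qed.

(** The kernel uses multiples of a fixed small frequency, below the range of the decay. There the
    total mass is a sufficient bound; above, lowering [s] to [sg] is harmless as [|xi| >= 1]. *)
Lemma wave_decay_all (C r s sg : R) : 0 < sg -> sg < s ->
  (forall xi, r <= euclidean_norm xi ->
    ComplexField.Normc.normc (fourier (pushforward m gamma) xi) <= C * euclidean_norm xi `^ (- (s / 2))) ->
  exists2 D : R, 0 <= D & forall xi ph, 0 < euclidean_norm xi ->
    `|\int[m]_p wave gamma xi ph p| <= D * euclidean_norm xi `^ (- (sg / 2)).
Proof.
move=> sg0 sgs decay; pose r' := Num.max r 1; pose A0 := fine (m setT).
have A00 : 0 <= A0 by rewrite fine_ge0.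
have r'1 : 1 <= r' by rewrite le_max lexx orbT.
exists (2 * `|C| + A0 * r' `^ (sg / 2)).
  by rewrite addr_ge0 ?mulr_ge0 ?powR_ge0.
move=> xi ph xi0; rewrite mulrDl; have [rx|xr] := leP r' (euclidean_norm xi).
  have rx' : r <= euclidean_norm xi by apply: le_trans rx; rewrite le_max lexx.
  have x1 : 1 <= euclidean_norm xi by exact: le_trans rx.
  apply: le_trans (wave_le_fourier xi ph) _.
  apply: (@le_trans _ _ (2 * `|C| * euclidean_norm xi `^ (- (sg / 2)))); last first.
    by rewrite lerDl mulr_ge0 ?mulr_ge0 ?powR_ge0.
  rewrite -mulrA ler_wpM2l//; apply: le_trans (decay xi rx') _.
  apply: (@le_trans _ _ (`|C| * euclidean_norm xi `^ (- (s / 2)))).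
    by rewrite ler_wpM2r ?powR_ge0// ler_norm.
  by rewrite ler_wpM2l// ler_powR// lerN2 ler_pM2r ?invr_gt0// ltW.
apply: (@le_trans _ _ (A0 * r' `^ (sg / 2) * euclidean_norm xi `^ (- (sg / 2)))); last first.
  by rewrite lerDr !mulr_ge0 ?powR_ge0.
apply: (@le_trans _ _ (1 * A0)).
  by apply: (le_Rintegral_torus_norm mfin); [exact: continuous_wave|move=> p; exact: cos_max].
rewrite mul1r -mulrA ler_peMr// powRN ler_pdivlMr ?powR_gt0// mul1r.
apply: ge0_ler_powR; rewrite ?nnegrE ?(ltW xi0) ?(ltW xr)//; first by rewrite divr_ge0// ltW.
by rewrite (le_trans _ r'1).
Qed.

End FourierPushforward.

(** * The endpoint exponent *)

Section LocalExponent.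
Context d0 (T0 : measurableType d0) (R : realType) (P0 : probability T0 R).
Variable W : {RV P0 >-> R}.
Hypothesis KP : minimal_Kahane_Peyriere W.

Let W0 : {ae P0, forall w, 0 <= W w}. Proof. by case: KP. Qed.

Let meanW : (\int[P0]_w (W w)%:E = 1)%E.
Proof. by case: KP => _ + _ _; rewrite unlock. Qed.

(** [W] is nonnegative only almost surely, so [moment_ge1] is applied to its positive part. *)
Lemma moment_fine_ge1 q : 1 < q -> (1 <= \int[P0]_w (W w `^ q)%:E)%E.
Proof.
move=> q1; pose V w := Num.max (W w) 0.
have mV : measurable_fun setT V by exact: measurable_maxr.
have V0 w : 0 <= V w by rewrite le_max lexx orbT.
have WV : {ae P0, forall w, W w = V w} by apply: filterS W0 => w h; rewrite /V max_l.
have meanV : (\int[P0]_w (V w)%:E = 1)%E.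
  rewrite -meanW; apply: ae_eq_integral => //; try exact/measurable_EFinP.
  by apply: filterS WV => w h _; rewrite h.
apply: le_trans (moment_ge1 mV V0 meanV q1) _.
rewrite le_eqVlt; apply/orP; left; apply/eqP; apply: ae_eq_integral => //.
- by apply/measurable_EFinP; exact: (measurableT_comp (measurable_powR q)).
- by apply/measurable_EFinP; exact: (measurableT_comp (measurable_powR q)).
- by apply: filterS WV => w h _; rewrite -h.
Qed.

Lemma local_exponent_termP q : 1 < q ->
  (local_exponent_term W q = 0 \/ exists M, [/\ (\int[P0]_w (W w `^ q)%:E = M%:E)%E, 1 <= M &
    local_exponent_term W q = (q - 1 - log2 M) / q]) /\ local_exponent_term W q <= 1.
Proof.
move=> q1; have q0 : 0 < q by exact: lt_trans q1.
have := moment_fine_ge1 q1; rewrite /local_exponent_term unlock.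
case e : (\int[P0]_w (W w `^ q)%:E)%E => [M| |]//=; last by split=> //; left.
rewrite lee_fin => M1; split; first by right; exists M.
rewrite ler_pdivrMr// mul1r; have : 0 <= log2 M.
  by rewrite divr_ge0// ln_ge0// ler1n.
lra.
Qed.

Let terms := [set Num.max 0 (local_exponent_term W q) | q in [set q : R | 1 < q]].

Let terms_ub : has_ubound terms.
Proof.
exists 1 => _ [q /= q1 <-]; rewrite ge_max ler01 /=.
by have [_] := local_exponent_termP q1.
Qed.

Let terms_nonempty : terms !=set0.
Proof. by exists (Num.max 0 (local_exponent_term W 2)), 2 => //=; rewrite ltr1n. Qed.

Lemma local_exponent_ge0 : 0 <= local_exponent W.
Proof.
have [x [q /= q1 xE]] := terms_nonempty; apply: (@le_trans _ _ x).
  by rewrite -xE le_max lexx.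
by apply: ub_le_sup; [exact: terms_ub|exists q].
Qed.

Lemma local_exponent_le1 : local_exponent W <= 1.
Proof.
apply: ge_sup; first exact: terms_nonempty.
move=> _ [q /= q1 <-]; rewrite ge_max ler01 /=.
by have [_] := local_exponent_termP q1.
Qed.

Lemma local_exponent_upper q M : 1 < q -> (\int[P0]_w (W w `^ q)%:E = M%:E)%E ->
  q - 1 - log2 M <= local_exponent W * q.
Proof.
move=> q1 eM; have q0 : 0 < q by exact: lt_trans q1.
have t : local_exponent_term W q = (q - 1 - log2 M) / q.
  by rewrite /local_exponent_term unlock eM.
rewrite -ler_pdivrMr// -t; apply: (@le_trans _ _ (Num.max 0 (local_exponent_term W q))).
  by rewrite le_max lexx orbT.
by apply: ub_le_sup; [exact: terms_ub|exists q].
Qed.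

(** The last inequality is [a < (q - 1 - log2 M) / q] in logarithmic form, and [a] is the midpoint
    between [s] and that quotient. The moment is finite, since an infinite one gives a term 0, which
    does not exceed [s]. *)
Lemma local_exponent_attained s : 0 <= s -> s < local_exponent W ->
  exists q M a, [/\ 1 < q, (\int[P0]_w (W w `^ q)%:E = M%:E)%E, s < a &
    2 * (2^-1 `^ q * M) * pow2 (a * q) < 1].
Proof.
move=> s0 /(sup_gt terms_nonempty)[_ [q /= q1 <-] sq].
have q0 : 0 < q by exact: lt_trans q1.
have [[t0|[M [eM M1 tM]]] _] := local_exponent_termP q1.
  by move: sq; rewrite t0 maxxx ltNge s0.
have st : s < (q - 1 - log2 M) / q.
  by move: sq; rewrite tM lt_max => /orP[h|//]; move: s0; rewrite leNgt h.
exists q, M, ((s + (q - 1 - log2 M) / q) / 2); split=> //; first by move: st; lra.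
have M0 : 0 < M by exact: lt_le_trans M1.
have ln20 : 0 < ln (2 : R) by rewrite ln_gt0// ltr1n.
have ME : M = pow2 (log2 M).
  by rewrite /pow2 /powR pnatr_eq0 /= /log2 divfK ?gt_eqF// lnK.
have e2 : 2^-1 `^ q = pow2 (- q) :> R.
  by rewrite pow2N /pow2 -powR_inv1// -powRrM mulN1r powRN.
set a := _ / 2.
have -> : 2 * (2^-1 `^ q * M) * pow2 (a * q) = pow2 (1 + - q + log2 M + a * q).
  rewrite !pow2D -ME e2 (_ : pow2 1 = 2); last by rewrite /pow2 powRr1.
  by ring.
rewrite -[ltRHS](pow2_0 R) ltr_pow2.
have : a < (q - 1 - log2 M) / q by rewrite /a; move: st; lra.
rewrite ltr_pdivlMr//; lra.
Qed.

End LocalExponent.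

(** * Passage to nonnegative weights *)

Section PositivePart.
Context (R : realType)
    (d0 : measure_display) (T0 : measurableType d0) (P0 : probability T0 R)
    (W : {RV P0 >-> R})
    (d : measure_display) (T : measurableType d) (P : probability T R)
    (Wv : seq bool -> {RV P >-> R}).
Hypothesis KP : minimal_Kahane_Peyriere W.
Hypothesis IID : iid_copies [set v | v != [::]] W Wv.

(* The weights are nonnegative only almost surely. *)
Let U v t : R := Num.max (Wv v t) 0.
Let V w : R := Num.max (W w) 0.
Let rho (A : set R) : \bar R := P0 [set w | A (V w)].

Lemma positive_part_ge0 v t : 0 <= U v t.
Proof. by rewrite le_max lexx orbT. Qed.

Let mmax : measurable_fun setT (fun y : R => Num.max y 0).
Proof. exact: measurable_maxr. Qed.

Lemma iid_positive_part : iid_field P rho U.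
Proof.
case: IID => law ind; split=> [v|J A J0 mA].
  by apply: (measurableT_comp mmax).
have mA' v : measurable ((fun y : R => Num.max y 0) @^-1` A v).
  by rewrite -[X in measurable X]setTI; exact: mmax.
have JD : [set` J] `<=` [set v | v != [::]].
  by move=> v /= vJ; apply: contraNneq J0 => <-.
have -> : [set t | forall v, v \in J -> A v (U v t)] =
    \bigcap_(v in [set` J]) Wv v @^-1` ((fun y : R => Num.max y 0) @^-1` A v).
  by apply/seteqP; split=> t /= h v; exact: h.
apply: etrans (ind J (fun v => (fun y : R => Num.max y 0) @^-1` A v) JD mA') _.
apply: eq_big_seq => v vJ; exact: (law v (JD v vJ) _ (mA' v)).
Qed.

Let integral_positive_part_ge0 (f : R -> \bar R) : measurable_fun setT f ->
  (forall x, 0 <= f x)%E ->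
  (\int[P]_t f (U [:: true] t) = \int[P0]_w f (V w))%E.
Proof.
move=> mf f0; case: IID => law _.
have mfm : measurable_fun setT (fun y : R => f (Num.max y 0)) by exact: measurableT_comp.
have e1 := @ge0_integral_pushforward _ _ _ _ R (Wv [:: true]) (measurable_funPT (Wv [:: true])) P setT _ measurableT mfm (fun y _ => f0 _).
have e2 := @ge0_integral_pushforward _ _ _ _ R W (measurable_funPT W) P0 setT _ measurableT mfm (fun y _ => f0 _).
rewrite preimage_setT in e1; rewrite preimage_setT in e2.
rewrite -[LHS]e1 -[RHS]e2; apply: eq_setfun_integral => A mA.
exact: (law [:: true] isT A mA).
Qed.

Let WV : {ae P0, forall w, V w = W w}.
Proof. by case: KP => h _ _ _; apply: filterS h => w h; rewrite /V max_l. Qed.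

Let mV : measurable_fun setT V. Proof. exact: (measurableT_comp mmax). Qed.

Lemma integral_copy (f : R -> R) : measurable_fun setT f ->
  (\int[P]_t (f (U [:: true] t))%:E = \int[P0]_w (f (W w))%:E)%E.
Proof.
move=> mf; transitivity (\int[P0]_w (f (V w))%:E)%E; last first.
  apply: ae_eq_integral => //.
  - by apply/measurable_EFinP; exact: measurableT_comp.
  - by apply/measurable_EFinP; exact: measurableT_comp.
  - by apply: filterS WV => w h _; rewrite h.
pose fE := (EFin \o f).
have mfE : measurable_fun setT fE by exact/measurable_EFinP.
have hp := integral_positive_part_ge0 (measurable_funepos mfE) (funepos_ge0 fE).
have hn := integral_positive_part_ge0 (measurable_funeneg mfE) (funeneg_ge0 fE).
rewrite integralE [RHS]integralE; congr (_ - _)%E.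
- rewrite -[LHS]/(\int[P]_t ((fun t => fE (U [:: true] t))^\+ t))%E.
  transitivity (\int[P]_t (fE^\+ (U [:: true] t)))%E; first by apply: eq_integral => t _; rewrite !funeposE.
  by rewrite hp; apply: eq_integral => t _; rewrite !funeposE.
- transitivity (\int[P]_t (fE^\- (U [:: true] t)))%E; first by apply: eq_integral => t _; rewrite !funenegE.
  by rewrite hn; apply: eq_integral => t _; rewrite !funenegE.
Qed.

Lemma mean_copy : (\int[P]_t (U [:: true] t)%:E = 1)%E.
Proof. by rewrite (integral_copy (f := id))//; case: KP => _ + _ _; rewrite unlock. Qed.

Lemma moment_copy q : (\int[P]_t (U [:: true] t `^ q)%:E = \int[P0]_w (W w `^ q)%:E)%E.
Proof. by rewrite (integral_copy (f := fun x => x `^ q))//; exact: measurable_powR. Qed.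

Lemma supersolution_copy sg : local_exponent W < sg ->
  supersolution P (fun t => pow2 sg / 2 * U [:: true] t) /\
  exists delta, 0 < delta /\ (0 < P [set t | (expR delta <= pow2 sg / 2 * U [:: true] t)%R])%E.
Proof.
move=> Asg; have sg0 : 0 < sg by exact: le_lt_trans (local_exponent_ge0 KP) Asg.
have mU : measurable_fun setT (U [:: true]) by exact: iid_positive_part.1.
have U0 := positive_part_ge0 [:: true].
have mlog : measurable_fun setT (fun x : R => log2 x).
  by apply: measurable_funM => //; exact: measurable_ln.
have ent_pos : (\int[P]_t (U [:: true] t * Num.max (log2 (U [:: true] t)) 0)%:E < +oo)%E.
  rewrite (integral_copy (f := fun x => x * Num.max (log2 x) 0)); last first.
    by apply: measurable_funM => //; exact: measurable_maxr.
  by case: KP => _ _ + _; rewrite unlock.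
have ent : (\int[P]_t (U [:: true] t * log2 (U [:: true] t))%:E < 1)%E.
  rewrite (integral_copy (f := fun x => x * log2 x)); last exact: measurable_funM.
  by case: KP => _ _ _; rewrite unlock.
have expo q M : 1 < q -> (\int[P]_t (U [:: true] t `^ q)%:E = M%:E)%E ->
    q - 1 - log2 M <= local_exponent W * q.
  by move=> q1; rewrite moment_copy; exact: local_exponent_upper.
have [delta [delta0 Zd]] := moment_exceeds mU U0 mean_copy Asg expo.
split; last by exists delta.
apply: (@supersolution_exists _ _ _ P _ delta) => //; first exact: measurable_funM.
by move=> q q0; exact: (moment_growth mU U0 mean_copy ent_pos ent Asg sg0 expo q0).
Qed.

End PositivePart.

(** * The Fourier dimension *)

Lemma mass_agree (R : realType) (w w' : seq bool -> R) v : agree w w' -> mass w v = mass w' v.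
Proof.
move=> ww'; rewrite /mass /weight; congr (_ / _); apply: eq_bigr => j _; apply: ww'.
by case: v j => [[]|].
Qed.

Lemma pick_antiderivative (R : realType) (I : Type) (f : I -> bool -> R -> R) :
  (forall i p, continuous (f i p)) ->
  exists F : I -> bool -> R -> R, forall i p (t : R), is_derive t 1 (F i p) (f i p t).
Proof.
move=> cf; have h (ip : I * bool) : exists F : R -> R, forall t : R, is_derive t 1 F (f ip.1 ip.2 t).
  exact: antiderivative.
by have [F hF] := choice h; exists (fun i p => F (i, p)) => i p; exact: (hF (i, p)).
Qed.

Section CascadeOnCurve.
Context (R : realType)
    (d0 : measure_display) (T0 : measurableType d0) (P0 : probability T0 R)
    (W : {RV P0 >-> R})
    (d : measure_display) (T : measurableType d) (P : probability T R)
    (Wv : seq bool -> {RV P >-> R}) (mu : R.-ker T ~> torus R)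
    (gamma : torus R -> R * R).
Hypothesis KP : minimal_Kahane_Peyriere W.
Hypothesis IID : iid_copies [set v | v != [::]] W Wv.
Hypothesis casc : is_cascade Wv mu.
Hypothesis curve : nondegenerate_C2_Jordan_curve gamma.

Let U v t : R := Num.max (Wv v t) 0.
Let U0 v t : 0 <= U v t.
Proof. exact: positive_part_ge0. Qed.

Let iidU := iid_positive_part IID.

Let mfin t : (mu t [set: torus R] < +oo)%E.
Proof. exact: casc.1. Qed.

Let cgamma : continuous gamma.
Proof. by case: curve. Qed.

Lemma ae_weights_ge0 : {ae P, forall t v, v != [::] -> 0 <= Wv v t}.
Proof.
have h v : {ae P, forall t, v != [::] -> 0 <= Wv v t}.
  have [->|v0] := eqVneq v [::]; first exact: aeW.
  have mA : measurable (Wv v @^-1` `]-oo, 0[ : set T).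
    by rewrite -[X in measurable X]setTI; exact: measurable_funPT.
  exists (Wv v @^-1` `]-oo, 0[); split => //; last first.
    by move=> t /=; rewrite in_itv /= ltNge => h; apply/negP => h'; apply: h.
  have := IID.1 v v0 `]-oo, 0[%classic (measurable_itv _); rewrite /distribution /pushforward => ->.
  have mA0 : measurable (W @^-1` `]-oo, 0[ : set T0).
    by rewrite -[X in measurable X]setTI; exact: measurable_funPT.
  case: KP => W0 _ _ _; apply: measure_negligible => //; apply: negligibleS W0 => t /=.
  by rewrite in_itv /= => h; apply/negP; rewrite -ltNge.
have := ae_foralln (fun n => h (word_of_nat n)); apply: filterS => t ht v.
by have [n <-] := word_of_nat_surj v; exact: ht.
Qed.

(** Weak convergence in the form used everywhere: integrals against the steps of the cascade are
    expressed by antiderivatives. *)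
Definition tested_by (m : {measure set (torus R) -> \bar R}) (w : seq bool -> R) :=
  forall (f : torus R -> R) (F : R -> R), continuous f ->
  (forall x : R, is_derive x 1 F (f (to_torus x))) ->
  cascade_integral w n F @[n --> \oo] --> \int[m]_p f p.

Lemma ae_tested : {ae P, forall t, tested_by (mu t) (U ^~ t)}.
Proof.
apply: filterS2 ae_weights_ge0 casc.2 => t W0 wc f F cf dF.
have agr : agree (U ^~ t) (Wv ^~ t) by move=> v v0; rewrite /U max_l// W0.
have := wc f cf; rewrite (Rintegral_torusE (mfin t) cf).
rewrite (_ : (fun n => _) = (fun n => (cascade_integral (U ^~ t) n F)%:E)).
  by move=> /fine_cvgP[_].
apply/funext => n; rewrite (cascade_step_integral W0 n cf dF); congr EFin.
by apply: eq_bigr => v _; rewrite (mass_agree _ agr).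
Qed.

Let cvgU : {ae P, forall t, cvgn (total_mass (U ^~ t))}.
Proof.
apply: filterS ae_tested => t ht; apply/cvg_ex; exists (fine (mu t setT)).
exact: (total_mass_cvg_torus ht).
Qed.

(** A sequence of exponents [sg n] decreasing to the endpoint yields one null set for all [s]. Decay
    with [s] beyond the endpoint gives decay with some [sg n] and hence bounded scores, against
    [ae_unbounded_score]. *)
Lemma ae_fourier_decay_le : {ae P, forall t, (0 < mu t [set: torus R])%E ->
  forall s C r : R, s <= 2 -> (forall xi, r <= euclidean_norm xi ->
    ComplexField.Normc.normc (fourier (pushforward (mu t) gamma) xi) <=
      C * euclidean_norm xi `^ (- (s / 2))) -> s <= local_exponent W}.
Proof.
pose sg (n : nat) : R := local_exponent W + n.+1%:R^-1.
have Asg n : local_exponent W < sg n by rewrite ltrDl invr_gt0.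
have [x1 [x2 [y1 [y2 [z1 [z2 [B [c co]]]]]]]] := curve_coordinates curve.
have unb n : {ae P, forall t, 0 < limit_mass (U ^~ t) -> unbounded_score (sg n) (U ^~ t)}.
  have [ss [delta [delta0 Zd]]] := supersolution_copy KP IID (Asg n).
  exact: (ae_unbounded_score iidU U0 cvgU delta0 Zd ss).
apply: filterS3 (ae_foralln unb) ae_tested (ae_regular iidU cvgU) => t hu ht hr mu0 s C r s2 decay.
rewrite leNgt; apply/negP => As.
have [n ns] : exists n, sg n < s.
  exists (Num.truncn (s - local_exponent W)^-1); rewrite /sg -ltrBrDl.
  rewrite -[ltRHS]invrK ltf_pV2 ?posrE ?invr_gt0 ?subr_gt0//; exact: truncnS_gt.
have sg0 : 0 < sg n by exact: le_lt_trans (local_exponent_ge0 KP) (Asg n).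
have [D D0 hD] := wave_decay_all (mfin t) cgamma sg0 ns decay.
have w0 v : v != [::] -> 0 <= U v t by [].
have sg2 : sg n < 2 by exact: lt_le_trans s2.
have [K hK] := score_le_of_decay (mfin t) ht w0 cgamma (coordE co) (coord_dx1 co) (coord_dx2 co)
  (coord_dy1 co) (coord_dy2 co) (coord_B0 co) (coord_zB co) (coord_speed co) D0 sg0 sg2 hD.
have lm : 0 < limit_mass (U ^~ t).
  by rewrite (limit_mass_torus ht) fine_gt0// mu0 mfin.
have [v] := hu n lm (Num.truncn `|K|).+1.
apply/negP; rewrite -leNgt; apply: le_trans (hK v (hr v)) _.
by apply: le_trans (ler_norm _) _; apply: ltW; exact: truncnS_gt.
Qed.

Lemma ae_fourier_decay_lt (s : R) : 0 < s -> s < local_exponent W ->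
  {ae P, forall t (sg : R), 0 < sg -> sg < s -> exists C : R, forall xi, 2 <= euclidean_norm xi ->
    ComplexField.Normc.normc (fourier (pushforward (mu t) gamma) xi) <=
      C * euclidean_norm xi `^ (- (sg / 2))}.
Proof.
move=> s0 sA; have [q [M [a [q1 eM sa a_lt]]]] := local_exponent_attained KP (ltW s0) sA.
have s1 : s <= 1 by apply: ltW; exact: lt_le_trans (local_exponent_le1 KP).
have [x1 [x2 [y1 [y2 [z1 [z2 [B [c co]]]]]]]] := curve_coordinates curve.
pose ph (p : bool) : R := if p then - (pi / 2) else 0.
have cw xi p : continuous (wave gamma xi (ph p)) by exact: continuous_wave.
have [prim dprim] := pick_antiderivative
  (f := fun xi p t => wave gamma xi (ph p) (to_torus t)) (fun xi p => continuous_comp_to_torus (cw xi p)).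
have f1 xi p (t : R) : `|wave gamma xi (ph p) (to_torus t)| <= 1 by exact: cos_max.
have eM' : (\int[P]_t (U [:: true] t `^ q)%:E = M%:E)%E by rewrite (moment_copy KP IID).
have fE xi p (t : R) : wave gamma xi (ph p) (to_torus t) =
    cos (2 * pi * (x1 t * xi.1 + x2 t * xi.2) + (if p then - (pi / 2) else 0)).
  by rewrite /wave (coordE co).
have := ae_decay iidU U0 (mean_copy KP IID) q1 eM' a_lt s0 sa s1 dprim f1
  (coord_dx1 co) (coord_dx2 co) (coord_dy1 co) (coord_dy2 co) (coord_cz1 co) (coord_cz2 co)
  (coord_B0 co) (coord_yB co) (coord_zB co) (coord_c0 co) (coord_det co) fE.
apply: filterS2 ae_tested => t ht [C [C0 hC]] sg sg0 sgs.
have grid_decay (L j k : nat) (p : bool) : (j < 2 ^ (2 * L + 4))%N -> (k < 2 ^ (2 * L + 4))%N ->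
    2 ^+ L <= 2 * pi * euclidean_norm (grid R L j k) ->
    2 * pi * euclidean_norm (grid R L j k) <= 2 ^+ (L + 5) ->
    `|\int[mu t]_x wave gamma (grid R L j k) (ph p) x| <=
      C * L.+1%:R ^+ 2 * pow2 (- (L%:R * (s / 2))).
  move=> jL kL lamL lamU.
  have h := ht _ _ (cw (grid R L j k) p) (dprim (grid R L j k) p).
  have hn : `|cascade_integral (U ^~ t) n (prim (grid R L j k) p)| @[n --> \oo] -->
      `|\int[mu t]_x wave gamma (grid R L j k) (ph p) x| by exact: cvg_norm.
  apply: (cvgr_to_le hn); near=> n; apply: (hC L j k p n jL kL lamL lamU).
  by apply: (@leq_trans n); [near: n; exact: nbhs_infty_ge|exact: leq_addr].
have sg2 : sg <= 2 by apply: le_trans (ltW sgs) (le_trans s1 _); rewrite ler1n.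
have [C' C'0 hC'] := wave_decay (mfin t) cgamma (coord_xB co) C0 sg0 sgs sg2 grid_decay.
exists (2 * C') => xi xi2; apply: le_trans (fourier_le (mfin t) cgamma xi) _.
apply: le_trans (lerD (hC' xi false xi2) (hC' xi true xi2)) _.
by rewrite -mulrA [leRHS]mulrDl !mul1r.
Unshelve. all: by end_near.
Qed.

(** Exponents [s n] increasing to the endpoint again reduce uncountably many [sg] to one null
    set. *)
Lemma ae_fourier_decay : {ae P, forall t (sg : R), 0 < sg -> sg < local_exponent W ->
  exists C : R, forall xi, 2 <= euclidean_norm xi ->
    ComplexField.Normc.normc (fourier (pushforward (mu t) gamma) xi) <=
      C * euclidean_norm xi `^ (- (sg / 2))}.
Proof.
have [A0|A0] := leP (local_exponent W) 0.
  by apply: aeW => t sg /lt_trans h /h; rewrite ltNge A0.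
(* [n.+2] instead of [n.+1], so that already [s 0] is positive. *)
pose s (n : nat) : R := local_exponent W - local_exponent W / n.+2%:R.
have s0 n : 0 < s n by rewrite subr_gt0 gtr_pMr// invf_lt1// ltr1n.
have sA n : s n < local_exponent W by rewrite gtrBl divr_gt0.
apply: filterS (ae_foralln (fun n => ae_fourier_decay_lt (s0 n) (sA n))) => t h sg sg0 sgA.
pose n := Num.truncn (local_exponent W / (local_exponent W - sg)).
apply: (h n) => //; rewrite /s ltrBrDl -ltrBrDr ltr_pdivrMr// mulrC -ltr_pdivrMr ?subr_gt0//.
apply: lt_trans (truncnS_gt _) _; by rewrite ltr_nat.
Qed.

(** The exponent 0 is always admissible, by the total mass, so the supremum is over a nonempty set
    and a vanishing endpoint exponent is covered. The endpoint is at most 1, so the cap 2 does not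
    interfere. *)
Lemma ae_fourier_dimension : {ae P, forall t, (0 < mu t [set: torus R])%E ->
  fourier_dimension (pushforward (mu t) gamma) = local_exponent W}.
Proof.
apply: filterS2 ae_fourier_decay_le ae_fourier_decay => t upper lower mu0.
rewrite /fourier_dimension; set S := [set s | _].
have SA : ubound S (local_exponent W).
  by move=> s [/andP[_ s2] [C [r h]]]; exact: (upper mu0 s C r).
have S0 : S 0.
  split; first by rewrite lexx ler0n.
  exists (2 * fine (mu t setT)), 0 => xi _; rewrite mul0r oppr0 powRr0 mulr1.
  apply: le_trans (fourier_le (mfin t) cgamma xi) _.
  rewrite mulr_natl mulr2n; apply: lerD; rewrite -[leRHS]mul1r;
    apply: (le_Rintegral_torus_norm (mfin t)); by [exact: continuous_wave|move=> p; exact: cos_max].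
apply/eqP; rewrite eq_le; apply/andP; split; first by apply: ge_sup => //; exists 0.
apply/ler_addgt0Pr => e e0; rewrite -lerBlDr.
have ubS : has_ubound S by exists (local_exponent W).
have [h|h] := leP (local_exponent W - e) 0; first by apply: le_trans h _; exact: ub_le_sup.
apply: ub_le_sup => //; have eA : local_exponent W - e < local_exponent W by rewrite gtrBl.
have [C hC] := lower _ h eA; split; last by exists C, 2.
by have := local_exponent_le1 KP; rewrite (ltW h) /=; move: (local_exponent W) => A; lra.
Qed.

End CascadeOnCurve.

Theorem theorem1p4 (R : realType)
    (d0 : measure_display) (T0 : measurableType d0) (P0 : probability T0 R)
    (W : {RV P0 >-> R})
    (d : measure_display) (T : measurableType d) (P : probability T R)
    (Wv : seq bool -> {RV P >-> R}) (mu : R.-ker T ~> torus R)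
    (gamma : torus R -> R * R) :
  minimal_Kahane_Peyriere W ->
  iid_copies [set v | v != [::]] W Wv ->
  is_cascade Wv mu ->
  nondegenerate_C2_Jordan_curve gamma ->
  let mu_gamma : T -> set (R * R) -> \bar R :=
    fun w => pushforward (mu w) gamma in
  let S_gamma : set T := [set w | (0 < mu w [set: torus R])%E] in
  {ae P, forall w, S_gamma w ->
    fourier_dimension (mu_gamma w) = local_exponent W} /\
  (0 < local_exponent W ->
    {ae P, forall w, S_gamma w ->
      forall sigma : R, 0 < sigma < local_exponent W ->
        exists C r : R, forall xi : R * R, r <= euclidean_norm xi ->
          ComplexField.Normc.normc (fourier (mu_gamma w) xi) <=
            C * euclidean_norm xi `^ (- (sigma / 2))}).
Proof.
move=> KP IID casc curve /=; split; first exact: (ae_fourier_dimension KP IID casc curve).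
move=> A0; apply: filterS (ae_fourier_decay KP IID casc curve) => t h _ sg /andP[sg0 sgA].
by have [C hC] := h sg sg0 sgA; exists C, 2.
Qed.
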